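(* Let $\varphi_n\colon\mathbb S^d_+\times\mathbb R^d\to[0,\infty]$, $n\in\mathbb N$, be functions and $$H_n(a,b):=\sup_{(\tilde a,\tilde b)\in\mathbb S^d_+\times\mathbb R^d}\Big(\tfrac12\mathrm{tr}(a\tilde a)+b^T\tilde b-\varphi_n(\tilde a,\tilde b)\Big),\qquad(a,b)\in\mathbb R^{d\times d}\times\mathbb R^d.$$ Suppose: for every $n\in\mathbb N$ there exists $(a,b)\in\mathbb S^d_+\times\mathbb R^d$ with $\varphi_n(a,b)=0$; $\lim_{|a|+|b|\to\infty}\inf_{n\in\mathbb N}\frac{\varphi_n(a,b)}{|a|+|b|}=\infty$; and there exists $H\colon\mathbb R^{d\times d}\times\mathbb R^d\to\mathbb R$ with $\lim_{n\to\infty}\sup_{(a,b)\in K}|H_n(a,b)-H(a,b)|=0$ for all compact $K\subset\mathbb R^{d\times d}\times\mathbb R^d$. Then there exists a sequence $(S_n)_{n\in\mathbb N}$ of strongly continuous convex monotone semigroups $(S_n(t))_{t\ge0}$ on $C_b(\mathbb R^d)$ with generators $A_n\colon D(A_n)\to C_b(\mathbb R^d)$ such that $C_b^\infty(\mathbb R^d)\subset D(A_n)$ and $A_nf=H_n(D^2f,Df)$ for all $n\in\mathbb N$ and $f\in C_b^\infty(\mathbb R^d)$, and such that the following conditions hold: (1) For every $r,T\ge0$ there is $c\ge0$ with $\|S_n(t)f-S_n(t)g\|_\infty\le c\|f-g\|_\infty$ for all $n$, $t\in[0,T]$ and $f,g\in C_b(\mathbb R^d)$ with $\|f\|_\infty,\|g\|_\infty\le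 r$. (2) For every $\epsilon>0$, $r,T\ge0$ and compact $K\subset\mathbb R^d$ there are $c\ge0$ and a compact $K'\subset\mathbb R^d$ with $\|S_n(t)f-S_n(t)g\|_{\infty,K}\le c\|f-g\|_{\infty,K'}+\epsilon$ for all $n$, $t\in[0,T]$ and $f,g\in C_b(\mathbb R^d)$ with $\|f\|_\infty,\|g\|_\infty\le r$. (3) There is a countable set $\mathcal D_0\subset C_b(\mathbb R^d)$ such that for every $f\in\mathcal D_0$ there exist $\bar f_n\in D(A_n)$ with $\bar f_n\to f$ and $\|\bar f_n\|_\infty\le\|f\|_\infty$ for all $n$ such that $(A_n\bar f_n)$ converges in $C_b(\mathbb R^d)$ and, for every $t\ge0$, there exist $\bar t_n\ge0$ with $\bar t_n\to t$ such that $(S_n(\bar t_n)\bar f_n)_{n}$ is uniformly equicontinuous; moreover, for every $f\in C_b(\mathbb R^d)$ there is $(f_n)\subset\mathcal D_0$ with $f_n\to f$ and $\|f_n\|_\infty\le\|f\|_\infty$ for all $n$. (4) For every $f\in\mathrm{Lip}_b(\mathbb R^d)$ and $\epsilon>0$ there exist $\delta,t_0>0$ and $f_n\in C_b(\mathbb R^d)$ with $f_n\to f$ such that $S_n(t)(\tau_xf_n)\le\tau_xS_n(t)f_n+\epsilon t$ for all $n$, $t\in[0,t_0]$ and $|x|\le\delta$. (5) For every $f\in\mathrm{Lip}_b(\mathbb R^d)$ there exist $r,t_0>0$ with $S_n(t)f\in\mathrm{Lip}_b(\mathbb R^d,r)$ for all $n$ and $t\in[0,t_0]$. (6) For every $f\in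 C_b^\infty(\mathbb R^d)$ there exist $f_n\in D(A_n)$ with $f_n\to f$ such that $(A_nf_n)$ converges in $C_b(\mathbb R^d)$. Hence, there exists another strongly continuous convex monotone semigroup $(S(t))_{t\ge0}$ on $C_b(\mathbb R^d)$ with generator $A\colon D(A)\to C_b(\mathbb R^d)$ such that $$S(t)f=\lim_{n\to\infty}S_n(t)f\quad\text{for all }(f,t)\in C_b(\mathbb R^d)\times\mathbb R_+,$$ satisfying $C_b^\infty(\mathbb R^d)\subset D(A)$ and $Af=H(D^2f,Df)$ for all $f\in C_b^\infty(\mathbb R^d)$.
   Context: $\mathbb S^d_+$ is the set of symmetric positive semi-definite $d\times d$ matrices; $Df$ is the gradient and $D^2f$ the Hessian of $f$; $\mathbb R_+:=[0,\infty)$. $C_b(\mathbb R^d)$ is the space of bounded continuous $f:\mathbb R^d\to\mathbb R$ with the mixed topology (strongest locally convex topology coinciding on $\|\cdot\|_\infty$-bounded sets with the topology of uniform convergence on compacts); for sequences, $f_n\to f$ iff $\sup_n\|f_n\|_\infty<\infty$ and $\|f-f_n\|_{\infty,K}:=\sup_{x\in K}|f(x)-f_n(x)|\to0$ for all compact $K$. All limits in $C_b(\mathbb R^d)$ refer to it. $f\le g$ is pointwise and $f_n\downarrow f$ means pointwise decreasing convergence. $\mathrm{Lip}_b(\mathbb R^d)$: bounded Lipschitz functions; $\mathrm{Lip}_b(\mathbb R^d,r)$: $r$-Lipschitz functions with sup norm at most $r$; $C_b^\infty(\mathbb R^d)$: bounded infinitely differentiable functions with all derivatives bounded; $(\tau_xf)(y):=f(x+y)$.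 A sequence $(f_n)$ is uniformly equicontinuous if for every $\epsilon>0$ there is $\delta>0$ with $|f_n(x)-f_n(y)|<\epsilon$ for all $n$ and $|x-y|<\delta$. A strongly continuous convex monotone semigroup on $C_b(\mathbb R^d)$ is a family $(S(t))_{t\ge0}$ of operators on $C_b(\mathbb R^d)$ such that: each $S(t)$ is monotone ($f\le g\Rightarrow S(t)f\le S(t)g$) and convex ($S(t)(\lambda f+(1-\lambda)g)\le\lambda S(t)f+(1-\lambda)S(t)g$, $\lambda\in[0,1]$) with $S(t)f_n\downarrow0$ whenever $f_n\downarrow0$; $S(0)f=f$ and $S(s+t)f=S(s)S(t)f$; $\sup_{t\in[0,T]}\|S(t)r\|_\infty<\infty$ for all constants $r,T\ge0$; $\lim_{t\downarrow0}S(t)f=f$ for all $f$. Its generator is $f\mapsto\lim_{h\downarrow0}\frac{S(h)f-f}h$ with domain the set of $f$ for which this limit exists in $C_b(\mathbb R^d)$. *)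

(* Defs.v *)
From HB Require Import structures.
From mathcomp Require Import all_boot all_order all_algebra.
From mathcomp Require Import all_classical all_reals all_analysis.
Set Implicit Arguments.
Unset Strict Implicit.
Unset Printing Implicit Defensive.
Import Order.TTheory GRing.Theory Num.Theory.
Import numFieldNormedType.Exports.
Local Open Scope classical_set_scope.
Local Open Scope ring_scope.

(* R^d is 'rV[R]_d.  Its library norm is the max norm, which is used only for
   the topology; |x| in the statement is the Euclidean (Frobenius) norm. *)
Definition enorm {R : realType} {m n : nat} (a : 'M[R]_(m, n)) : R :=
  Num.sqrt (\sum_i \sum_j a i j ^+ 2).

Definition psd {R : realType} {d : nat} (a : 'M[R]_d) : Prop :=
  a^T = a /\ forall x : 'rV[R]_d, 0 <= (x *m a *m x^T) ord0 ord0.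

(* sup_{x in K} |F x| as an element of [0, +oo]; adjoining 0 only fixes the
   value for K empty. *)
Definition esup_abs {R : realType} {T : Type} (K : set T) (F : T -> \bar R) :
    \bar R :=
  ereal_sup (0%E |` [set `|F x|%E | x in K]).

Definition norm_on {R : realType} {T : Type} (K : set T) (f : T -> R) : \bar R :=
  esup_abs K (fun x => (f x)%:E).

Definition supnorm {R : realType} {T : Type} (f : T -> R) : \bar R :=
  norm_on [set: T] f.

Section BoundedContinuous.
Context {R : realType} {d : nat}.
Local Notation X := 'rV[R]_d.
Implicit Types (f g l : X -> R) (u : nat -> X -> R).

Definition Cb f : Prop :=
  continuous f /\ exists M : R, forall x, `|f x| <= M.

(* Sequential convergence in C_b(R^d) for the mixed topology. *)
Definition cvgCb u l : Prop :=
  [/\ forall n, Cb (u n),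
      Cb l,
      exists M : R, forall n, (supnorm (u n) <= M%:E)%E &
      forall K : set X, compact K ->
        (fun n => norm_on K (l \- u n)) @ \oo --> 0%E].

(* lim_{h decreasing to 0} v h = l in C_b(R^d).  The right neighbourhoods of 0
   have a countable base, so in any topological space this limit is
   characterised by sequences. *)
Definition cvgCb_at_right0 (v : R -> X -> R) l : Prop :=
  forall h : nat -> R, (forall k, 0 < h k) -> h @ \oo --> (0 : R) ->
    cvgCb (fun k => v (h k)) l.

Definition decreases_to0 u : Prop :=
  forall x, (forall m n, (m <= n)%N -> u n x <= u m x) /\
            (fun n => u n x) @ \oo --> (0 : R).

Definition translate (x : X) f : X -> R := fun y => f (x + y).

Definition lipschitz_with (r : R) f : Prop :=
  forall x y, `|f x - f y| <= r * enorm (x - y).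

Definition Lipb_le (r : R) f : Prop :=
  lipschitz_with r f /\ (supnorm f <= r%:E)%E.

Definition Lipb f : Prop :=
  Cb f /\ exists r : R, lipschitz_with r f.

Definition partial (i : 'I_d) f : X -> R :=
  fun x => 'D_(delta_mx ord0 i) f x.

Definition iter_partial (s : seq 'I_d) f : X -> R := foldr partial f s.

(* All iterated partial derivatives exist and are continuous and bounded. *)
Definition Cb_infty f : Prop :=
  forall s : seq 'I_d, Cb (iter_partial s f) /\
    forall (i : 'I_d) (x : X), derivable (iter_partial s f) x (delta_mx ord0 i).

Definition gradient f (x : X) : 'rV[R]_d := \row_i partial i f x.

Definition hessian f (x : X) : 'M[R]_d :=
  \matrix_(i, j) partial i (partial j f) x.

Definition uniformly_equicontinuous u : Prop :=
  forall e : R, 0 < e -> exists2 del : R, 0 < del &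
    forall n x y, enorm (x - y) < del -> `|u n x - u n y| < e.

(* The operators are total maps on functions; only their values at times
   t >= 0 and at elements of C_b(R^d) are constrained or used. *)
Record convex_monotone_semigroup (S : R -> (X -> R) -> X -> R) : Prop := {
  cms_Cb : forall (t : R) f, 0 <= t -> Cb f -> Cb (S t f);
  cms_monotone : forall (t : R) f g, 0 <= t -> Cb f -> Cb g ->
    (forall x, f x <= g x) -> forall x, S t f x <= S t g x;
  cms_convex : forall (t : R) f g (lam : R), 0 <= t -> Cb f -> Cb g ->
    0 <= lam <= 1 -> forall x,
    S t (fun y => lam * f y + (1 - lam) * g y) x
      <= lam * S t f x + (1 - lam) * S t g x;
  cms_cont_above : forall (t : R) u, 0 <= t -> (forall n, Cb (u n)) ->
    decreases_to0 u -> decreases_to0 (fun n => S t (u n));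
  cms_0 : forall f, Cb f -> S 0 f = f;
  cms_add : forall (s t : R) f, 0 <= s -> 0 <= t -> Cb f ->
    S (s + t) f = S s (S t f);
  cms_bounded : forall r T : R, 0 <= r -> 0 <= T ->
    exists M : R, forall t : R, 0 <= t <= T -> (supnorm (S t (cst r)) <= M%:E)%E;
  cms_strongly_continuous : forall f, Cb f ->
    cvgCb_at_right0 (fun t => S t f) f
}.

(* Graph of the generator A: f belongs to D(A) and A f = g. *)
Definition generator (S : R -> (X -> R) -> X -> R) f g : Prop :=
  Cb f /\ cvgCb_at_right0 (fun h x => (S h f x - f x) / h) g.

Definition hamiltonian (phi : 'M[R]_d * 'rV[R]_d -> \bar R)
    (p : 'M[R]_d * 'rV[R]_d) : \bar R :=
  ereal_sup [set ((\tr (p.1 *m q.1) / 2 + (p.2 *m q.2^T) ord0 ord0)%:E - phi q)%E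
            | q in [set q : 'M[R]_d * 'rV[R]_d | psd q.1]].

End BoundedContinuous.

(* Main.v *)
Require Import Defs.
From HB Require Import structures.
From mathcomp Require Import all_boot all_order all_algebra.
From mathcomp Require Import all_classical all_reals all_analysis.
From mathcomp Require Import ring lra.
Set Implicit Arguments.
Unset Strict Implicit.
Unset Printing Implicit Defensive.
Import Order.TTheory GRing.Theory Num.Theory.
Import numFieldNormedType.Exports.
Local Open Scope classical_set_scope.
Local Open Scope ring_scope.

(** The semigroup of index n is the value function of a stochastic control
  problem: the controls are a covariance a and a drift b, with running cost
  phi n (a, b), and H_n is its Hamiltonian.  Instead of solving the Bellman
  equation, the value function is constructed by time discretization.  In one
  step of length h the controller picks (a, b) and pays h phi n (a, b); the
  state moves by h b and by a symmetric jump of covariance h a.  The supremum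
  over the controls is an operator step that is monotone, convex and translation invariant
  and commutes with the addition of constants.  The hypotheses on phi n enter only
  through a common modulus of coercivity rho, and so do all constants below,
  which are therefore uniform in n.

  Consistency.  Coercivity makes large controls unprofitable, and on bounded
  controls a Taylor expansion gives step v = v + h H_n (D^2 v, D v) up to
  O(h^(3/2)) for smooth v (step_consistent).  The same expansion holds over
  several steps with error e t, where t is their total length
  (multi_consistent).

  Comparison.  By convexity and translation invariance the step satisfies
  Jensen's inequality for convolutions.  Mollifying the iterates of one scheme
  therefore yields smooth supersolutions, with which any other scheme can be
  compared by consistency (comparison).  Two schemes with fine steps and with
  Hamiltonians that are close on a large ball are thus uniformly close on
  Lipschitz functions (scheme_cauchy).  With a fixed n this gives convergence
  as the step size tends to 0, and for varying n it makes the sequence of the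
  limit semigroups a Cauchy sequence.  The argument replaces the uniqueness of
  viscosity solutions.

  Tightness.  To pass from Lipschitz to continuous functions, the values on a
  ball must be controlled by the data on a larger ball.  A capped parabola of
  large radius is almost a supersolution, and convexity allows to add a small
  multiple of it (step_tight).  Together with continuity in time this defines
  the class regular_family, which is closed under limits and consists of
  strongly continuous semigroups as soon as the semigroup law holds.

  Generators.  Consistency is uniform on bounded sets of smooth functions, so
  it survives both limits and identifies the generators.  The remaining
  conditions follow with constant sequences: the operators are contractions
  that commute with translations and hence preserve Lipschitz constants, and
  mollified rational splines form the countable dense set. *)

(** * Norms and averages on the line *)

Section Norms.
Context {R : realType}.

Lemma mx_entry_le m n (A : 'M[R]_(m, n)) i j : `|A i j| <= `|A|.
Proof.
have -> : `|A| = mx_norm A by []; rewrite mx_normrE.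
by apply: (le_bigmax_cond _ (fun ij : 'I_m * 'I_n => `|A ij.1 ij.2|) (j := (i, j))).
Qed.

Lemma mx_norm_leP m n (A : 'M[R]_(m, n)) (c : R) : 0 <= c ->
  (forall i j, `|A i j| <= c) -> `|A| <= c.
Proof.
move=> c0 H; have -> : `|A| = mx_norm A by []; rewrite mx_normrE.
by apply/bigmax_leP; split => // -[i j] _; exact: H.
Qed.

Lemma norm_delta_mx n (i : 'I_n) : `|delta_mx ord0 i : 'rV[R]_n| <= 1.
Proof.
apply: mx_norm_leP => // k j; rewrite mxE.
by case: (_ && _); rewrite ?normr1 ?normr0.
Qed.

Lemma lipschitz_continuous (V W : normedModType R) (f : V -> W) (L : R) :
  (forall x y, `|f x - f y| <= L * `|x - y|) -> continuous f.
Proof.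
move=> Lf x; apply/cvgrPdist_lt => e e0.
have L1 : 0 < `|L| + 1 by rewrite ltr_wpDl.
near=> y.
apply: le_lt_trans (Lf _ _) _.
apply: (@le_lt_trans _ _ ((`|L| + 1) * `|x - y|)).
  by apply: ler_wpM2r => //; rewrite (le_trans (ler_norm L)) ?lerDl.
rewrite mulrC -ltr_pdivlMr //.
near: y; apply: cvgr_dist_lt => //; exact: divr_gt0.
Unshelve. all: by end_near. Qed.

Lemma mean_value (G g : R -> R) (a b : R) : a <= b ->
  (forall s, a <= s <= b -> is_derive s 1 G (g s)) ->
  exists c, a <= c <= b /\ G b - G a = g c * (b - a).
Proof.
move=> ab dG.
have [|s|c cab ->] := @MVT_segment _ G g a b ab.
- by move=> x /itvP xab; apply: dG; rewrite !xab.
- apply: continuous_in_subspaceT => x; rewrite inE /= in_itv/= => xab.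
  have dx := dG _ xab; apply: differentiable_continuous.
  by apply/derivable1_diffP; exact: ex_derive.
- by exists c; split; [move: cab; rewrite in_itv|].
Qed.

End Norms.

Section Averages.
Context {R : realType}.
Notation mu := (@lebesgue_measure R).

Definition primitive (g : R -> R) (s : R) : R :=
  (\int[mu]_(u in `[-1, s]) g u)%R.

Lemma primitiveP (g : R -> R) : continuous g ->
  forall s : R, 0 <= s -> is_derive s 1 (primitive g) (g s).
Proof.
move=> cg s s0.
have ss : s < s + 1 by rewrite ltrDl.
have ig : mu.-integrable `[-1, s + 1] (EFin \o g).
  apply: continuous_compact_integrable; first exact: segment_compact.
  exact: continuous_subspaceT.
have s1 : -1 < s by rewrite (lt_le_trans _ s0) // ltrN10.
have [dG Gs] := continuous_FTC1_closed ss ig s1 (cg s).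
apply: DeriveDef; first exact: dG.
by rewrite -derive1E; exact: Gs.
Qed.

Definition average (e : R) (g : R -> R) : R := (primitive g e - primitive g 0) / e.

(** Only the increment of a primitive matters, and by the mean value theorem it
  does not depend on the primitive. *)
Lemma averageE (e : R) (g G : R -> R) : continuous g -> 0 < e ->
  (forall s : R, 0 <= s <= e -> is_derive s 1 G (g s)) ->
  average e g = (G e - G 0) / e.
Proof.
move=> cg e0 dG; congr (_ / _).
have [||c [_ E]] := @mean_value R (primitive g \- G) (fun s => g s - g s) 0 e.
- exact: ltW.
- move=> s /[dup] /andP[s0 _] se.
  have ? := primitiveP cg s0; have ? := dG _ se; exact: is_deriveB.
- by move: E; rewrite subrr mul0r => /=; lra.
Qed.

Lemma average_mvt (e : R) (g : R -> R) : continuous g -> 0 < e ->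
  exists c, 0 <= c <= e /\ average e g = g c.
Proof.
move=> cg e0; have [||c [ce E]] := @mean_value R (primitive g) g 0 e.
- exact: ltW.
- by move=> s /andP[s0 _]; exact: primitiveP.
by exists c; split => //; rewrite /average E subr0 mulfK // gt_eqF.
Qed.

Lemma average_lin (e a b : R) (g1 g2 : R -> R) : continuous g1 -> continuous g2 -> 0 < e ->
  average e (fun s => a * g1 s + b * g2 s) = a * average e g1 + b * average e g2.
Proof.
move=> c1 c2 e0.
have cg : continuous (fun s => a * g1 s + b * g2 s).
  move=> x; apply: cvgD; apply: cvgM; (try exact: cvg_cst);
    [exact: c1|exact: c2].
have dG (s : R) : 0 <= s <= e ->
    is_derive s 1 (fun s => a * primitive g1 s + b * primitive g2 s) (a * g1 s + b * g2 s).
  move=> /andP[s0 _].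
  have ? := primitiveP c1 s0; have ? := primitiveP c2 s0.
  have ? : is_derive s 1 (fun s => a * primitive g1 s) (a * g1 s).
    exact: (@is_deriveZ R R R^o (primitive g1)).
  have ? : is_derive s 1 (fun s => b * primitive g2 s) (b * g2 s).
    exact: (@is_deriveZ R R R^o (primitive g2)).
  exact: is_deriveD.
rewrite (averageE cg e0 dG) /average; field; by rewrite gt_eqF.
Qed.

Lemma le_average (e : R) (g1 g2 : R -> R) : continuous g1 -> continuous g2 -> 0 < e ->
  (forall s : R, 0 <= s <= e -> g1 s <= g2 s) -> average e g1 <= average e g2.
Proof.
move=> c1 c2 e0 le12.
have c12 : continuous (fun s => 1 * g2 s + (-1) * g1 s).
  by move=> x; apply: cvgD; apply: cvgM; (try exact: cvg_cst);
    [exact: c2|exact: c1].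
have [c [ce]] := average_mvt c12 e0.
rewrite average_lin // => E; have := le12 _ ce; lra.
Qed.

Lemma average_cst (e c : R) : 0 < e -> average e (fun=> c) = c.
Proof. by move=> /(average_mvt (@cst_continuous _ _ c))[x []]. Qed.

Lemma average_shift (e : R) (g : R -> R) (t : R) : continuous g -> 0 < e -> 0 <= t ->
  average e (fun s => g (t + s)) = (primitive g (t + e) - primitive g t) / e.
Proof.
move=> cg e0 t0.
have ct : continuous (fun s => g (t + s)).
  by move=> x; apply: continuous_comp; [apply: cvgD; [exact: cvg_cst|exact: cvg_id]|exact: cg].
have dG (s : R) : 0 <= s <= e ->
    is_derive s 1 (fun s => primitive g (t + s)) (g (t + s)).
  move=> /andP[s0 _].
  have ts : 0 <= t + s by rewrite addr_ge0.
  have ? := primitiveP cg ts.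
  rewrite -[g _]mulr1; apply: is_derive1_comp.
  rewrite -[X in is_derive _ _ _ X]add0r; exact: is_deriveD.
by rewrite (averageE ct e0 dG) addr0.
Qed.

(** The average over the interval from t to t + e has derivative (g (t + e) -
  g t) / e in t, and this quotient is Lipschitz because g is: averaging gains
  one order of smoothness. *)
Lemma average_derivative (e : R) (g : R -> R) (L t : R) : 0 < e -> 0 <= t ->
  (forall x y, `|g x - g y| <= L * `|x - y|) ->
  `|average e (fun s => g (t + s)) - average e g - t * ((g e - g 0) / e)|
    <= 2 * L / e * t ^+ 2.
Proof.
move=> e0 t0 Lg; have cg := @lipschitz_continuous R R^o R^o g L Lg.
rewrite average_shift // /average.
have [||c [ct E1]] := @mean_value R (primitive g) g e (t + e).
- by rewrite lerDr.
- by move=> s /andP[s0 _]; apply: primitiveP => //; apply: le_trans s0; exact: ltW.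
have [||c' [ct' E2]] := @mean_value R (primitive g) g 0 t.
- by [].
- by move=> s /andP[s0 _]; exact: primitiveP.
have -> : (primitive g (t + e) - primitive g t) / e
    - (primitive g e - primitive g 0) / e - t * ((g e - g 0) / e)
    = t / e * ((g c - g e) - (g c' - g 0)).
  have -> : primitive g (t + e) = primitive g e + g c * (t + e - e) by lra.
  have -> : primitive g t = primitive g 0 + g c' * (t - 0) by lra.
  by field; rewrite gt_eqF.
rewrite normrM ger0_norm; last by rewrite divr_ge0 // ltW.
have L0 : 0 <= L.
  by have := Lg 1 0; rewrite subr0 normr1 mulr1; exact: le_trans.
have B1 : `|g c - g e| <= L * t.
  by apply: le_trans (Lg _ _) _; apply: ler_wpM2l => //;
    rewrite ger0_norm; move: ct => /andP[]; lra.
have B2 : `|g c' - g 0| <= L * t.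
  by apply: le_trans (Lg _ _) _; apply: ler_wpM2l => //;
    rewrite ger0_norm; move: ct' => /andP[]; lra.
apply: (@le_trans _ _ (t / e * (L * t + L * t))).
  apply: ler_wpM2l; first by rewrite divr_ge0 // ltW.
  by rewrite (le_trans (ler_normB _ _)) // lerD.
have -> : t / e * (L * t + L * t) = 2 * L / e * t ^+ 2 by field; rewrite gt_eqF.
by [].
Qed.

End Averages.

(** * Mollification by averages *)

Section Smoothing.
Context {R : realType} {d : nat}.
Local Notation X := 'rV[R]_d.
Local Notation "''e_' i" := (delta_mx ord0 i : X) (at level 8, i at level 2).
Implicit Types (f g : X -> R) (B C e : R).

Lemma subrDr (x y z : X) : x + z - (y + z) = x - y.
Proof. by rewrite opprD addrACA subrr addr0. Qed.

Definition BL C f : Prop :=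
  (forall x, `|f x| <= C) /\ (forall x y, `|f x - f y| <= C * `|x - y|).

Lemma BL_ge0 C f : BL C f -> 0 <= C.
Proof. by move=> [H _]; exact: le_trans (H 0). Qed.

Lemma le_BL C C' f : C <= C' -> BL C f -> BL C' f.
Proof.
move=> CC [H1 H2]; split=> [x|x y]; first exact: le_trans (H1 x) _.
by apply: le_trans (H2 x y) _; exact: ler_wpM2r.
Qed.

Lemma BL_lin a b C C' f g : BL C f -> BL C' g ->
  BL (`|a| * C + `|b| * C') (fun x => a * f x + b * g x).
Proof.
move=> [f1 f2] [g1 g2]; split=> [x|x y].
  by rewrite (le_trans (ler_normD _ _)) // !normrM lerD // ler_wpM2l.
have -> : a * f x + b * g x - (a * f y + b * g y)
  = a * (f x - f y) + b * (g x - g y) by lra.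
rewrite (le_trans (ler_normD _ _)) // !normrM mulrDl -!mulrA.
by rewrite lerD // ler_wpM2l.
Qed.

Lemma BL_shift C f z : BL C f -> BL C (fun x => f (x + z)).
Proof.
move=> [f1 f2]; split=> [x|x y]; first exact: f1.
by apply: le_trans (f2 _ _) _; rewrite subrDr.
Qed.

Lemma BL_cst c : BL `|c| (fun=> c).
Proof. by split=> [//|x y]; rewrite subrr normr0 mulr_ge0. Qed.

Lemma BL_line C f x (v : X) (s t : R) : BL C f ->
  `|f (x + s *: v) - f (x + t *: v)| <= C * `|v| * `|s - t|.
Proof.
move=> [_ f2]; apply: le_trans (f2 _ _) _.
have -> : x + s *: v - (x + t *: v) = (s - t) *: v.
  by rewrite scalerBl opprD addrACA subrr add0r.
by rewrite normrZ -mulrA [`|v| * _]mulrC.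
Qed.

Lemma BL_line_continuous C f x (v : X) : BL C f ->
  continuous (fun s : R => f (x + s *: v)).
Proof.
move=> fC; apply: (@lipschitz_continuous R R^o R^o _ (C * `|v|)) => s t.
exact: BL_line.
Qed.
Arguments BL_line_continuous {C f} x v.

(** The properties of the convolution with a probability measure. *)
Record averaging (A : (X -> R) -> X -> R) : Prop := {
  av_BL : forall C f, BL C f -> BL C (A f);
  av_lin : forall a b C C' f g, BL C f -> BL C' g -> forall x,
    A (fun y => a * f y + b * g y) x = a * A f x + b * A g x;
  av_le : forall C C' f g, BL C f -> BL C' g -> (forall x, f x <= g x) ->
    forall x, A f x <= A g x;
  av_shift : forall f z x, A (fun y => f (y + z)) x = A f (x + z);
  av_cst : forall c x, A (fun=> c) x = c
}.

Lemma averaging_id : averaging id.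
Proof. by split. Qed.

Lemma averaging_comp A A' : averaging A -> averaging A' -> averaging (A \o A').
Proof.
move=> hA hA'; split => /=.
- by move=> C f /(av_BL hA') /(av_BL hA).
- move=> a b C C' f g fC gC x.
  rewrite -(av_lin hA a b (av_BL hA' fC) (av_BL hA' gC)); congr (A _ x).
  by apply/funext => y; exact: (av_lin hA' a b fC gC).
- move=> C C' f g fC gC fg x; apply: (av_le hA (av_BL hA' fC) (av_BL hA' gC)).
  exact: (av_le hA' fC gC).
- move=> f z x; rewrite -(av_shift hA); congr (A _ x).
  by apply/funext => y; rewrite (av_shift hA').
- move=> c x; have -> : A' (fun=> c) = fun=> c.
    by apply/funext => y; rewrite (av_cst hA').
  by rewrite (av_cst hA).
Qed.

Lemma av_near A C f g K : averaging A -> BL C f -> BL C g ->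
  (forall x, `|f x - g x| <= K) -> forall x, `|A f x - A g x| <= K.
Proof.
move=> hA fC gC fg x.
have fgC := BL_lin 1 (-1) fC gC.
have -> : A f x - A g x = A (fun y => 1 * f y + (-1) * g y) x.
  by rewrite (av_lin hA _ _ fC gC); lra.
rewrite ler_norml; apply/andP; split.
  rewrite -[leLHS](av_cst hA (- K) x).
  apply: (av_le hA (BL_cst _) fgC) => y.
  by have := fg y; rewrite ler_norml => /andP[]; lra.
rewrite -[leRHS](av_cst hA K x).
apply: (av_le hA fgC (BL_cst _)) => y.
by have := fg y; rewrite ler_norml => /andP[]; lra.
Qed.

Definition dir_average e i f x : R := average e (fun s => f (x + s *: 'e_i)).

Lemma averaging_dir_average e i : 0 < e -> averaging (dir_average e i).
Proof.
move=> e0; split.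
- move=> C f fC; split=> [x|x y].
    have [c [_]] := average_mvt (BL_line_continuous x 'e_i fC) e0.
    by rewrite /dir_average => ->; exact: (proj1 fC).
  have cx := BL_line_continuous x 'e_i fC; have cy := BL_line_continuous y 'e_i fC.
  have cB : continuous (fun s : R => 1 * f (x + s *: 'e_i) + (-1) * f (y + s *: 'e_i)).
    by move=> s; apply: cvgD; apply: cvgM; (try exact: cvg_cst);
      [exact: cx|exact: cy].
  have [c [_]] := average_mvt cB e0.
  rewrite average_lin // => E.
  have -> : dir_average e i f x - dir_average e i f y =
     f (x + c *: 'e_i) - f (y + c *: 'e_i) by rewrite /dir_average; lra.
  by apply: le_trans (proj2 fC _ _) _; rewrite subrDr.
- move=> a b C C' f g fC gC x; rewrite /dir_average average_lin //;
    [exact: BL_line_continuous fC|exact: BL_line_continuous gC].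
- move=> C C' f g fC gC fg x; apply: le_average => //;
    [exact: BL_line_continuous fC|exact: BL_line_continuous gC].
- move=> f z x; rewrite /dir_average; congr (average e _).
  by apply/funext => s; rewrite addrAC.
- by move=> c x; exact: average_cst.
Qed.

Lemma dir_average_near e i C f : 0 < e -> BL C f ->
  forall x, `|dir_average e i f x - f x| <= C * e.
Proof.
move=> e0 fC x.
have [c [/andP[c0 ce]]] := average_mvt (BL_line_continuous x 'e_i fC) e0.
rewrite /dir_average => ->.
have := BL_line x 'e_i c 0 fC; rewrite scale0r addr0 => /le_trans; apply.
rewrite -mulrA; apply: ler_wpM2l; first exact: BL_ge0 fC.
rewrite subr0 (ger0_norm c0) -[leRHS]mul1r; apply: ler_pM => //.
exact: norm_delta_mx.
Qed.

(** A derivative with a uniform quadratic remainder. In this form it passes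
  through averages, which are linear and monotone and commute with
  translations. *)
Definition has_partial B i f g : Prop :=
  forall x (t : R), `|f (x + t *: 'e_i) - f x - t * g x| <= B * t ^+ 2.

Lemma av_has_partial A B B' i f g : averaging A -> BL B f -> BL B' g ->
  has_partial B i f g -> has_partial B i (A f) (A g).
Proof.
move=> hA fB gB fg x t.
have fsB := BL_shift (t *: 'e_i) fB.
have h1B := BL_lin 1 (-1) fsB fB.
have h2B := BL_lin 1 (- t) h1B gB.
rewrite -(av_shift hA).
have -> : A (fun y => f (y + t *: 'e_i)) x - A f x - t * A g x =
    A (fun y => 1 * (1 * f (y + t *: 'e_i) + (-1) * f y) + (- t) * g y) x.
  by rewrite (av_lin hA _ _ h1B gB) (av_lin hA _ _ fsB fB); lra.
have cB := BL_cst (B * t ^+ 2).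
rewrite ler_norml; apply/andP; split.
  rewrite -[leLHS](av_cst hA _ x).
  apply: (av_le hA (BL_cst _) h2B) => y.
  by have := fg y t; rewrite ler_norml => /andP[]; lra.
rewrite -[leRHS](av_cst hA _ x).
apply: (av_le hA h2B (BL_cst _)) => y.
by have := fg y t; rewrite ler_norml => /andP[]; lra.
Qed.

Lemma le_has_partial B B' i f g : B <= B' -> has_partial B i f g ->
  has_partial B' i f g.
Proof.
move=> BB H x t; apply: le_trans (H x t) _; apply: ler_wpM2r => //.
exact: sqr_ge0.
Qed.

(** The derivatives are only asserted to exist, so that smoothness propagates
  through averages without naming them. *)
Fixpoint smooth (k : nat) B f : Prop :=
  BL B f /\ if k is k'.+1 then
    forall i, exists2 g, has_partial B i f g & smooth k' B g
  else True.

Lemma smooth_BL k B f : smooth k B f -> BL B f.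
Proof. by case: k => [|k] []. Qed.

Lemma le_smooth k B B' f : B <= B' -> smooth k B f -> smooth k B' f.
Proof.
move=> BB; elim: k f => [|k IH] f /= [fB H]; split => //; try exact: le_BL fB.
by move=> i; have [g fg gB] := H i; exists g; [exact: le_has_partial fg|exact: IH].
Qed.

Lemma smooth_lin k a b B B' f g : smooth k B f -> smooth k B' g ->
  smooth k (`|a| * B + `|b| * B') (fun x => a * f x + b * g x).
Proof.
elim: k f g => [|k IH] f g [fB f1] [gB g1]; split => //; try exact: BL_lin.
move=> i; have [f' ff' f'B] := f1 i; have [g' gg' g'B] := g1 i.
exists (fun x => a * f' x + b * g' x); last exact: IH.
move=> x t.
have -> : a * f (x + t *: 'e_i) + b * g (x + t *: 'e_i) - (a * f x + b * g x)
    - t * (a * f' x + b * g' x)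
  = a * (f (x + t *: 'e_i) - f x - t * f' x)
    + b * (g (x + t *: 'e_i) - g x - t * g' x) by lra.
rewrite (le_trans (ler_normD _ _)) // !normrM mulrDl -!mulrA.
by apply: lerD; apply: ler_wpM2l; [by []|exact: ff'|by []|exact: gg'].
Qed.

Lemma smooth_shift k B f z : smooth k B f -> smooth k B (fun x => f (x + z)).
Proof.
elim: k f => [|k IH] f [fB f1]; split => //; try exact: BL_shift.
move=> i; have [f' ff' f'B] := f1 i.
exists (fun x => f' (x + z)); last exact: IH.
by move=> x t; have := ff' (x + z) t; rewrite [x + z + _]addrAC.
Qed.

Lemma av_smooth A k B f : averaging A -> smooth k B f -> smooth k B (A f).
Proof.
move=> hA; elim: k f => [|k IH] f [fB f1]; split => //; try exact: (av_BL hA).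
move=> i; have [g fg gB] := f1 i; exists (A g); last exact: IH.
exact: av_has_partial hA fB (smooth_BL gB) fg.
Qed.

Lemma dir_average_has_partial e i B f : 0 < e -> BL B f ->
  has_partial (4 * B / e) i (dir_average e i f)
    (fun x => e^-1 * f (x + e *: 'e_i) + (- e^-1) * f x).
Proof.
move=> e0 fB.
have B0 := BL_ge0 fB.
have pos x (t : R) : 0 <= t ->
    `|dir_average e i f (x + t *: 'e_i) - dir_average e i f x
      - t * ((f (x + e *: 'e_i) - f x) / e)| <= 2 * B / e * t ^+ 2.
  move=> t0.
  have Lf (s u : R) : `|f (x + s *: 'e_i) - f (x + u *: 'e_i)| <= B * `|s - u|.
    apply: le_trans (BL_line x 'e_i s u fB) _; rewrite -mulrA.
    apply: ler_wpM2l => //; rewrite -[leRHS]mul1r; apply: ler_wpM2r => //.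
    exact: norm_delta_mx.
  have := @average_derivative R e (fun s => f (x + s *: 'e_i)) B t e0 t0 Lf.
  have -> : (fun s : R => f (x + (t + s) *: 'e_i)) =
            (fun s : R => f (x + t *: 'e_i + s *: 'e_i)).
    by apply/funext => s; rewrite scalerDl addrA.
  by rewrite scale0r addr0 /dir_average.
move=> x t; have [t0|t0] := leP 0 t.
  have -> : e^-1 * f (x + e *: 'e_i) + - e^-1 * f x = (f (x + e *: 'e_i) - f x) / e.
    by lra.
  apply: le_trans (pos x t t0) _; apply: ler_wpM2r; first exact: sqr_ge0.
  by apply: ler_wpM2r; [rewrite invr_ge0 ltW|lra].
have nt0 : 0 <= - t by lra.
have := pos (x + t *: 'e_i) (- t) nt0.
rewrite scaleNr addrK sqrrN => H1.
have H2 : `|(f (x + e *: 'e_i) - f (x + t *: 'e_i + e *: 'e_i)) / e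
            - (f x - f (x + t *: 'e_i)) / e| <= 2 * B / e * - t.
  have Lt y : `|f y - f (y + t *: 'e_i)| <= B * - t.
    have := BL_line y 'e_i 0 t fB; rewrite scale0r addr0 => /le_trans; apply.
    rewrite sub0r ger0_norm // -mulrA; apply: ler_wpM2l => //.
    by rewrite -[leRHS]mul1r; apply: ler_wpM2r => //; exact: norm_delta_mx.
  rewrite -mulrBl normrM [`|e^-1|]gtr0_norm ?invr_gt0 //.
  have -> : 2 * B / e * - t = (B * - t + B * - t) / e by lra.
  apply: ler_wpM2r; first by rewrite invr_ge0 ltW.
  rewrite (le_trans (ler_normB _ _)) // lerD //.
  by rewrite addrAC; exact: Lt.
have -> : dir_average e i f (x + t *: 'e_i) - dir_average e i f x
    - t * (e^-1 * f (x + e *: 'e_i) + - e^-1 * f x)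
  = - (dir_average e i f x - dir_average e i f (x + t *: 'e_i)
        - - t * ((f (x + t *: 'e_i + e *: 'e_i) - f (x + t *: 'e_i)) / e))
    + (- t) * ((f (x + e *: 'e_i) - f (x + t *: 'e_i + e *: 'e_i)) / e
            - (f x - f (x + t *: 'e_i)) / e) by lra.
rewrite (le_trans (ler_normD _ _)) // normrN normrM (ger0_norm nt0).
have -> : 4 * B / e * t ^+ 2 = 2 * B / e * t ^+ 2 + (- t) * (2 * B / e * - t).
  by field; rewrite gt_eqF.
by rewrite lerD // ler_wpM2l.
Qed.

Fixpoint dir_averages e (s : seq 'I_d) f : X -> R :=
  if s is i :: s' then dir_average e i (dir_averages e s' f) else f.

Lemma averaging_dir_averages e s : 0 < e -> averaging (dir_averages e s).
Proof.
move=> e0; elim: s => [|i s IH]; first exact: averaging_id.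
exact: (averaging_comp (averaging_dir_average i e0) IH).
Qed.

Lemma dir_averages_near e s C f : 0 < e -> BL C f ->
  forall x, `|dir_averages e s f x - f x| <= (size s)%:R * C * e.
Proof.
move=> e0 fC; elim: s => [|i s IH] x /=; first by rewrite subrr normr0 !mul0r.
have H := dir_average_near i e0 (av_BL (averaging_dir_averages s e0) fC) x.
have := IH x; rewrite -natr1 !mulrDl mul1r => H2.
have -> : dir_average e i (dir_averages e s f) x - f x =
  (dir_averages e s f x - f x) + (dir_average e i (dir_averages e s f) x - dir_averages e s f x) by lra.
by rewrite (le_trans (ler_normD _ _)) // lerD.
Qed.

(** The average in direction i turns the i-th derivative into a difference
  quotient of the other averages; those commute with translations and keep all
  smoothness. *)
Lemma dir_averages_partial e s k B f i : 0 < e -> smooth k B f -> i \in s ->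
  exists2 g, has_partial (B * (1 + 4 / e)) i (dir_averages e s f) g
           & smooth k (B * (1 + 4 / e)) g.
Proof.
move=> e0 fB; have B0 := BL_ge0 (smooth_BL fB).
have ei0 : 0 <= e^-1 by rewrite invr_ge0 ltW.
have Be : 0 <= B * e^-1 by rewrite mulr_ge0.
elim: s => [//|j s IH]; rewrite inE.
have FB : smooth k B (dir_averages e s f).
  by apply: av_smooth fB; exact: averaging_dir_averages.
case/orP => [/eqP ->|/IH [g fg gB]].
  exists (fun x => e^-1 * dir_averages e s f (x + e *: 'e_j) + (- e^-1) * dir_averages e s f x).
    apply: le_has_partial (dir_average_has_partial j e0 (smooth_BL FB)).
    by lra.
  apply: le_smooth (smooth_lin e^-1 (- e^-1) (smooth_shift (e *: 'e_j) FB) FB).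
  by rewrite normrN ger0_norm //; lra.
have hA := averaging_dir_average j e0.
exists (dir_average e j g); last exact: av_smooth gB.
apply: av_has_partial hA _ (smooth_BL gB) fg.
apply: le_BL (smooth_BL FB); rewrite mulrDr mulr1; lra.
Qed.

Lemma dir_averages_smooth e k B f : 0 < e -> smooth k B f ->
  smooth k.+1 (B * (1 + 4 / e)) (dir_averages e (enum 'I_d) f).
Proof.
move=> e0 fB; have B0 := BL_ge0 (smooth_BL fB); split.
  apply: le_BL (av_BL (averaging_dir_averages _ e0) (smooth_BL fB)).
  by rewrite mulrDr mulr1 lerDl mulr_ge0 // divr_ge0 // ltW.
by move=> i; apply: dir_averages_partial => //; rewrite mem_enum.
Qed.

(** Every round of averages in all directions gains one order of smoothness;
  second derivatives need two rounds. *)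
Definition mollify e f : X -> R :=
  dir_averages e (enum 'I_d) (dir_averages e (enum 'I_d) f).

Lemma averaging_mollify e : 0 < e -> averaging (mollify e).
Proof.
move=> e0; have h := averaging_dir_averages (enum 'I_d) e0.
by apply: averaging_comp.
Qed.

Lemma mollify_near e C f : 0 < e -> BL C f ->
  forall x, `|mollify e f x - f x| <= 2 * d%:R * C * e.
Proof.
move=> e0 fC x; have h := averaging_dir_averages (enum 'I_d) e0.
have H1 := dir_averages_near (enum 'I_d) e0 fC x.
have H2 := dir_averages_near (enum 'I_d) e0 (av_BL h fC) x.
rewrite size_enum_ord in H1 H2.
have -> : mollify e f x - f x = (mollify e f x - dir_averages e (enum 'I_d) f x)
   + (dir_averages e (enum 'I_d) f x - f x) by lra.
rewrite (le_trans (ler_normD _ _)) //.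
have -> : 2 * d%:R * C * e = d%:R * C * e + d%:R * C * e by lra.
exact: lerD.
Qed.

Lemma mollify_smooth e C f : 0 < e -> BL C f ->
  smooth 2 (C * (1 + 4 / e) * (1 + 4 / e)) (mollify e f).
Proof. by move=> e0 fC; do 2 apply: dir_averages_smooth => //; split. Qed.

End Smoothing.

(** * Uniform Taylor expansions *)

Section Taylor.
Context {R : realType} {d : nat}.
Local Notation X := 'rV[R]_d.
Local Notation "''e_' i" := (delta_mx ord0 i : X) (at level 8, i at level 2).
Implicit Types (f g v : X -> R) (B C e : R) (p : X -> X) (Q : X -> 'M[R]_d).

Definition dot (p y : X) : R := \sum_i p ord0 i * y ord0 i.
Definition quad (Q : 'M[R]_d) (y : X) : R :=
  \sum_i \sum_j y ord0 i * Q i j * y ord0 j.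

Lemma dotDr (p y z : X) : dot p (y + z) = dot p y + dot p z.
Proof. by rewrite -big_split; apply: eq_bigr => i _; rewrite mxE mulrDr. Qed.

Lemma dotZr (p : X) (t : R) (y : X) : dot p (t *: y) = t * dot p y.
Proof. by rewrite mulr_sumr; apply: eq_bigr => i _; rewrite mxE mulrCA. Qed.

Lemma dotBl (p q y : X) : dot (p - q) y = dot p y - dot q y.
Proof. by rewrite -sumrB; apply: eq_bigr => i _; rewrite !mxE mulrBl. Qed.

Lemma quadZ (Q : 'M[R]_d) (t : R) y : quad Q (t *: y) = t ^+ 2 * quad Q y.
Proof.
rewrite mulr_sumr; apply: eq_bigr => i _; rewrite mulr_sumr.
by apply: eq_bigr => j _; rewrite !mxE; ring.
Qed.

Lemma ler_sum_ord n (F : 'I_n -> R) c :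
  (forall i, F i <= c) -> \sum_i F i <= n%:R * c.
Proof.
move=> H; apply: (@le_trans _ _ (\sum_(i < n) c)); first exact: ler_sum.
by rewrite sumr_const card_ord mulr_natl.
Qed.

Lemma norm_dot (p y : X) : `|dot p y| <= d%:R * (`|p| * `|y|).
Proof.
apply: le_trans (ler_norm_sum _ _ _) _.
apply: ler_sum_ord => i; rewrite normrM.
by apply: ler_pM => //; exact: mx_entry_le.
Qed.

Lemma norm_quad (Q : 'M[R]_d) (y : X) : `|quad Q y| <= d%:R ^+ 2 * (`|Q| * `|y| ^+ 2).
Proof.
apply: le_trans (ler_norm_sum _ _ _) _.
rewrite expr2 -mulrA; apply: ler_sum_ord => i.
apply: le_trans (ler_norm_sum _ _ _) _.
apply: ler_sum_ord => j; rewrite !normrM.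
rewrite [`|Q| * _]mulrC expr2 mulrAC -!mulrA; apply: ler_pM => //.
- exact: mx_entry_le.
- by apply: ler_pM => //; exact: mx_entry_le.
Qed.

(** The C^2-functions with Lipschitz second derivatives, through their Taylor
  expansions with remainders that are uniform in the base point and in the
  increment; every later estimate inherits this uniformity. *)
Record taylor B v p Q : Prop := {
  ty_v : BL B v;
  ty_1 : forall x y, `|v (x + y) - v x - dot (p x) y| <= B * `|y| ^+ 2;
  ty_2 : forall x y,
    `|v (x + y) - v x - dot (p x) y - quad (Q x) y / 2| <= B * `|y| ^+ 3;
  ty_p : (forall x, `|p x| <= B) /\ (forall x y, `|p x - p y| <= B * `|x - y|);
  ty_Q : (forall x, `|Q x| <= B) /\ (forall x y, `|Q x - Q y| <= B * `|x - y|)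
}.

Lemma le_taylor B B' v p Q : B <= B' -> taylor B v p Q -> taylor B' v p Q.
Proof.
move=> BB [H0 H1 H2 [H3 H4] [H5 H6]].
have M (z : R) : 0 <= z -> B * z <= B' * z by move=> ?; exact: ler_wpM2r.
split; first exact: le_BL H0.
- by move=> x y; apply: le_trans (H1 x y) (M _ _); exact: exprn_ge0.
- by move=> x y; apply: le_trans (H2 x y) (M _ _); exact: exprn_ge0.
- split=> [x|x y]; first exact: le_trans (H3 x) _.
  exact: le_trans (H4 x y) (M _ _).
- split=> [x|x y]; first exact: le_trans (H5 x) _.
  exact: le_trans (H6 x y) (M _ _).
Qed.

Lemma taylor_lin a b B B' v w p q P Q : taylor B v p P -> taylor B' w q Q ->
  taylor (`|a| * B + `|b| * B') (fun x => a * v x + b * w x)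
    (fun x => a *: p x + b *: q x) (fun x => a *: P x + b *: Q x).
Proof.
move=> [H0 H1 H2 [H3 H4] [H5 H6]] [K0 K1 K2 [K3 K4] [K5 K6]].
have dotE x y : dot (a *: p x + b *: q x) y = a * dot (p x) y + b * dot (q x) y.
  rewrite /dot !mulr_sumr -big_split; apply: eq_bigr => i _.
  by rewrite !mxE /=; ring.
have quadE x y : quad (a *: P x + b *: Q x) y = a * quad (P x) y + b * quad (Q x) y.
  rewrite /quad !mulr_sumr -big_split; apply: eq_bigr => i _ /=.
  rewrite !mulr_sumr -big_split; apply: eq_bigr => j _.
  by rewrite !mxE /=; ring.
have tri (V : normedModType R) (u1 u2 : V) c1 c2 z : `|u1| <= c1 * z -> `|u2| <= c2 * z ->
   `|a *: u1 + b *: u2| <= (`|a| * c1 + `|b| * c2) * z.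
  move=> h1 h2; rewrite (le_trans (ler_normD _ _)) // !normrZ mulrDl -!mulrA.
  by apply: lerD; apply: ler_wpM2l.
split; first exact: BL_lin.
- move=> x y; rewrite dotE.
  have := tri R^o _ _ _ _ _ (H1 x y) (K1 x y); rewrite /GRing.scale /=.
  by congr (`|_| <= _); lra.
- move=> x y; rewrite dotE quadE.
  have := tri R^o _ _ _ _ _ (H2 x y) (K2 x y); rewrite /GRing.scale /=.
  by congr (`|_| <= _); lra.
- split=> [x|x y].
    have := tri X (p x) (q x) B B' 1; rewrite !mulr1; exact.
  have -> : a *: p x + b *: q x - (a *: p y + b *: q y)
     = a *: (p x - p y) + b *: (q x - q y) by rewrite !scalerBr opprD addrACA.
  exact: tri.
- split=> [x|x y].
    have := tri 'M[R]_d (P x) (Q x) B B' 1; rewrite !mulr1; exact.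
  have -> : a *: P x + b *: Q x - (a *: P y + b *: Q y)
     = a *: (P x - P y) + b *: (Q x - Q y) by rewrite !scalerBr opprD addrACA.
  exact: tri.
Qed.

(** Moving along the coordinate axes one after the other. *)
Lemma partials_expansion B f (g : 'I_d -> X -> R) :
  (forall i, has_partial B i f (g i)) -> (forall i, BL B (g i)) -> 0 <= B ->
  forall x y, `|f (x + y) - f x - \sum_i g i x * y ord0 i| <= d%:R ^+ 2 * B * `|y| ^+ 2.
Proof.
move=> fg gB B0 x y.
have main (s : seq 'I_d) : forall x,
    `|f (x + \sum_(i <- s) y ord0 i *: 'e_i) - f x - \sum_(i <- s) g i x * y ord0 i|
      <= (size s)%:R ^+ 2 * (B * `|y| ^+ 2).
  elim: s => [|j s IH] z.
    by rewrite !big_nil addr0 !subrr normr0 expr0n mul0r.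
  rewrite !big_cons addrA.
  set z' := z + y ord0 j *: 'e_j.
  have H1 := IH z'; have H2 := fg j z (y ord0 j); rewrite -/z' in H2.
  have H3 : `|\sum_(i <- s) (g i z' - g i z) * y ord0 i| <= (size s)%:R * (B * `|y| ^+ 2).
    apply: le_trans (ler_norm_sum _ _ _) _.
    apply: (@le_trans _ _ (\sum_(i <- s) B * `|y| ^+ 2)).
      apply: ler_sum => i _; rewrite normrM expr2 mulrA; apply: ler_pM => //.
        apply: le_trans (proj2 (gB i) _ _) _; apply: ler_wpM2l => //.
        rewrite /z' addrAC subrr add0r normrZ -[leRHS]mulr1.
        by apply: ler_pM => //; [exact: mx_entry_le|exact: norm_delta_mx].
      exact: mx_entry_le.
    by rewrite big_const_seq count_predT iter_addr_0 mulr_natl.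
  have H4 : B * y ord0 j ^+ 2 <= B * `|y| ^+ 2.
    apply: ler_wpM2l => //; rewrite -real_normK ?num_real //.
    by rewrite lerXn2r ?nnegrE //; exact: mx_entry_le.
  have -> : f (z' + \sum_(i <- s) y ord0 i *: 'e_i) - f z
      - (g j z * y ord0 j + \sum_(i <- s) g i z * y ord0 i)
    = (f (z' + \sum_(i <- s) y ord0 i *: 'e_i) - f z'
         - \sum_(i <- s) g i z' * y ord0 i)
      + (f z' - f z - y ord0 j * g j z)
      + \sum_(i <- s) (g i z' - g i z) * y ord0 i.
    under [X in _ = _ + X]eq_bigr do rewrite mulrBl.
    rewrite sumrB; lra.
  rewrite (le_trans (ler_normD _ _)) //.
  have W0 : 0 <= B * `|y| ^+ 2 by rewrite mulr_ge0 // exprn_ge0.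
  have : (size (j :: s))%:R ^+ 2 * (B * `|y| ^+ 2)
     = (size s)%:R ^+ 2 * (B * `|y| ^+ 2) + B * `|y| ^+ 2
       + (size s)%:R * (B * `|y| ^+ 2) + (size s)%:R * (B * `|y| ^+ 2).
    by rewrite /= -natr1; ring.
  have W1 : 0 <= (size s)%:R * (B * `|y| ^+ 2) by rewrite mulr_ge0.
  have H5 := ler_normD (f (z' + \sum_(i <- s) y ord0 i *: 'e_i) - f z'
         - \sum_(i <- s) g i z' * y ord0 i) (f z' - f z - y ord0 j * g j z).
  lra.
have := main (enum 'I_d) x; rewrite size_enum_ord !big_enum /= -row_sum_delta mulrA.
by [].
Qed.

(** A discrete mean value inequality: summing the increments over n equal
  steps leaves only the linear term as n tends to infinity. *)
Lemma increments_le (r : R -> R) (A C : R) : 0 <= C ->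
  (forall t s : R, 0 <= t -> 0 <= s -> t + s <= 1 ->
    `|r (t + s) - r t| <= s * A + s ^+ 2 * C) ->
  `|r 1 - r 0| <= A.
Proof.
move=> C0 H.
have step n : `|r 1 - r 0| <= A + C * (n.+1%:R)^-1.
  have n0 : (0 : R) < n.+1%:R by rewrite ltr0n.
  have K k : (k <= n.+1)%N ->
      `|r (k%:R / n.+1%:R) - r 0| <= k%:R * (n.+1%:R^-1 * A + n.+1%:R^-1 ^+ 2 * C).
    elim: k => [|k IH] kn; first by rewrite !mul0r subrr normr0.
    have H1 := IH (ltnW kn).
    have H2 : `|r (k%:R / n.+1%:R + n.+1%:R^-1) - r (k%:R / n.+1%:R)|
       <= n.+1%:R^-1 * A + n.+1%:R^-1 ^+ 2 * C.
      apply: H; rewrite ?divr_ge0 ?invr_ge0 //.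
      rewrite -[X in _ + X]mul1r -mulrDl natr1 ler_pdivrMr // mul1r.
      by rewrite ler_nat.
    rewrite -natr1 mulrDl mul1r [(_ + 1) * _]mulrDl mul1r.
    have := ler_distD (r (k%:R / n.+1%:R)) (r (k%:R / n.+1%:R + n.+1%:R^-1)) (r 0).
    move: (_ * A + _) H1 H2 => W H1 H2; lra.
  have := K n.+1 (leqnn _); rewrite divff ?gt_eqF // => /le_trans; apply.
  rewrite mulrDr mulrA divff ?gt_eqF // mul1r lerD2l expr2 -mulrA mulrA divff ?gt_eqF //.
  by rewrite mul1r mulrC.
apply/ler_addgt0Pr => e e0.
have [n] : exists n : nat, C / e < n%:R.
  by exists (Num.bound (C / e)); apply: archi_boundP; rewrite divr_ge0 // ltW.
rewrite ltr_pdivrMr // => Hn.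
apply: le_trans (step n) _; rewrite lerD2l ler_pdivrMr ?ltr0n // -natr1.
by rewrite mulrDr mulr1 mulrC; apply: le_trans (ltW Hn) _; rewrite lerDl ltW.
Qed.

Definition tayconst : R := d.+1%:R ^+ 3.

(** The first-order expansions of f and of its gradient come from the partial
  derivatives. The second-order remainder, followed along a segment, has a
  derivative bounded by the first-order remainder of the gradient. *)
Lemma taylor_of_partials B f p Q :
  BL B f ->
  (forall i, has_partial B i f (fun x => p x ord0 i)) ->
  (forall i, BL B (fun x => p x ord0 i)) ->
  (forall i j, has_partial B j (fun x => p x ord0 i) (fun x => Q x j i)) ->
  (forall i j, BL B (fun x => Q x i j)) ->
  taylor (tayconst * B) f p Q.
Proof.
move=> fB fp pB pQ QB; have B0 := BL_ge0 fB.
have d0 : (0 : R) <= d%:R by [].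
have dE : d.+1%:R = d%:R + 1 :> R by rewrite -natr1.
have d3 : d%:R * (d%:R ^+ 2) <= tayconst.
  by rewrite -exprS; rewrite lerXn2r ?nnegrE // ler_nat.
have d2 : d%:R ^+ 2 <= tayconst.
  rewrite /tayconst dE; have : 0 <= (d%:R : R) ^+ 2 by rewrite exprn_ge0.
  have : 0 <= (d%:R : R) ^+ 3 by rewrite exprn_ge0.
  lra.
have d1 : 1 <= tayconst by rewrite exprn_ege1 // ler1n.
have E1 x y : `|f (x + y) - f x - dot (p x) y| <= d%:R ^+ 2 * B * `|y| ^+ 2.
  exact: (partials_expansion fp pB B0).
have E2 i x y : `|p (x + y) ord0 i - p x ord0 i - \sum_j Q x j i * y ord0 j|
    <= d%:R ^+ 2 * B * `|y| ^+ 2.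
  exact: (partials_expansion (pQ i) (fun j => QB j i) B0).
(* The remainder of the gradient, paired with the increment. *)
have E3 x (y : X) : `|dot (p (x + y) - p x) y - quad (Q x) y| <= d%:R * (d%:R ^+ 2 * B * `|y| ^+ 3).
  have -> : dot (p (x + y) - p x) y - quad (Q x) y =
     \sum_i (p (x + y) ord0 i - p x ord0 i - \sum_j Q x j i * y ord0 j) * y ord0 i.
    rewrite /dot /quad exchange_big -sumrB; apply: eq_bigr => i _.
    rewrite !mxE [RHS]mulrBl; congr (_ - _); rewrite mulr_suml.
    by apply: eq_bigr => j _; ring.
  apply: le_trans (ler_norm_sum _ _ _) _.
  apply: ler_sum_ord => i; rewrite normrM [`|y| ^+ 3]exprSr mulrA; apply: ler_pM => //.
  exact: mx_entry_le.
have tB : B <= tayconst * B by rewrite -[leLHS]mul1r; exact: ler_wpM2r.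
split.
- exact: le_BL fB.
- move=> x y; apply: le_trans (E1 x y) _.
  by apply: ler_wpM2r; [exact: exprn_ge0|exact: ler_wpM2r].
- move=> x y.
  (* The second-order remainder at distance t along the segment from x to x +
    y. *)
  pose r (t : R) := f (x + t *: y) - t * dot (p x) y - t ^+ 2 * (quad (Q x) y / 2).
  have := @increments_le r (tayconst * B * `|y| ^+ 3)
     (d%:R ^+ 2 * B * `|y| ^+ 2 + `|quad (Q x) y|).
  rewrite /r scale0r addr0 scale1r expr0n expr1n !mul0r !mul1r !subr0 => H.
  have -> : f (x + y) - f x - dot (p x) y - quad (Q x) y / 2
    = f (x + y) - dot (p x) y - quad (Q x) y / 2 - f x by lra.
  apply: H.
    by rewrite addr_ge0 // !mulr_ge0 // exprn_ge0.
  move=> t s t0 s0 ts.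
  rewrite scalerDl addrA.
  have F1 := E1 (x + t *: y) (s *: y).
  have F2 := E3 x (t *: y).
  rewrite !dotZr quadZ !normrZ (ger0_norm t0) (ger0_norm s0) in F1 F2.
  have {}F2 : `|s * (dot (p (x + t *: y)) y - dot (p x) y - t * quad (Q x) y)|
     <= s * (tayconst * B * `|y| ^+ 3).
    rewrite normrM (ger0_norm s0); apply: ler_wpM2l => //.
    have [->|tN0] := eqVneq t 0.
      rewrite scale0r addr0 subrr mul0r subr0 normr0.
      by rewrite !mulr_ge0 // ?exprn_ge0 // (le_trans _ d1).
    have tp : 0 < t by rewrite lt_neqAle eq_sym tN0.
    rewrite -(ler_pM2l tp) -{1}(ger0_norm t0) -normrM.
    have -> : t * (dot (p (x + t *: y)) y - dot (p x) y - t * quad (Q x) y)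
      = t * dot (p (x + t *: y) - p x) y - t ^+ 2 * quad (Q x) y.
      by rewrite dotBl; ring.
    apply: le_trans F2 _.
    have W : 0 <= B * `|y| ^+ 3 by rewrite mulr_ge0 // exprn_ge0.
    have -> : d%:R * (d%:R ^+ 2 * B * (t * `|y|) ^+ 3)
      = t * (d%:R * d%:R ^+ 2 * (t ^+ 2 * (B * `|y| ^+ 3))) by ring.
    rewrite -[tayconst * B * _]mulrA; apply: ler_wpM2l => //; apply: ler_pM => //.
    + by rewrite mulr_ge0 // exprn_ge0.
    rewrite -[leRHS]mul1r; apply: ler_wpM2r => //.
    rewrite expr_le1 //; lra.
  have -> : f (x + t *: y + s *: y) - (t + s) * dot (p x) y
      - (t + s) ^+ 2 * (quad (Q x) y / 2)
      - (f (x + t *: y) - t * dot (p x) y - t ^+ 2 * (quad (Q x) y / 2))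
    = s * (dot (p (x + t *: y)) y - dot (p x) y - t * quad (Q x) y)
      + ((f (x + t *: y + s *: y) - f (x + t *: y) - s * dot (p (x + t *: y)) y)
         - s ^+ 2 * (quad (Q x) y / 2)) by field.
  rewrite (le_trans (ler_normD _ _)) //; apply: lerD => //.
  rewrite (le_trans (ler_normB _ _)) // mulrDr; apply: lerD.
    by apply: le_trans F1 _; rewrite exprMn mulrCA.
  rewrite normrM ger0_norm ?exprn_ge0 //; apply: ler_wpM2l; first exact: exprn_ge0.
  rewrite normrM [`|2^-1|]ger0_norm ?invr_ge0 //.
  by rewrite ler_piMr // invf_le1 ?ler1n.
- split=> [x|x y].
    apply: mx_norm_leP; first exact: le_trans tB.
    by move=> k i; rewrite (ord1 k); exact: le_trans (proj1 (pB i) x) tB.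
  apply: mx_norm_leP; first by rewrite mulr_ge0 // (le_trans _ tB).
  move=> k i; rewrite (ord1 k) !mxE.
  by apply: le_trans (proj2 (pB i) x y) _; exact: ler_wpM2r.
- split=> [x|x y].
    apply: mx_norm_leP; first exact: le_trans tB.
    by move=> k i; exact: le_trans (proj1 (QB k i) x) tB.
  apply: mx_norm_leP; first by rewrite mulr_ge0 // (le_trans _ tB).
  move=> k i; rewrite !mxE.
  by apply: le_trans (proj2 (QB k i) x y) _; exact: ler_wpM2r.
Qed.

Lemma taylor_of_families B f (g : 'I_d -> X -> R) (h : 'I_d * 'I_d -> X -> R) :
  BL B f -> (forall i, has_partial B i f (g i)) -> (forall i, BL B (g i)) ->
  (forall ij, has_partial B ij.1 (g ij.2) (h ij)) -> (forall ij, BL B (h ij)) ->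
  taylor (tayconst * B) f (fun x => \row_i g i x) (fun x => \matrix_(i, j) h (i, j) x).
Proof.
move=> fB fg gB gh hB.
have gE i : (fun x => (\row_i g i x) ord0 i) = g i by apply/funext => x; rewrite mxE.
have hE i j : (fun x => (\matrix_(i, j) h (i, j) x) i j) = h (i, j).
  by apply/funext => x; rewrite mxE.
apply: taylor_of_partials => // [i|i|i j|i j]; rewrite ?gE ?hE //.
exact: (gh (j, i)).
Qed.

Lemma smooth_taylor B f : smooth 2 B f ->
  exists p Q, taylor (tayconst * B) f p Q.
Proof.
move=> [fB H].
have H' (i : 'I_d) : exists g, has_partial B i f g /\ smooth 1 B g.
    by have [g ? ?] := H i; exists g.
have [g Hg] := choice H'.
have H'' (ij : 'I_d * 'I_d) : exists h, has_partial B ij.1 (g ij.2) h /\ BL B h.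
    by have [_ [_ H1]] := Hg ij.2; have [h ? [? _]] := H1 ij.1; exists h.
have [h Hh] := choice H''.
exists (fun x => \row_i g i x), (fun x => \matrix_(i, j) h (i, j) x).
apply: taylor_of_families => // [i|i|ij|ij]; [exact: (Hg i).1|exact: (Hg i).2.1|
  exact: (Hh ij).1|exact: (Hh ij).2].
Qed.

(** The Taylor constant of a mollification at scale e of a function in BL C;
  that it depends on nothing else makes consistency uniform over the iterates
  of a scheme. *)
Definition mollconst C e : R := tayconst * (C * (1 + 4 / e) * (1 + 4 / e)).

Lemma mollconst_ge0 C e : 0 <= C -> 0 < e -> 0 <= mollconst C e.
Proof.
move=> C0 e0; have t0 : 0 <= 1 + 4 / e by rewrite addr_ge0 // divr_ge0 // ltW.
by rewrite !mulr_ge0 // exprn_ge0.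
Qed.

Lemma mollify_taylor C e f : 0 < e -> BL C f ->
  exists p Q, taylor (mollconst C e) (mollify e f) p Q.
Proof. by move=> e0 fC; exact: smooth_taylor (mollify_smooth e0 fC). Qed.

(** ** Smooth functions in the sense of iterated partial derivatives *)

Lemma Cb_infty_partial i f : Cb_infty f -> Cb_infty (partial i f).
Proof.
move=> H s; have := H (rcons s i).
have -> : iter_partial (rcons s i) f = iter_partial s (partial i f).
  by rewrite /iter_partial foldr_rcons.
by [].
Qed.

Lemma Cb_infty_increment i f : Cb_infty f -> forall x (t : R),
  exists2 s, `|s| <= `|t| & f (x + t *: 'e_i) - f x = t * partial i f (x + s *: 'e_i).
Proof.
move=> H.
have [_ df] := H [::].
have dline x (s : R) : is_derive s 1 (fun u : R => f (x + u *: 'e_i)) (partial i f (x + s *: 'e_i)).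
  have dfs := df i (x + s *: 'e_i).
  have E : (fun h : R => h^-1 *: ((fun u : R => f (x + u *: 'e_i)) (h *: 1 + s) - f (x + s *: 'e_i)))
     = (fun h : R => h^-1 *: (f (h *: 'e_i + (x + s *: 'e_i)) - f (x + s *: 'e_i))).
    apply/funext => h; congr (_ *: (f _ - _)).
    have -> : h%:A = h by rewrite /GRing.scale /= mulr1.
    by rewrite scalerDl addrCA.
  apply: DeriveDef; first by rewrite /derivable E; exact: dfs.
  by rewrite /partial /derive E.
move=> x t; have [t0|t0] := leP 0 t.
  have [s [/andP[s0 st]]] := @mean_value R _ _ 0 t t0 (fun s _ => dline x s).
  rewrite scale0r addr0 subr0 => ->; exists s; last by rewrite mulrC.
  by rewrite !ger0_norm.
have [s [/andP[ts s0]]] := @mean_value R _ _ t 0 (ltW t0) (fun s _ => dline x s).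
rewrite scale0r addr0 sub0r => E; exists s; last by lra.
by rewrite (ler0_norm s0) (ler0_norm (ltW t0)) lerN2.
Qed.

Lemma Cb_infty_BL f : Cb_infty f -> exists B, BL B f.
Proof.
move=> H.
have [[_ [M fM]] _] := H [::].
have bp i : exists M, forall x, `|partial i f x| <= M.
  by have [[_ [M' h]] _] := H [:: i]; exists M'.
have [Mp HMp] := choice bp.
pose K := M + \sum_i `|Mp i|.
have M0 : 0 <= M by exact: le_trans (fM 0).
have S0 : 0 <= \sum_i `|Mp i| by apply: sumr_ge0.
exists K; split=> [x|x y]; first by apply: le_trans (fM x) _; rewrite lerDl.
have step (s : seq 'I_d) (z : X) : forall x,
    `|f (x + \sum_(i <- s) z ord0 i *: 'e_i) - f x| <= (\sum_(i <- s) `|Mp i|) * `|z|.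
  elim: s => [|j s IH] x'.
    by rewrite !big_nil addr0 subrr normr0 mul0r.
  rewrite !big_cons addrA mulrDl.
  have H1 := IH (x' + z ord0 j *: 'e_j).
  have [u _ H2] := Cb_infty_increment j H x' (z ord0 j).
  have H3 : `|f (x' + z ord0 j *: 'e_j) - f x'| <= `|Mp j| * `|z|.
    rewrite H2 normrM mulrC; apply: ler_pM => //; last exact: mx_entry_le.
    by apply: le_trans (HMp j _) _; exact: ler_norm.
  have := ler_distD (f (x' + z ord0 j *: 'e_j)) (f (x' + z ord0 j *: 'e_j + \sum_(i <- s) z ord0 i *: 'e_i)) (f x').
  lra.
have := step (enum 'I_d) (x - y) y; rewrite !big_enum /= -row_sum_delta.
rewrite [y + _]addrC subrK => /le_trans; apply; apply: ler_wpM2r => //.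
by rewrite /K lerDr.
Qed.

Lemma Cb_infty_has_partial i f : Cb_infty f -> exists B, has_partial B i f (partial i f).
Proof.
move=> H; have [B fB] := Cb_infty_BL (Cb_infty_partial i H).
have B0 := BL_ge0 fB.
exists B => x t; have [s st ->] := Cb_infty_increment i H x t.
rewrite -mulrBr normrM.
have := BL_line x 'e_i s 0 fB; rewrite scale0r addr0 subr0 => h.
rewrite -real_normK ?num_real // expr2 mulrCA; apply: ler_wpM2l => //.
apply: le_trans h _; apply: ler_pM => //; first exact: mulr_ge0.
by rewrite -[leRHS]mulr1; apply: ler_wpM2l => //; exact: norm_delta_mx.
Qed.

(** Finitely many partial derivatives of order at most three enter, so one
  constant bounds them all. *)
Lemma Cb_infty_taylor f : Cb_infty f ->
  exists B, taylor B f (gradient f) (hessian f).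
Proof.
move=> H.
have Hp i := Cb_infty_partial i H; have Hpp i j := Cb_infty_partial i (Hp j).
have [B0 h0] := Cb_infty_BL H.
have [B1 h1] := choice (fun i => Cb_infty_has_partial i H).
have [B2 h2] := choice (fun i => Cb_infty_BL (Hp i)).
have [B3 h3] := choice (fun ij : 'I_d * 'I_d => Cb_infty_has_partial ij.1 (Hp ij.2)).
have [B4 h4] := choice (fun ij : 'I_d * 'I_d => Cb_infty_BL (Hpp ij.1 ij.2)).
pose B := `|B0| + \sum_i `|B1 i| + \sum_i `|B2 i| + \sum_ij `|B3 ij| + \sum_ij `|B4 ij|.
have le1 (I : finType) (F : I -> R) i : F i <= \sum_i `|F i|.
  by rewrite (bigD1 i) //=; apply: le_trans (ler_norm _) _; rewrite lerDl; exact: sumr_ge0.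
have P0 := ler_norm B0.
have P0' := normr_ge0 B0.
have P1 : 0 <= \sum_i `|B1 i| by exact: sumr_ge0.
have P2 : 0 <= \sum_i `|B2 i| by exact: sumr_ge0.
have P3 : 0 <= \sum_i `|B3 i| by exact: sumr_ge0.
have P4 : 0 <= \sum_i `|B4 i| by exact: sumr_ge0.
exists (tayconst * B).
apply: (@taylor_of_families B f (fun i => partial i f) (fun ij => partial ij.1 (partial ij.2 f))).
- by apply: le_BL h0; rewrite /B; lra.
- by move=> i; apply: le_has_partial (h1 i); rewrite /B; have := le1 _ B1 i; lra.
- by move=> i; apply: le_BL (h2 i); rewrite /B; have := le1 _ B2 i; lra.
- by move=> ij; apply: le_has_partial (h3 ij); rewrite /B; have := le1 _ B3 ij; lra.
- by move=> ij; apply: le_BL (h4 ij); rewrite /B; have := le1 _ B4 ij; lra.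
Qed.

End Taylor.

(** * Square roots of positive semi-definite matrices *)

Section Cholesky.
Context {R : realType}.

Lemma psd_block m (a : 'M[R]_(1 + m)) : psd a ->
  exists al (c : 'rV[R]_m) (b : 'M[R]_m), a = block_mx al%:M c c^T b /\ b^T = b /\
    forall (s : R) (y : 'rV[R]_m),
      0 <= s ^+ 2 * al + 2 * s * (c *m y^T) ord0 ord0 + (y *m b *m y^T) ord0 ord0.
Proof.
move=> [aT apos].
exists (ulsubmx a ord0 ord0), (ursubmx a), (drsubmx a).
have dl : dlsubmx a = (ursubmx a)^T by rewrite trmx_ursub aT.
have ul : (ulsubmx a ord0 ord0)%:M = ulsubmx a by rewrite -mx11_scalar.
split; first by rewrite ul -dl submxK.
split; first by rewrite trmx_drsub aT.
move=> s y; have := apos (row_mx s%:M y).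
rewrite -{1}(submxK a) dl -ul mul_row_block tr_row_mx mul_row_col !mulmxDl.
rewrite tr_scalar_mx !mul_scalar_mx !mul_mx_scalar !mxE eqxx mulr1n.
have -> : \sum_j y ord0 j * (ursubmx a)^T j ord0 = \sum_j ursubmx a ord0 j * y^T j ord0.
  by apply: eq_bigr => j _; rewrite [(ursubmx a)^T _ _]mxE [y^T _ _]mxE mulrC.
have -> : \sum_j (s *: ursubmx a) ord0 j * y^T j ord0 = s * \sum_j ursubmx a ord0 j * y^T j ord0.
  rewrite mulr_sumr; apply: eq_bigr => j _; rewrite mulrA; congr (_ * _).
  by rewrite !mxE.
by congr (0 <= _); rewrite /=; ring.
Qed.

(** Induction on the dimension: a positive first diagonal entry is split off
  by its Schur complement, and a vanishing one forces its row to vanish. The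
  additional row keeps the number of rows positive in dimension 0. *)
Lemma cholesky m (a : 'M[R]_m) : psd a ->
  exists u : 'M[R]_(m.+1, m), a = u^T *m u.
Proof.
elim: m a => [|m IH] a apsd.
  by exists 0; apply/matrixP => -[].
have [al [c [b [aE [bT ab]]]]] := psd_block apsd.
have al0 : 0 <= al.
  have := ab 1 0; rewrite trmx0 mulmx0 mul0mx mul0mx !mxE; lra.
have bpos (y : 'rV[R]_m) : 0 <= (y *m b *m y^T) ord0 ord0.
  by have := ab 0 y; rewrite expr0n /= !mul0r mulr0 mul0r !add0r.
have [al_eq0|al_neq0] := eqVneq al 0.
  have c0 : c = 0.
    apply/rowP => j; rewrite [RHS]mxE; apply/eqP/negPn/negP => cj0.
    pose y : 'rV[R]_m := delta_mx ord0 j.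
    have H s := ab s y.
    have cy : (c *m y^T) ord0 ord0 = c ord0 j.
      rewrite mxE (bigD1 j) //= big1 ?addr0; last first.
        by move=> i ij; rewrite !mxE eqxx (negbTE ij) mulr0.
      by rewrite !mxE !eqxx mulr1.
    (* If an entry of the row were nonzero, the quadratic form would be affine
      in s with nonzero slope, and hence negative for some s. *)
    have := H (- ((y *m b *m y^T) ord0 ord0 + 1) / (2 * c ord0 j)).
    rewrite cy al_eq0 mulr0 add0r.
    have -> : 2 * (- ((y *m b *m y^T) ord0 ord0 + 1) / (2 * c ord0 j)) * c ord0 j
       = - ((y *m b *m y^T) ord0 ord0 + 1) by field.
    lra.
  have [u bu] := IH b (conj bT bpos).
  exists (block_mx 0 0 0 u : 'M[R]_(1 + m.+1, 1 + m)).
  rewrite aE c0 al_eq0 bu (@tr_block_mx R 1 m.+1 1 m) (@mulmx_block R 1 m 1 m.+1 1 m).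
  by rewrite !trmx0 !mul0mx !mulmx0 !addr0 !add0r raddf0.
have al_gt0 : 0 < al by rewrite lt_neqAle eq_sym al_neq0.
have sq0 : Num.sqrt al != 0 by rewrite gt_eqF // sqrtr_gt0.
have sq2 : Num.sqrt al * Num.sqrt al = al by rewrite -expr2 sqr_sqrtr.
have [u bu] : exists u : 'M[R]_(m.+1, m), b - al^-1 *: (c^T *m c) = u^T *m u.
  apply: IH; split.
    by rewrite linearB /= bT linearZ /= trmx_mul trmxK.
  move=> y.
  have -> : (y *m (b - al^-1 *: (c^T *m c)) *m y^T) ord0 ord0 =
      (y *m b *m y^T) ord0 ord0 - al^-1 * ((c *m y^T) ord0 ord0) ^+ 2.
    have mB (A B : 'M[R]_1) : (A - B) ord0 ord0 = A ord0 ord0 - B ord0 ord0 by rewrite !mxE.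
    rewrite mulmxBr mulmxBl mB; congr (_ - _).
    rewrite -scalemxAr -scalemxAl mxE; congr (_ * _).
    have -> : y *m (c^T *m c) *m y^T = (c *m y^T)^T *m (c *m y^T).
      by rewrite trmx_mul trmxK !mulmxA.
    by rewrite mxE big_ord1 expr2 [(c *m y^T)^T _ _]mxE.
  (* The minimizer in s of the quadratic form. *)
  have := ab (- (c *m y^T) ord0 ord0 / al) y.
  move: ((c *m y^T) ord0 ord0) => w.
  by congr (0 <= _); field.
exists (block_mx (Num.sqrt al)%:M ((Num.sqrt al)^-1 *: c) 0 u : 'M[R]_(1 + m.+1, 1 + m)).
rewrite aE (@tr_block_mx R 1 m.+1 1 m) (@mulmx_block R 1 m 1 m.+1 1 m).
have cT : ((Num.sqrt al)^-1 *: c)^T = (Num.sqrt al)^-1 *: c^T by rewrite linearZ.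
rewrite !trmx0 tr_scalar_mx !mul0mx !mulmx0 !addr0 cT.
rewrite -scalar_mxM sq2 mul_scalar_mx mul_mx_scalar !scalerA mulfV // !scale1r.
have E : (Num.sqrt al)^-1 *: c^T *m ((Num.sqrt al)^-1 *: c) + u^T *m u = b.
  by rewrite -bu -scalemxAl -scalemxAr scalerA -invfM sq2 addrC subrK.
by rewrite E.
Qed.

End Cholesky.

(** * Convex operators and controlled random walks *)

Section Operators.
Context {R : realType} {d : nat}.
Local Notation X := 'rV[R]_d.
Local Notation M := 'M[R]_d.
Implicit Types (f g v : X -> R).

Lemma entry_le_enorm m n (a : 'M[R]_(m, n)) i j : `|a i j| <= enorm a.
Proof.
rewrite /enorm -sqrtr_sqr ler_wsqrtr //.
rewrite (bigD1 i) //= (bigD1 j) //= -addrA lerDl addr_ge0 //.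
  by apply: sumr_ge0 => k _; exact: sqr_ge0.
by apply: sumr_ge0 => k _; apply: sumr_ge0 => l _; exact: sqr_ge0.
Qed.

Lemma enorm_ge0 m n (a : 'M[R]_(m, n)) : 0 <= enorm a.
Proof. exact: sqrtr_ge0. Qed.

Lemma norm_le_enorm m n (a : 'M[R]_(m, n)) : `|a| <= enorm a.
Proof. by apply: mx_norm_leP; [exact: enorm_ge0|exact: entry_le_enorm]. Qed.

Definition bounded f := exists C, forall x, `|f x| <= C.

Lemma BL_bounded C f : BL C f -> bounded f.
Proof. by move=> [H _]; exists C. Qed.

Lemma bounded_cst c : bounded (fun=> c).
Proof. by exists `|c|. Qed.

Lemma bounded_lin a b f g : bounded f -> bounded g ->
  bounded (fun x => a * f x + b * g x).
Proof.
move=> [C fC] [C' gC]; exists (`|a| * C + `|b| * C') => x.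
by rewrite (le_trans (ler_normD _ _)) // !normrM lerD // ler_wpM2l.
Qed.

Lemma bounded_addcst f c : bounded f -> bounded (fun x => f x + c).
Proof.
move=> [C fC]; exists (C + `|c|) => x.
by rewrite (le_trans (ler_normD _ _)) // lerD.
Qed.

Lemma bounded_shift f z : bounded f -> bounded (fun x => f (x + z)).
Proof. by move=> [C fC]; exists C => x. Qed.

(** Function spaces on which the operators act: all bounded functions for the
  discrete schemes, the bounded continuous ones for the limits. *)
Record domain (D : (X -> R) -> Prop) : Prop := {
  dom_lin : forall a b f g, D f -> D g -> D (fun x => a * f x + b * g x);
  dom_shift : forall f z, D f -> D (fun x => f (x + z));
  dom_BL : forall C f, BL C f -> D f;
  dom_bounded : forall f, D f -> bounded f
}.

Lemma domain_bounded : domain bounded.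
Proof.
split; [exact: bounded_lin|exact: bounded_shift|exact: BL_bounded|by []].
Qed.

(** These are the translation invariant convex expectations; adding constants
  commutes with them, so they are contractions for the supremum norm. *)
Record convex_operator (D : (X -> R) -> Prop) (P : (X -> R) -> X -> R) : Prop := {
  co_domain : domain D;
  co_dom : forall f, D f -> D (P f);
  co_le : forall f g, D f -> D g -> (forall x, f x <= g x) ->
    forall x, P f x <= P g x;
  co_addcst : forall f c, D f -> forall x, P (fun y => f y + c) x = P f x + c;
  co_zero : forall x, P (fun=> 0) x = 0;
  co_shift : forall f z, D f -> forall x, P (fun y => f (y + z)) x = P f (x + z);
  co_convex : forall f g (lam : R), D f -> D g -> 0 <= lam <= 1 -> forall x,
    P (fun y => lam * f y + (1 - lam) * g y) x <= lam * P f x + (1 - lam) * P g x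
}.

Definition jensen (P : (X -> R) -> X -> R) : Prop :=
  forall A C f, averaging A -> BL C f -> forall x, P (A f) x <= A (P f) x.

Section ConvexOperatorTheory.
Variables (D : (X -> R) -> Prop) (P : (X -> R) -> X -> R).
Hypothesis hP : convex_operator D P.
Let hD := co_domain hP.

Lemma dom_cst c : D (fun=> c).
Proof. exact: (dom_BL hD (BL_cst c)). Qed.

Lemma dom_addcst f c : D f -> D (fun x => f x + c).
Proof.
move=> fD; have := dom_lin hD 1 1 fD (dom_cst c).
by have -> : (fun x => 1 * f x + 1 * c) = (fun x => f x + c)
  by apply/funext => x; rewrite !mul1r.
Qed.

Lemma co_cst c x : P (fun=> c) x = c.
Proof.
have -> : (fun=> c) = (fun y : X => (fun=> 0) y + c) by apply/funext => y; rewrite add0r.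
by rewrite (co_addcst hP) ?(co_zero hP) ?add0r //; exact: dom_cst.
Qed.

Lemma co_le_addcst f g c : D f -> D g ->
  (forall x, f x <= g x + c) -> forall x, P f x <= P g x + c.
Proof.
move=> fb gb fg x; rewrite -(co_addcst hP) //; apply: (co_le hP) => //.
exact: dom_addcst.
Qed.

Lemma co_contraction f g c : D f -> D g ->
  (forall x, `|f x - g x| <= c) -> forall x, `|P f x - P g x| <= c.
Proof.
move=> fb gb fg x; rewrite ler_distlC; apply/andP; split.
  rewrite lerBlDr; apply: co_le_addcst => // y.
  by have := fg y; rewrite ler_distlC => /andP[]; lra.
by apply: co_le_addcst => // y; have := fg y; rewrite ler_distl => /andP[]; lra.
Qed.

Lemma co_bound C f : D f -> (forall x, `|f x| <= C) -> forall x, `|P f x| <= C.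
Proof.
move=> fD fC x; rewrite -[P f x]subr0 -[X in _ - X](co_zero hP x).
by apply: co_contraction; [|exact: dom_cst|move=> y; rewrite subr0].
Qed.

(** An increment of P f is a difference of P at two translates of f, so moduli
  of continuity are preserved. *)
Lemma co_modulus f z c : D f ->
  (forall x, `|f (x + z) - f x| <= c) -> forall x, `|P f (x + z) - P f x| <= c.
Proof.
move=> fb H x; rewrite -(co_shift hP) //.
exact: co_contraction (dom_shift hD z fb) fb H x.
Qed.

Lemma co_BL C f : BL C f -> BL C (P f).
Proof.
move=> fC; have fD := dom_BL hD fC; split; first exact: co_bound (proj1 fC).
move=> x y; have -> : x = y + (x - y) by rewrite addrC subrK.
rewrite [X in _ * `|X|]addrAC subrr add0r.
apply: co_modulus => // z.
by apply: le_trans (proj2 fC _ _) _; rewrite addrAC subrr add0r.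
Qed.

End ConvexOperatorTheory.

Lemma convex_operator_comp D P P' : convex_operator D P -> convex_operator D P' ->
  convex_operator D (P \o P').
Proof.
move=> hP hP'; have hD := co_domain hP; split => //=.
- by move=> f fD; apply: (co_dom hP); exact: (co_dom hP').
- by move=> f g fb gb fg; apply: (co_le hP);
    [exact: (co_dom hP')|exact: (co_dom hP')|exact: (co_le hP')].
- move=> f c fb x; rewrite -(co_addcst hP); last exact: (co_dom hP').
  by congr (P _ x); apply/funext => y; rewrite (co_addcst hP').
- move=> x; have -> : P' (fun=> 0) = fun=> 0.
    by apply/funext => y; exact: co_zero hP' y.
  exact: co_zero hP x.
- move=> f z fb x; rewrite -(co_shift hP); last exact: (co_dom hP').
  by congr (P _ x); apply/funext => y; rewrite (co_shift hP').
- move=> f g lam fb gb lam01 x.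
  have P'f := co_dom hP' fb; have P'g := co_dom hP' gb.
  apply: le_trans (co_convex hP P'f P'g lam01 x).
  apply: (co_le hP).
  + by apply: (co_dom hP'); exact: (dom_lin hD).
  + exact: (dom_lin hD).
  + exact: (co_convex hP').
Qed.

Lemma jensen_comp D P P' : convex_operator D P -> convex_operator D P' ->
  jensen P -> jensen P' -> jensen (P \o P').
Proof.
move=> hP hP' jP jP' A C f hA fC x /=.
have hD := co_domain hP.
apply: le_trans (jP A C _ hA (co_BL hP' fC) x).
apply: (co_le hP).
- by apply: (co_dom hP'); exact: (dom_BL hD (av_BL hA fC)).
- exact: (dom_BL hD (av_BL hA (co_BL hP' fC))).
- exact: jP' hA fC.
Qed.

Lemma convex_operator_iter D P m : convex_operator D P -> convex_operator D (iter m P).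
Proof.
move=> hP; elim: m => [|m IH]; first by split => //; exact: co_domain hP.
exact: (convex_operator_comp hP IH).
Qed.

Lemma jensen_iter D P m : convex_operator D P -> jensen P -> jensen (iter m P).
Proof.
move=> hP jP; elim: m => [|m IH]; first by [].
exact: jensen_comp hP (convex_operator_iter m hP) jP IH.
Qed.

(** ** Controlled random walks *)

(** A covariance a is given by a square root s with a = s^T s, whose rows
  serve as the jumps of the walk. *)
Definition control : Type := ('M[R]_(d.+1, d) * X)%type.
Implicit Types (u : control) (adm : set control) (cost : control -> R).

Definition diffusion u : M := u.1^T *m u.1.
Definition magnitude u : R := enorm (diffusion u) + enorm u.2.

Lemma magnitude_ge0 u : 0 <= magnitude u.
Proof. by rewrite addr_ge0 // enorm_ge0. Qed.

Lemma drift_le_magnitude u : `|u.2| <= magnitude u.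
Proof.
by apply: le_trans (norm_le_enorm _) _; rewrite /magnitude lerDr enorm_ge0.
Qed.

Lemma diffusion_le_magnitude u : `|diffusion u| <= magnitude u.
Proof.
by apply: le_trans (norm_le_enorm _) _; rewrite /magnitude lerDl enorm_ge0.
Qed.

Lemma row_le_magnitude u k : `|row k u.1| ^+ 2 <= magnitude u.
Proof.
have s0 := magnitude_ge0 u.
rewrite -(sqr_sqrtr s0) lerXn2r ?nnegrE ?sqrtr_ge0 //.
apply: mx_norm_leP; first exact: sqrtr_ge0.
move=> i j; rewrite mxE -sqrtr_sqr ler_wsqrtr //.
apply: le_trans (diffusion_le_magnitude u).
apply: le_trans (mx_entry_le _ j j).
apply: le_trans (ler_norm _).
rewrite mxE (bigD1 k) //= mxE expr2 lerDl; apply: sumr_ge0 => l _.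
by rewrite mxE -expr2 sqr_ge0.
Qed.

(** The later constants depend on adm and cost through rho alone, which makes
  them uniform over a family of problems with the same coercivity. *)
Record control_problem (rho : R -> R) adm cost : Prop := {
  cp_cost_ge0 : forall u, adm u -> 0 <= cost u;
  cp_free : exists u, [/\ adm u, cost u = 0 & magnitude u <= rho 1];
  cp_coercive : forall m u, adm u -> rho m < magnitude u -> m * magnitude u <= cost u;
  cp_rho : forall m, 1 <= rho m
}.

(** The walk moves by the drift h b and by plus or minus one of these jumps,
  with the row chosen uniformly among d + 1; the scaling makes the covariance
  of the jump equal to h a. *)
Definition jump (h : R) u k : X := Num.sqrt (d.+1%:R * h) *: row k u.1.

Definition walk (h : R) u f (x : X) : R :=
  (2 * d.+1%:R)^-1 * \sum_(k < d.+1)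
     (f (x + (h *: u.2 + jump h u k)) + f (x + (h *: u.2 - jump h u k))).

Lemma walk_lin h u a b f g x :
  walk h u (fun y => a * f y + b * g y) x = a * walk h u f x + b * walk h u g x.
Proof.
rewrite /walk mulrCA [b * _]mulrCA -mulrDr; congr (_ * _).
rewrite !mulr_sumr -big_split; apply: eq_bigr => k _ /=; ring.
Qed.

Lemma walk_le h u f g x : (forall y, f y <= g y) -> walk h u f x <= walk h u g x.
Proof.
move=> fg; apply: ler_wpM2l; first by rewrite invr_ge0 mulr_ge0.
by apply: ler_sum => k _; exact: lerD.
Qed.

Lemma walk_cst h u c x : walk h u (fun=> c) x = c.
Proof.
have -> : walk h u (fun=> c) x = (2 * d.+1%:R)^-1 * (d.+1%:R * (c + c)).
  by congr (_ * _); rewrite sumr_const card_ord mulr_natl.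
have : (d.+1%:R : R) != 0 by rewrite pnatr_eq0.
by move: (d.+1%:R) => N N0; field.
Qed.

Lemma walk_bound h u f C x : (forall y, `|f y| <= C) -> `|walk h u f x| <= C.
Proof.
move=> fC; rewrite ler_norml; apply/andP; split.
  rewrite -[leLHS](walk_cst h u _ x); apply: walk_le => y.
  by have := fC y; rewrite ler_norml => /andP[].
rewrite -[leRHS](walk_cst h u _ x); apply: walk_le => y.
by have := fC y; rewrite ler_norml => /andP[].
Qed.

Lemma walk_shift h u f z x : walk h u (fun y => f (y + z)) x = walk h u f (x + z).
Proof.
by congr (_ * _); apply: eq_bigr => k _; congr (f _ + f _); rewrite addrAC.
Qed.

Lemma av_sum A C (I : Type) (r : seq I) (F : I -> X -> R) : averaging A ->
  (forall i, BL C (F i)) ->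
  (exists C', BL C' (fun y => \sum_(i <- r) F i y)) /\
  forall x, A (fun y => \sum_(i <- r) F i y) x = \sum_(i <- r) A (F i) x.
Proof.
move=> hA FC; elim: r => [|i r [[C' rC] IH]].
  have -> : (fun y : X => \sum_(j <- [::]) F j y) = fun=> 0.
    by apply/funext => y; rewrite big_nil.
  split=> [|x]; first by exists (`|0 : R|); exact: BL_cst.
  by rewrite big_nil (av_cst hA).
have -> : (fun y : X => \sum_(k <- i :: r) F k y) =
      fun y => 1 * F i y + 1 * \sum_(k <- r) F k y.
  by apply/funext => y; rewrite big_cons !mul1r.
split=> [|x]; first by exists (`|1| * C + `|1| * C'); exact: BL_lin.
by rewrite big_cons -IH (av_lin hA 1 1 (FC i) rC) !mul1r.
Qed.

Lemma av_walk A C h u f : averaging A -> BL C f -> forall x,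
  walk h u (A f) x = A (walk h u f) x.
Proof.
move=> hA fC x.
pose F k y := 1 * f (y + (h *: u.2 + jump h u k)) + 1 * f (y + (h *: u.2 - jump h u k)).
have FC k : BL (`|1| * C + `|1| * C) (F k).
  by apply: BL_lin; exact: BL_shift.
have [[C' GC] GE] := av_sum (index_enum 'I_d.+1) hA FC.
have -> : walk h u f = fun y => (2 * d.+1%:R)^-1 * (\sum_(k < d.+1) F k y) + 0 * (\sum_(k < d.+1) F k y).
  apply/funext => y; rewrite mul0r addr0; congr (_ * _).
  by apply: eq_bigr => k _; rewrite /F !mul1r.
rewrite (av_lin hA _ _ GC GC) mul0r addr0; congr (_ * _).
rewrite GE; apply: eq_bigr => k _.
rewrite (av_lin hA 1 1 (BL_shift _ fC) (BL_shift _ fC)) !mul1r.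
by rewrite !(av_shift hA).
Qed.

Lemma walk_BL h u C f : BL C f -> BL C (walk h u f).
Proof.
move=> [f1 f2]; split=> [x|x y].
  exact: walk_bound.
have -> : walk h u f x - walk h u f y = walk h u (fun z => f (z + (x - y)) - f z) y.
  have -> : walk h u f x = walk h u (fun z => f (z + (x - y))) y.
    by rewrite walk_shift addrC subrK.
  have := walk_lin h u 1 (-1) (fun z => f (z + (x - y))) f y.
  rewrite mul1r mulN1r => <-; congr (walk h u _ y).
  by apply/funext => z; rewrite mul1r mulN1r.
apply: walk_bound => z; apply: le_trans (f2 _ _) _.
by rewrite [z + _]addrC addrK.
Qed.

(** One step of the Bellman scheme for the running cost. *)
Definition step adm cost (h : R) f (x : X) : R :=
  sup [set walk h u f x - h * cost u | u in adm].

Section StepTheory.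
Variables (rho : R -> R) (adm : set control) (cost : control -> R).
Hypothesis cp : control_problem rho adm cost.
Variable h : R.
Hypothesis h0 : 0 <= h.
Local Notation J := (step adm cost h).

Lemma step_ub f x c : (forall u, adm u -> walk h u f x - h * cost u <= c) -> J f x <= c.
Proof.
move=> H; apply: ge_sup; last by move=> _ [u au <-]; exact: H.
by have [u [au _ _]] := cp_free cp; exists (walk h u f x - h * cost u); exists u.
Qed.

Lemma step_lb f x u : bounded f -> adm u -> walk h u f x - h * cost u <= J f x.
Proof.
move=> [C fC] au; apply: ub_le_sup; last by exists u.
exists C => _ [w aw <-].
have := walk_bound h w x fC; rewrite ler_norml => /andP[_].
have : 0 <= h * cost w by rewrite mulr_ge0 // (cp_cost_ge0 cp).
lra.
Qed.

Lemma step_bound C f x : (forall y, `|f y| <= C) -> `|J f x| <= C.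
Proof.
move=> fC; have fb : bounded f by exists C.
rewrite ler_norml; apply/andP; split.
  have [u [au cu _]] := cp_free cp; apply: le_trans (step_lb x fb au).
  have := walk_bound h u x fC; rewrite cu mulr0 subr0 ler_norml => /andP[].
  by [].
apply: step_ub => u au; have := walk_bound h u x fC; rewrite ler_norml => /andP[_].
have : 0 <= h * cost u by rewrite mulr_ge0 // (cp_cost_ge0 cp).
lra.
Qed.

Lemma convex_operator_step : convex_operator bounded J.
Proof.
split.
- exact: domain_bounded.
- by move=> f [C fC]; exists C => x; exact: step_bound.
- move=> f g fb gb fg x; apply: step_ub => u au.
  apply: le_trans (step_lb x gb au); rewrite lerD2r; exact: walk_le.
- move=> f c fb x.
  have E u : walk h u (fun y => f y + c) x = walk h u f x + c.
    have := walk_lin h u 1 1 f (fun=> c) x.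
    rewrite walk_cst !mul1r => <-; congr (walk h u _ x).
    by apply/funext => y; rewrite !mul1r.
  apply/eqP; rewrite eq_le; apply/andP; split.
    by apply: step_ub => u au; rewrite E; have := step_lb x fb au; lra.
  rewrite -lerBrDr; apply: step_ub => u au.
  by have := step_lb x (bounded_addcst c fb) au; rewrite E; lra.
- move=> x; apply/eqP; rewrite eq_le; apply/andP; split.
    apply: step_ub => u au; rewrite walk_cst sub0r oppr_le0 mulr_ge0 //.
    exact: (cp_cost_ge0 cp).
  have [u [au cu _]] := cp_free cp.
  by have := step_lb x (bounded_cst 0) au; rewrite walk_cst cu mulr0 subr0.
- move=> f z fb x; rewrite /step; congr sup.
  by apply/funext => r; apply/propext; split => -[u au <-]; exists u => //;
    rewrite walk_shift.
- move=> f g lam fb gb /andP[l0 l1] x; apply: step_ub => u au.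
  rewrite walk_lin.
  have H1 := ler_wpM2l l0 (step_lb x fb au).
  have l1' : 0 <= 1 - lam by lra.
  have H2 := ler_wpM2l l1' (step_lb x gb au).
  lra.
Qed.

(** Walks commute with averages, and the supremum over the controls of an
  average is at most the average of the supremum. *)
Lemma jensen_step : jensen J.
Proof.
move=> A C f hA fC x; apply: step_ub => u au.
have JC := co_BL convex_operator_step fC.
have fb := BL_bounded fC.
rewrite (av_walk _ _ hA fC) lerBlDr.
have -> : A (J f) x + h * cost u = A (fun y => 1 * J f y + 1 * (h * cost u)) x.
  by rewrite (av_lin hA 1 1 JC (BL_cst _)) (av_cst hA) !mul1r.
apply: (av_le hA (walk_BL h u fC) (BL_lin 1 1 JC (BL_cst _))) => y.
by have := step_lb y fb au; lra.
Qed.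

End StepTheory.

End Operators.

(** * Hamiltonians and consistency of the scheme *)

Section Consistency.
Context {R : realType} {d : nat}.
Local Notation X := 'rV[R]_d.
Local Notation M := 'M[R]_d.
Local Notation control := (@control R d).
Implicit Types (f g v : X -> R) (u : control) (adm : set control)
  (cost : control -> R) (rho : R -> R) (q : M * X).

Definition linear_part q u : R := \tr (q.1 *m diffusion u) / 2 + dot q.2 u.2.

Definition Lam : R := d.+1%:R ^+ 2.

Lemma Lam_ge1 : 1 <= Lam.
Proof. by rewrite exprn_ege1 // ler1n. Qed.

Lemma trace_bound (A B : M) : `|\tr (A *m B)| <= d%:R ^+ 2 * (`|A| * `|B|).
Proof.
apply: le_trans (ler_norm_sum _ _ _) _; rewrite expr2 -mulrA.
apply: ler_sum_ord => i; rewrite mxE; apply: le_trans (ler_norm_sum _ _ _) _.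
by apply: ler_sum_ord => j; rewrite normrM; apply: ler_pM => //; exact: mx_entry_le.
Qed.

Lemma linear_part_bound B q u : `|q.1| <= B -> `|q.2| <= B ->
  `|linear_part q u| <= Lam * B * magnitude u.
Proof.
move=> q1 q2; have B0 : 0 <= B by exact: le_trans q1.
have s0 := magnitude_ge0 u.
have H1 : `|\tr (q.1 *m diffusion u)| <= d%:R ^+ 2 * (B * magnitude u).
  apply: le_trans (trace_bound _ _) _; apply: ler_wpM2l; first exact: exprn_ge0.
  by apply: ler_pM => //; exact: diffusion_le_magnitude.
have H2 : `|dot q.2 u.2| <= d%:R * (B * magnitude u).
  apply: le_trans (norm_dot _ _) _; apply: ler_wpM2l => //.
  by apply: ler_pM => //; exact: drift_le_magnitude.
rewrite (le_trans (ler_normD _ _)) // normrM [`|2^-1|]ger0_norm ?invr_ge0 //.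
have -> : Lam * B * magnitude u = d%:R ^+ 2 * (B * magnitude u) + 2 * (d%:R * (B * magnitude u)) + B * magnitude u.
  by rewrite /Lam -natr1; ring.
have : 0 <= B * magnitude u by exact: mulr_ge0.
have : 0 <= d%:R * (B * magnitude u) by rewrite !mulr_ge0.
have : 0 <= d%:R ^+ 2 * (B * magnitude u) by rewrite !mulr_ge0.
have := normr_ge0 (\tr (q.1 *m diffusion u)).
lra.
Qed.

Lemma linear_partB q q' u :
  linear_part q u - linear_part q' u = linear_part (q.1 - q'.1, q.2 - q'.2) u.
Proof. by rewrite /linear_part /= mulmxBl raddfB /= dotBl; lra. Qed.

Definition ham adm cost q : R := sup [set linear_part q u - cost u | u in adm].

Definition ham_bound rho B : R := Lam * B * (rho (Lam * B) + rho 1).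
Definition ham_lip rho B : R := Lam * rho (Lam * B + ham_bound rho B).

Section HamTheory.
Variables (rho : R -> R) (adm : set control) (cost : control -> R).
Hypothesis cp : control_problem rho adm cost.
Local Notation H := (ham adm cost).

Lemma rho_ge0 m : 0 <= rho m.
Proof. by apply: le_trans (cp_rho cp m). Qed.

Lemma ham_bound_ge0 B : 0 <= B -> 0 <= ham_bound rho B.
Proof. by move=> B0; rewrite !mulr_ge0 ?addr_ge0 ?rho_ge0. Qed.

Lemma ham_lip_ge0 B : 0 <= ham_lip rho B.
Proof. by rewrite mulr_ge0 ?rho_ge0 // (le_trans _ Lam_ge1). Qed.

(** The linear part grows at most linearly in the control, whereas the cost is
  superlinear. *)
Lemma large_control B k q u : `|q.1| <= B -> `|q.2| <= B -> adm u -> 0 <= k ->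
  magnitude u <= rho (Lam * B + k) \/ linear_part q u - cost u <= - k.
Proof.
move=> q1 q2 au k0; have [h|h] := leP (magnitude u) (rho (Lam * B + k)); [by left|right].
have H1 := cp_coercive cp au h.
have := linear_part_bound u q1 q2; rewrite ler_norml => /andP[_ H2].
have s1 : 1 <= magnitude u by apply: le_trans (cp_rho cp _) (ltW h).
have : k <= k * magnitude u by rewrite ler_peMr.
lra.
Qed.

Lemma ham_ub q c : (forall u, adm u -> linear_part q u - cost u <= c) -> H q <= c.
Proof.
move=> Hc; apply: ge_sup; last by move=> _ [u au <-]; exact: Hc.
by have [u [au _ _]] := cp_free cp; exists (linear_part q u - cost u); exists u.
Qed.

Lemma linear_part_le B q u : `|q.1| <= B -> `|q.2| <= B -> adm u ->
  linear_part q u - cost u <= Lam * B * rho (Lam * B).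
Proof.
move=> q1 q2 au.
have LB0 : 0 <= Lam * B.
  by rewrite mulr_ge0 // ?(le_trans _ Lam_ge1) // (le_trans _ q1).
have [h|h] := large_control q1 q2 au (lexx 0); rewrite ?addr0 in h.
  have := linear_part_bound u q1 q2; rewrite ler_norml => /andP[_ H2].
  have := ler_wpM2l LB0 h; have := cp_cost_ge0 cp au; lra.
apply: le_trans h _; rewrite oppr0; exact: mulr_ge0 LB0 (rho_ge0 _).
Qed.

Lemma ham_lb q u : adm u -> linear_part q u - cost u <= H q.
Proof.
move=> au; apply: ub_le_sup; last by exists u.
pose B := `|q.1| + `|q.2|.
exists (Lam * B * rho (Lam * B)) => _ [w aw <-].
by apply: linear_part_le => //; rewrite /B ?lerDl ?lerDr.
Qed.

Lemma ham_norm_le B q : `|q.1| <= B -> `|q.2| <= B -> `|H q| <= ham_bound rho B.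
Proof.
move=> q1 q2; have B0 : 0 <= B by exact: le_trans q1.
have L0 : 0 <= Lam by exact: le_trans Lam_ge1.
have LB0 : 0 <= Lam * B by exact: mulr_ge0.
have W1 := mulr_ge0 LB0 (rho_ge0 1).
have W2 := mulr_ge0 LB0 (rho_ge0 (Lam * B)).
rewrite /ham_bound mulrDr ler_norml; apply/andP; split.
  have [u [au cu su]] := cp_free cp.
  have := ham_lb q au; rewrite cu subr0.
  have := linear_part_bound u q1 q2; rewrite ler_norml => /andP[H2 _].
  have := ler_wpM2l LB0 su; lra.
apply: ham_ub => u au; have := linear_part_le q1 q2 au; lra.
Qed.

(** By coercivity the supremum may be restricted to a bounded set of controls,
  on which the linear parts differ by a multiple of e. *)
Lemma ham_le_add B q q' e : `|q.1| <= B -> `|q.2| <= B -> `|q'.1| <= B -> `|q'.2| <= B ->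
  `|q.1 - q'.1| <= e -> `|q.2 - q'.2| <= e -> H q <= H q' + ham_lip rho B * e.
Proof.
move=> q1 q2 q1' q2' d1 d2; have B0 : 0 <= B by exact: le_trans q1.
have e0 : 0 <= e by exact: le_trans d1.
have Le0 : 0 <= Lam * e by rewrite mulr_ge0 // (le_trans _ Lam_ge1).
apply: ham_ub => u au.
have [h|h] := large_control q1 q2 au (ham_bound_ge0 B0).
  have := linear_part_bound (q := (q.1 - q'.1, q.2 - q'.2)) u d1 d2.
  rewrite -linear_partB ler_norml => /andP[_ H2].
  have := ham_lb q' au.
  have := ler_wpM2l Le0 h; rewrite /ham_lip; lra.
apply: le_trans h _.
have := ham_norm_le q1' q2'; rewrite ler_norml => /andP[H1 _].
have := mulr_ge0 (ham_lip_ge0 B) e0; lra.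
Qed.

Lemma ham_lipschitz B q q' e : `|q.1| <= B -> `|q.2| <= B -> `|q'.1| <= B -> `|q'.2| <= B ->
  `|q.1 - q'.1| <= e -> `|q.2 - q'.2| <= e -> `|H q - H q'| <= ham_lip rho B * e.
Proof.
move=> q1 q2 q1' q2' d1 d2; rewrite ler_norml; apply/andP; split.
  have := @ham_le_add B q' q e q1' q2' q1 q2; rewrite distrC => /(_ d1).
  by rewrite distrC => /(_ d2); lra.
by have := ham_le_add q1 q2 q1' q2' d1 d2; lra.
Qed.

Lemma ham_BL B v p Q : taylor B v p Q ->
  BL (ham_bound rho B + ham_lip rho B * B) (fun x => H (Q x, p x)).
Proof.
move=> tv; have B0 := BL_ge0 (ty_v tv).
have [p1 p2] := ty_p tv; have [Q1 Q2] := ty_Q tv.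
split=> [x|x y].
  apply: le_trans (ham_norm_le (B := B) _ _) _ => //=.
  by rewrite lerDl mulr_ge0 // ham_lip_ge0.
apply: le_trans (ham_lipschitz (B := B) (e := B * `|x - y|) _ _ _ _ _ _) _ => //=.
rewrite mulrA; apply: ler_wpM2r => //.
by rewrite lerDr ham_bound_ge0.
Qed.

End HamTheory.

(** Second differences are bounded from above only: this suffices to estimate
  the walk from above, and the capped barriers below satisfy no lower bound. *)
Definition semiconcave B f : Prop :=
  (forall x y, f (x + y) <= f x + B * `|y|) /\
  (forall z w, f (z + w) + f (z - w) <= 2 * f z + B * `|w| ^+ 2).

Lemma taylor_semiconcave B v p Q : taylor B v p Q ->
  semiconcave (2 * B) v /\ semiconcave (2 * B) (fun x => - v x).
Proof.
move=> tv; have B0 := BL_ge0 (ty_v tv).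
have L x y : `|v (x + y) - v x| <= B * `|y|.
  by apply: le_trans (proj2 (ty_v tv) _ _) _; rewrite addrAC subrr add0r.
have D z w : `|v (z + w) + v (z - w) - 2 * v z| <= 2 * B * `|w| ^+ 2.
  have H1 := ty_1 tv z w; have H2 := ty_1 tv z (- w).
  rewrite normrN -scaleN1r dotZr scaleN1r in H2.
  have -> : v (z + w) + v (z - w) - 2 * v z = (v (z + w) - v z - dot (p z) w)
     + (v (z - w) - v z - -1 * dot (p z) w) by lra.
  by rewrite (le_trans (ler_normD _ _)) //; lra.
have Bn (y : X) : 0 <= B * `|y| by exact: mulr_ge0.
split; split=> [x y|z w].
- by have := L x y; have := Bn y; rewrite ler_norml => ? /andP[]; lra.
- by have := D z w; rewrite ler_norml => /andP[]; lra.
- by have := L x y; have := Bn y; rewrite ler_norml => ? /andP[]; lra.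
- by have := D z w; rewrite ler_norml => /andP[]; lra.
Qed.

Lemma norm_jump_sqr h u k : 0 <= h -> `|jump h u k| ^+ 2 <= d.+1%:R * h * magnitude u.
Proof.
move=> h0; have N0 : 0 <= d.+1%:R * h by rewrite mulr_ge0.
rewrite normrZ exprMn ger0_norm ?sqrtr_ge0 // sqr_sqrtr //.
by apply: ler_wpM2l => //; exact: row_le_magnitude.
Qed.

Lemma walk_semiconcave B h u f x : 0 <= B -> 0 <= h -> semiconcave B f ->
  walk h u f x <= f x + h * (d.+2%:R * B * magnitude u).
Proof.
move=> B0 h0 [f1 f2].
have s0 := magnitude_ge0 u.
have Ns : (0 : R) < d.+1%:R by rewrite ltr0n.
have W : 0 <= h * (B * magnitude u) by rewrite !mulr_ge0.
have step k : f (x + (h *: u.2 + jump h u k)) + f (x + (h *: u.2 - jump h u k))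
   <= 2 * f x + 2 * (h * (B * magnitude u)) + d.+1%:R * (h * (B * magnitude u)).
  rewrite !addrA.
  have H1 := f2 (x + h *: u.2) (jump h u k).
  have H2 := f1 x (h *: u.2).
  have H3 : B * `|h *: u.2| <= h * (B * magnitude u).
    rewrite normrZ ger0_norm // mulrCA; apply: ler_wpM2l => //.
    by apply: ler_wpM2l => //; exact: drift_le_magnitude.
  have := ler_wpM2l B0 (norm_jump_sqr u k h0).
  have -> : B * (d.+1%:R * h * magnitude u) = d.+1%:R * (h * (B * magnitude u)) by ring.
  lra.
have Ni : 0 < (2 * d.+1%:R : R)^-1 by rewrite invr_gt0 mulr_gt0.
have := ler_wpM2l (ltW Ni) (ler_sum_ord step).
move=> /le_trans; apply.
have -> : d.+2%:R = d.+1%:R + 1 :> R by rewrite -natr1.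
have N0 : (d.+1%:R : R) != 0 by rewrite pnatr_eq0.
have -> : (2 * d.+1%:R)^-1 * (d.+1%:R * (2 * f x + 2 * (h * (B * magnitude u))
    + d.+1%:R * (h * (B * magnitude u))))
  = f x + h * (B * magnitude u) + d.+1%:R * (h * (B * magnitude u)) / 2.
  by move: (d.+1%:R) N0 => N N0; field.
have : 0 <= d.+1%:R * (h * (B * magnitude u)) by rewrite mulr_ge0.
have -> : h * ((d.+1%:R + 1) * B * magnitude u) = d.+1%:R * (h * (B * magnitude u)) + h * (B * magnitude u) by ring.
lra.
Qed.

Lemma small_time (C1 C2 e : R) : 0 <= C1 -> 0 <= C2 -> 0 < e ->
  exists h0, [/\ 0 < h0, h0 <= 1 & forall h, 0 <= h <= h0 ->
    C1 * Num.sqrt h <= e /\ C2 * h <= e].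
Proof.
move=> C10 C20 e0; pose t := e / (C1 + C2 + e).
have D0 : 0 < C1 + C2 + e by lra.
have t0 : 0 < t by exact: divr_gt0.
have t1 : t <= 1 by rewrite ler_pdivrMr // mul1r; lra.
have tE : t * (C1 + C2 + e) = e by rewrite /t divfK // gt_eqF.
have Ct1 := mulr_ge0 C10 (ltW t0); have Ct2 := mulr_ge0 C20 (ltW t0).
have te := mulr_ge0 (ltW t0) (ltW e0).
exists (t ^+ 2); split; [exact: exprn_gt0|by rewrite expr_le1 // ltW|].
move=> h /andP[h0 ht]; split.
  have : Num.sqrt h <= t.
    by rewrite -(ger0_norm (ltW t0)) -sqrtr_sqr ler_wsqrtr.
  by move=> /(ler_wpM2l C10); lra.
have : h <= t.
  apply: le_trans ht _; rewrite expr2 -[leRHS]mulr1; apply: ler_wpM2l => //.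
  exact: ltW.
by move=> /(ler_wpM2l C20); lra.
Qed.

Section StepEstimates.
Variables (rho : R -> R) (adm : set control) (cost : control -> R).
Hypothesis cp : control_problem rho adm cost.
Variable h : R.
Hypothesis h0 : 0 <= h.
Local Notation J := (step adm cost h).

(** Up to the radius rho m the walk gains at most a multiple of rho m, and
  beyond it the cost outweighs the gain. *)
Lemma step_semiconcave B m f x : 0 <= B -> semiconcave B f -> d.+2%:R * B <= m ->
  J f x <= f x + h * (d.+2%:R * B * rho m).
Proof.
move=> B0 fB Bm; apply: (step_ub cp) => u au.
have H1 := walk_semiconcave u x B0 h0 fB.
have s0 := magnitude_ge0 u.
have K0 : 0 <= d.+2%:R * B by rewrite mulr_ge0.
have [hs|hs] := leP (magnitude u) (rho m).
  have H2 := ler_wpM2l h0 (ler_wpM2l K0 hs).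
  have : 0 <= h * cost u by rewrite mulr_ge0 // (cp_cost_ge0 cp).
  lra.
have H2 := ler_wpM2l h0 (cp_coercive cp au hs).
have H3 := ler_wpM2l h0 (ler_wpM2r s0 Bm).
have : 0 <= h * (d.+2%:R * B * rho m) by rewrite !mulr_ge0 // (rho_ge0 cp).
lra.
Qed.

Lemma step_semiconvex B f x : bounded f -> 0 <= B -> semiconcave B (fun x => - f x) ->
  f x - h * (d.+2%:R * B * rho 1) <= J f x.
Proof.
move=> fb B0 fB; have [u [au cu su]] := cp_free cp.
have := step_lb cp h0 x fb au; rewrite cu mulr0 subr0; apply: le_trans.
have := walk_semiconcave u x B0 h0 fB.
have -> : walk h u (fun y => - f y) x = - walk h u f x.
  have := walk_lin h u (-1) 0 f f x; rewrite mul0r addr0 mulN1r => <-.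
  by congr (walk h u _ x); apply/funext => y; rewrite mul0r addr0 mulN1r.
have K0 : 0 <= d.+2%:R * B by rewrite mulr_ge0.
have H2 := ler_wpM2l h0 (ler_wpM2l K0 su).
lra.
Qed.

End StepEstimates.

Definition drift_const rho B : R :=
  d.+2%:R * (2 * B) * (rho (d.+2%:R * (2 * B)) + rho 1).

Section StepNear.
Variables (rho : R -> R) (adm : set control) (cost : control -> R).
Hypothesis cp : control_problem rho adm cost.
Variable h : R.
Hypothesis h0 : 0 <= h.
Local Notation J := (step adm cost h).

Lemma step_near B v p Q x : taylor B v p Q ->
  `|J v x - v x| <= h * drift_const rho B.
Proof.
move=> tv; have B0 := BL_ge0 (ty_v tv).
have [c1 c2] := taylor_semiconcave tv.
have B20 : 0 <= 2 * B by rewrite mulr_ge0.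
have vb := BL_bounded (ty_v tv).
have H1 := step_semiconcave cp h0 x B20 c1 (lexx _).
have H2 := step_semiconvex cp h0 x vb B20 c2.
have K0 : 0 <= d.+2%:R * (2 * B) by rewrite mulr_ge0.
have W1 := mulr_ge0 h0 (mulr_ge0 K0 (rho_ge0 cp 1)).
have W2 := mulr_ge0 h0 (mulr_ge0 K0 (rho_ge0 cp (d.+2%:R * (2 * B)))).
by rewrite ler_norml /drift_const !mulrDr; apply/andP; split; lra.
Qed.

Lemma iter_step_near B v p Q m x : taylor B v p Q ->
  `|iter m J v x - v x| <= m%:R * h * drift_const rho B.
Proof.
move=> tv; have vb := BL_bounded (ty_v tv).
have hJ := convex_operator_step cp h0.
elim: m x => [|m IH] x; first by rewrite subrr normr0 !mul0r.
have H1 := co_contraction hJ (co_dom (convex_operator_iter m hJ) vb) vb IH x.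
have H2 := step_near x tv.
rewrite iterS -natr1 !mulrDl mul1r.
by have := ler_distD (J v x) (J (iter m J v) x) (v x); lra.
Qed.

End StepNear.

Lemma quad_parallelogram (Q : M) (z w : X) :
  quad Q (z + w) + quad Q (z - w) = 2 * quad Q z + 2 * quad Q w.
Proof.
rewrite /quad !mulr_sumr -!big_split; apply: eq_bigr => i _ /=.
rewrite !mulr_sumr -!big_split; apply: eq_bigr => j _ /=.
by rewrite !mxE; ring.
Qed.

Lemma sum_quad_row (Q : M) u : \sum_(k < d.+1) quad Q (row k u.1) = \tr (Q *m diffusion u).
Proof.
rewrite /mxtrace /quad exchange_big; apply: eq_bigr => i _.
rewrite mxE exchange_big; apply: eq_bigr => j _.
rewrite mxE mulr_sumr; apply: eq_bigr => k _.
by rewrite !mxE; ring.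
Qed.

(** By symmetry the first-order terms of the jumps cancel, and their
  second-order terms sum to the trace. What is left is the second-order term
  of the drift, of order h^2, and Taylor remainders of order h^(3/2). *)
Lemma walk_taylor B s : 0 <= B -> 0 <= s -> exists2 C, 0 <= C &
  forall h u v p Q x, 0 <= h <= 1 -> magnitude u <= s -> taylor B v p Q ->
  `|walk h u v x - v x - h * linear_part (Q x, p x) u| <= C * (h * Num.sqrt h).
Proof.
move=> B0 s0; pose m := s + Num.sqrt (d.+1%:R * s).
have m0 : 0 <= m by rewrite addr_ge0 // sqrtr_ge0.
have C10 : 0 <= B * m ^+ 3 by rewrite mulr_ge0 // exprn_ge0.
have C20 : 0 <= d%:R ^+ 2 * (B * s ^+ 2) by rewrite !mulr_ge0 // exprn_ge0.
exists (B * m ^+ 3 + d%:R ^+ 2 * (B * s ^+ 2)); first exact: addr_ge0.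
(* Every displacement of the walk is at most m times the square root of h. *)
move=> h u v p Q x /andP[h0 h1] us tv.
have sh0 : 0 <= Num.sqrt h by exact: sqrtr_ge0.
have sh2 : Num.sqrt h ^+ 2 = h by rewrite sqr_sqrtr.
have hsh : h <= Num.sqrt h.
  rewrite -[leLHS]sh2 expr2 -[leRHS]mulr1; apply: ler_wpM2l => //.
  by rewrite -sqrtr1 ler_wsqrtr.
have bs : `|u.2| <= s by apply: le_trans (drift_le_magnitude u) us.
have hb : `|h *: u.2| <= Num.sqrt h * s.
  by rewrite normrZ ger0_norm //; apply: ler_pM.
have jb k : `|jump h u k| <= Num.sqrt h * Num.sqrt (d.+1%:R * s).
  rewrite -(ger0_norm (mulr_ge0 sh0 (sqrtr_ge0 (d.+1%:R * s)))).
  rewrite -[leLHS]normr_id -!sqrtr_sqr ler_wsqrtr // exprMn !sqr_sqrtr ?mulr_ge0 //.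
  apply: le_trans (norm_jump_sqr u k h0) _.
  rewrite mulrA [h * _]mulrC; apply: ler_wpM2l => //; exact: mulr_ge0.
pose r y := v (x + y) - v x - dot (p x) y - quad (Q x) y / 2.
have rB y : `|y| <= Num.sqrt h * m -> `|r y| <= B * m ^+ 3 * (h * Num.sqrt h).
  move=> ym; apply: le_trans (ty_2 tv x y) _.
  have -> : B * m ^+ 3 * (h * Num.sqrt h) = B * (Num.sqrt h * m) ^+ 3.
    by rewrite -{1}sh2; ring.
  apply: ler_wpM2l => //; rewrite lerXn2r ?nnegrE //.
  exact: mulr_ge0.
have vE y : v (x + y) = v x + dot (p x) y + quad (Q x) y / 2 + r y by rewrite /r; lra.
have N0 : (d.+1%:R : R) != 0 by rewrite pnatr_eq0.
have Nh : 0 <= d.+1%:R * h by rewrite mulr_ge0.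
have walkE : walk h u v x - v x - h * linear_part (Q x, p x) u =
    quad (Q x) (h *: u.2) / 2
    + (2 * d.+1%:R)^-1 * \sum_(k < d.+1) (r (h *: u.2 + jump h u k) + r (h *: u.2 - jump h u k)).
  have E k : v (x + (h *: u.2 + jump h u k)) + v (x + (h *: u.2 - jump h u k))
     = (2 * v x + 2 * (h * dot (p x) u.2) + quad (Q x) (h *: u.2))
       + d.+1%:R * h * quad (Q x) (row k u.1)
       + (r (h *: u.2 + jump h u k) + r (h *: u.2 - jump h u k)).
    have P := quad_parallelogram (Q x) (h *: u.2) (jump h u k).
    have -> : d.+1%:R * h * quad (Q x) (row k u.1) = quad (Q x) (jump h u k).
      by rewrite /jump quadZ sqr_sqrtr.
    rewrite !vE.
    have -> : h *: u.2 - jump h u k = h *: u.2 + (-1) *: jump h u k by rewrite scaleN1r.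
    rewrite scaleN1r.
    rewrite !dotDr -[- jump h u k]scaleN1r !dotZr scaleN1r; lra.
  rewrite /walk /linear_part (eq_bigr _ (fun k _ => E k)).
  set T := \sum_(k < d.+1) (r _ + r _).
  have -> (F : 'I_d.+1 -> R) (A c : R) (q : 'I_d.+1 -> R) :
      \sum_(k < d.+1) (A + c * q k + F k) = d.+1%:R * A + c * \sum_k q k + \sum_k F k.
    by rewrite !big_split /= -mulr_sumr sumr_const card_ord mulr_natl.
  rewrite sum_quad_row -/T.
  by move: T (d.+1%:R) N0 => T N N0; field.
rewrite walkE.
have -> : (B * m ^+ 3 + d%:R ^+ 2 * (B * s ^+ 2)) * (h * Num.sqrt h)
  = d%:R ^+ 2 * (B * s ^+ 2) * (h * Num.sqrt h) + B * m ^+ 3 * (h * Num.sqrt h) by ring.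
rewrite (le_trans (ler_normD _ _)) //; apply: lerD.
  rewrite normrM [`|2^-1|]ger0_norm ?invr_ge0 //.
  apply: (@le_trans _ _ `|quad (Q x) (h *: u.2)|).
    by rewrite ler_piMr // invf_le1 ?ler1n.
  apply: le_trans (norm_quad _ _) _.
  have -> : d%:R ^+ 2 * (B * s ^+ 2) * (h * Num.sqrt h)
    = d%:R ^+ 2 * (B * (s ^+ 2 * (h * Num.sqrt h))) by ring.
  apply: ler_wpM2l; first exact: exprn_ge0.
  apply: ler_pM => //; first exact: (proj1 (ty_Q tv)).
  apply: (@le_trans _ _ ((h * s) ^+ 2)).
    rewrite lerXn2r ?nnegrE ?mulr_ge0 // normrZ ger0_norm //; exact: ler_wpM2l.
  rewrite exprMn mulrC; apply: ler_wpM2l; first exact: exprn_ge0.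
  by rewrite expr2; apply: ler_wpM2l.
have Ni : 0 <= (2 * d.+1%:R : R)^-1 by rewrite invr_ge0 mulr_ge0.
rewrite normrM ger0_norm //.
have := ler_wpM2l Ni (le_trans (ler_norm_sum _ _ _) (@ler_sum_ord _ d.+1 (fun k => `|r (h *: u.2 + jump h u k) + r (h *: u.2 - jump h u k)|) (2 * (B * m ^+ 3 * (h * Num.sqrt h))) _)).
have -> : (2 * d.+1%:R)^-1 * (d.+1%:R * (2 * (B * m ^+ 3 * (h * Num.sqrt h))))
   = B * m ^+ 3 * (h * Num.sqrt h).
  by move: (d.+1%:R) N0 => N N0; field.
apply=> k.
rewrite (le_trans (ler_normD _ _)) // [leRHS]mulrDl mul1r; apply: lerD; apply: rB.
  by rewrite (le_trans (ler_normD _ _)) // mulrDr lerD.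
by rewrite (le_trans (ler_normB _ _)) // mulrDr lerD.
Qed.

(** Coercivity confines the suprema in the step and in the Hamiltonian to
  controls of bounded magnitude, on which the expansion of the walk is
  uniform. *)
Lemma step_consistent rho B : (forall m, 1 <= rho m) -> 0 <= B -> exists2 C, 0 <= C &
  forall adm cost, control_problem rho adm cost ->
  forall h v p Q x, 0 < h <= 1 -> taylor B v p Q ->
  `|step adm cost h v x - v x - h * ham adm cost (Q x, p x)| <= C * (h * Num.sqrt h).
Proof.
move=> rho1 B0.
have rho0 m : 0 <= rho m by apply: le_trans (rho1 m).
have L0 : 0 <= Lam by exact: le_trans Lam_ge1.
have hb0 : 0 <= ham_bound rho B by rewrite !mulr_ge0 // addr_ge0.
pose kap := d.+2%:R * (2 * B).
have kap0 : 0 <= kap by rewrite !mulr_ge0.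
(* K exceeds, up to sign, the lower bounds of the Hamiltonian and of the
  increment of the step, so controls that yield at most - K do not matter for
  either. *)
pose K := ham_bound rho B + kap * rho 1.
have K0 : 0 <= K by rewrite addr_ge0 // mulr_ge0.
pose s := rho (kap + K) + rho (Lam * B + K).
have s0 : 0 <= s by rewrite addr_ge0.
have [C C0 HC] := walk_taylor B0 s0.
exists C => // adm cost cp h v p Q x /andP[hp h1] tv.
have h0 := ltW hp.
have h01 : 0 <= h <= 1 by rewrite h0.
have vb := BL_bounded (ty_v tv).
have p1 := proj1 (ty_p tv) x; have Q1 := proj1 (ty_Q tv) x.
have B20 : 0 <= 2 * B by rewrite mulr_ge0.
have [c1 c2] := taylor_semiconcave tv.
have R0 : 0 <= C * (h * Num.sqrt h) by rewrite !mulr_ge0 // sqrtr_ge0.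
have Hn := ham_norm_le cp (q := (Q x, p x)) Q1 p1.
rewrite ler_norml in Hn; case/andP: Hn => Hn _.
have hHn := ler_wpM2l h0 Hn.
have hk1 : 0 <= h * (kap * rho 1) by rewrite !mulr_ge0.
have hhb : 0 <= h * ham_bound rho B by rewrite mulr_ge0.
rewrite ler_norml; apply/andP; split.
  suff : ham adm cost (Q x, p x) <= (step adm cost h v x - v x + C * (h * Num.sqrt h)) / h.
    by rewrite ler_pdivlMr // mulrC; lra.
  apply: (ham_ub cp) => u au; rewrite ler_pdivlMr // mulrC mulrBr.
  have Jl := step_lb cp h0 x vb au.
  have [|us] := large_control cp (q := (Q x, p x)) Q1 p1 au K0.
    move=> us; have us' : magnitude u <= s by rewrite /s; have := rho0 (kap + K); lra.
    have := HC _ _ _ _ _ x h01 us' tv; rewrite ler_norml => /andP[+ _]; lra.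
  have := ler_wpM2l h0 us.
  have := step_semiconvex cp h0 x vb B20 c2.
  rewrite /K -/kap; lra.
suff : step adm cost h v x <= v x + h * ham adm cost (Q x, p x) + C * (h * Num.sqrt h) by lra.
apply: (step_ub cp) => u au.
have [us|us] := leP (magnitude u) (rho (kap + K)).
  have us' : magnitude u <= s by rewrite /s; have := rho0 (Lam * B + K); lra.
  have := HC _ _ _ _ _ x h01 us' tv; rewrite ler_norml => /andP[_].
  have := ler_wpM2l h0 (ham_lb cp (Q x, p x) au); lra.
have H1 := walk_semiconcave u x B20 h0 c1.
have H2 := ler_wpM2l h0 (cp_coercive cp au us).
have s1 : 1 <= magnitude u by apply: le_trans (rho1 _) (ltW us).
have H3 : h * K <= h * (K * magnitude u) by apply: ler_wpM2l => //; rewrite ler_peMr.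
move: H1; rewrite -/kap => H1; move: H3; rewrite /K => H3.
rewrite /K in H2; lra.
Qed.

End Consistency.

(** * Comparison of schemes *)

Section Comparison.
Context {R : realType} {d : nat}.
Local Notation X := 'rV[R]_d.
Local Notation M := 'M[R]_d.
Local Notation control := (@control R d).
Implicit Types (f g v : X -> R) (u : control) (adm : set control)
  (cost : control -> R) (rho : R -> R) (q : M * X).

(** Over several steps the scheme moves a smooth function along the Hamiltonian
  of its initial derivatives.  The Hamiltonian applied to v is only Lipschitz;
  its mollification g is smooth, so one-step consistency can be applied along
  the line v + s g. *)
Lemma multi_consistent rho B e : (forall m, 1 <= rho m) -> 0 <= B -> 0 < e ->
  exists h0, [/\ 0 < h0, h0 <= 1 & forall adm cost, control_problem rho adm cost ->
  forall h m v p Q, 0 < h -> m%:R * h <= h0 -> taylor B v p Q -> forall x,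
  `|iter m (step adm cost h) v x - v x - m%:R * h * ham adm cost (Q x, p x)|
     <= e * (m%:R * h)].
Proof.
move=> rho1 B0 e0.
have rho0 m : 0 <= rho m by apply: le_trans (rho1 m).
have L0 : 0 <= (@Lam R d) by exact: le_trans Lam_ge1.
pose Cg := @ham_bound R d rho B + @ham_lip R d rho B * B.
have hb0 : 0 <= @ham_bound R d rho B by rewrite !mulr_ge0 // addr_ge0.
have hl0 b : 0 <= @ham_lip R d rho b by rewrite mulr_ge0.
have Cg0 : 0 <= Cg by rewrite addr_ge0 // mulr_ge0.
have D0 : 0 < 8 * d%:R * Cg + 1 by rewrite ltr_wpDl // !mulr_ge0.
pose eta := e / (8 * d%:R * Cg + 1).
have eta0 : 0 < eta by exact: divr_gt0.
have etaE : 2 * d%:R * Cg * eta <= e / 4.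
  have : eta * (8 * d%:R * Cg + 1) = e by rewrite /eta divfK // gt_eqF.
  lra.
pose Bg := @mollconst R d Cg eta.
have Bg0 : 0 <= Bg by exact: mollconst_ge0.
pose B1 := B + Bg.
have B10 : 0 <= B1 by exact: addr_ge0.
have [C1 C10 HC1] := @step_consistent R d rho B1 rho1 B10.
have e40 : 0 < e / 4 by rewrite divr_gt0.
have C20 : 0 <= @ham_lip R d rho B1 * Bg by exact: mulr_ge0.
have [h0 [h00 h01 Hh0]] := small_time C10 C20 e40.
exists h0; split=> // adm cost cp h m v p Q hp mh tv.
have hnn := ltW hp.
set J := step adm cost h; set H := ham adm cost.
have hJ : convex_operator bounded J := convex_operator_step cp hnn.
pose g0 x := H (Q x, p x).
have g0B : BL Cg g0 := ham_BL cp tv.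
pose g := mollify eta g0.
have gB : BL Cg g by apply: av_BL g0B; exact: averaging_mollify.
have gg0 x : `|g x - g0 x| <= e / 4.
  exact: le_trans (mollify_near eta0 g0B x) etaE.
have [pg [Qg tg]] := mollify_taylor eta0 g0B.
rewrite -/g -/Bg in tg.
have vb := BL_bounded (ty_v tv).
have gb := BL_bounded gB.
(* The line along which the scheme travels; w s is smooth uniformly in s up to
  1. *)
pose w s x := v x + s * g x.
have wb s : bounded (w s).
  have := bounded_lin 1 s vb gb.
  by have -> : (fun x => 1 * v x + s * g x) = w s by apply/funext => x; rewrite mul1r.
have tw s : 0 <= s <= 1 -> taylor B1 (w s) (fun x => p x + s *: pg x) (fun x => Q x + s *: Qg x).
  move=> /andP[s0 s1].
  have := taylor_lin 1 s tv tg.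
  have -> : (fun x => 1 * v x + s * g x) = w s by apply/funext => x; rewrite mul1r.
  have -> : (fun x => 1 *: p x + s *: pg x) = (fun x => p x + s *: pg x).
    by apply/funext => x; rewrite scale1r.
  have -> : (fun x => 1 *: Q x + s *: Qg x) = (fun x => Q x + s *: Qg x).
    by apply/funext => x; rewrite scale1r.
  apply: le_taylor; rewrite normr1 mul1r /B1 lerD2l ger0_norm //.
  by rewrite ler_piMl.
have onestep s : 0 <= s -> s + h <= h0 -> forall x,
    `|J (w s) x - w (s + h) x| <= h * (3 * (e / 4)).
  move=> s0 sh x.
  have s1 : 0 <= s <= 1 by rewrite s0 /=; lra.
  have h1 : 0 < h <= 1 by rewrite hp /=; lra.
  have [A1 _] := Hh0 h ltac:(rewrite hnn /=; lra).
  have [_ A2] := Hh0 s ltac:(rewrite s0 /=; lra).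
  have E1 := HC1 _ _ cp h _ _ _ x h1 (tw s s1).
  rewrite -/J -/H in E1.
  have [pb _] := ty_p (tw s s1); have [Qb _] := ty_Q (tw s s1).
  have [pb0 _] := ty_p tv; have [Qb0 _] := ty_Q tv.
  have [pgb _] := ty_p tg; have [Qgb _] := ty_Q tg.
  have BB1 : B <= B1 by rewrite /B1 lerDl.
  have E2 : `|H (Q x + s *: Qg x, p x + s *: pg x) - g0 x| <= @ham_lip R d rho B1 * (s * Bg).
    apply: (ham_lipschitz cp) => //=.
    - exact: le_trans (Qb0 x) BB1.
    - exact: le_trans (pb0 x) BB1.
    - by rewrite addrAC subrr add0r normrZ ger0_norm //; apply: ler_wpM2l.
    - by rewrite addrAC subrr add0r normrZ ger0_norm //; apply: ler_wpM2l.
  have E3 := gg0 x.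
  have -> : J (w s) x - w (s + h) x =
    (J (w s) x - w s x - h * H (Q x + s *: Qg x, p x + s *: pg x))
    + h * ((H (Q x + s *: Qg x, p x + s *: pg x) - g0 x) - (g x - g0 x)).
    by rewrite /w; ring.
  rewrite (le_trans (ler_normD _ _)) // normrM (ger0_norm hnn).
  have E4 := ler_normB (H (Q x + s *: Qg x, p x + s *: pg x) - g0 x) (g x - g0 x).
  have E5 : `|(H (Q x + s *: Qg x, p x + s *: pg x) - g0 x) - (g x - g0 x)| <= e / 4 + e / 4.
    lra.
  have := ler_wpM2l hnn E5; have := ler_wpM2l hnn A1; lra.
have main i x : (i <= m)%N ->
   `|iter i J v x - w (i%:R * h) x| <= i%:R * h * (3 * (e / 4)).
  elim: i x => [|i IH] x im.
    by rewrite /w !mul0r addr0 /= subrr normr0.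
  have IH' y := IH y (ltnW im).
  have F1 := co_contraction hJ (co_dom (convex_operator_iter i hJ) vb) (wb (i%:R * h)) IH' x.
  have ih : i%:R * h + h <= h0.
    apply: le_trans mh; rewrite -[X in _ + X]mul1r -mulrDl natr1; apply: ler_wpM2r => //.
    by rewrite ler_nat.
  have F2 := onestep (i%:R * h) (mulr_ge0 (ler0n _ _) hnn) ih x.
  rewrite iterS -natr1 !mulrDl !mul1r.
  have := ler_distD (J (w (i%:R * h)) x) (J (iter i J v) x) (w (i%:R * h + h) x).
  lra.
move=> x; have F1 := main m x (leqnn m); have F2 := gg0 x.
have mh0 : 0 <= m%:R * h by rewrite mulr_ge0.
have F3 := ler_wpM2l mh0 F2.
have -> : iter m J v x - v x - m%:R * h * H (Q x, p x) =
   (iter m J v x - w (m%:R * h) x) + m%:R * h * (g x - g0 x) by rewrite /w /g0; ring.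
rewrite (le_trans (ler_normD _ _)) // normrM (ger0_norm mh0); lra.
Qed.

(** Since P satisfies the Jensen inequality, the mollified trajectory of P is a
  smooth supersolution for P; an operator P' that is dominated by P on such
  smooth functions stays below it. *)
Lemma comparison P P' C eta c f : convex_operator bounded P -> convex_operator bounded P' ->
  jensen P -> 0 < eta -> BL C f ->
  (forall g, BL C g -> forall x, P' (mollify eta g) x <= P (mollify eta g) x + c) ->
  forall j x, iter j P' f x <= iter j P f x + j%:R * c + 4 * d%:R * C * eta.
Proof.
move=> hP hP' jP eta0 fC Hc j x.
have hA := @averaging_mollify R d eta eta0.
have near g : BL C g -> forall x, `|mollify eta g x - g x| <= 2 * d%:R * C * eta.
  exact: mollify_near.
have Cj i : BL C (iter i P f) := co_BL (convex_operator_iter i hP) fC.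
have main i y : iter i P' (mollify eta f) y <= mollify eta (iter i P f) y + i%:R * c.
  elim: i y => [|i IH] y; first by rewrite mul0r addr0.
  have b1 : bounded (mollify eta (iter i P f)) := BL_bounded (av_BL hA (Cj i)).
  have b2 : bounded (iter i P' (mollify eta f)).
    apply: (co_dom (convex_operator_iter i hP')).
    exact: BL_bounded (av_BL hA fC).
  have H1 := co_le_addcst hP' b2 b1 IH y.
  have H2 := Hc _ (Cj i) y.
  have H3 := jP _ _ _ hA (Cj i) y.
  by rewrite iterS -natr1 mulrDl mul1r; lra.
have H1 := main j x.
have H2 := near _ (Cj j) x; rewrite ler_norml in H2; case/andP: H2 => _ H2.
have fM y : `|f y - mollify eta f y| <= 2 * d%:R * C * eta by rewrite distrC; exact: near.
have H3 := co_contraction (convex_operator_iter j hP') (BL_bounded fC) (BL_bounded (av_BL hA fC)) fM x.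
rewrite ler_norml in H3; case/andP: H3 => _ H3.
lra.
Qed.

Definition ham_close B del (H H' : M * X -> R) : Prop :=
  forall q, `|q.1| <= B -> `|q.2| <= B -> `|H q - H' q| <= del.

Lemma ham_close_sym B del H H' : ham_close B del H H' -> ham_close B del H' H.
Proof. by move=> h q q1 q2; rewrite distrC; exact: h. Qed.

Lemma mollify_scale C e : 0 <= C -> 0 < e ->
  exists2 eta : R, 0 < eta & 4 * d%:R * C * eta <= e.
Proof.
move=> C0 e0; have D0 : 0 < 4 * d%:R * C + 1 by rewrite ltr_wpDl // !mulr_ge0.
exists (e / (4 * d%:R * C + 1)); first exact: divr_gt0.
rewrite mulrCA -[leRHS]mulr1; apply: ler_wpM2l; first exact: ltW.
by rewrite ler_pdivrMr // mul1r; lra.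
Qed.

(** Over blocks of common length s each scheme follows its own Hamiltonian on
  mollified functions up to a small multiple of s. By comparison these errors
  add up to a small multiple of T, whatever the step sizes inside the blocks. *)
Lemma block_comparison rho C T e : (forall m, 1 <= rho m) -> 0 <= C -> 0 <= T -> 0 < e ->
  exists h0 B del, [/\ 0 < h0, 0 <= B, 0 < del &
  forall adm cost adm' cost', control_problem rho adm cost ->
  control_problem rho adm' cost' ->
  ham_close B del (ham adm cost) (ham adm' cost') ->
  forall h h' m m' s j f, 0 < h -> 0 < h' -> m%:R * h = s -> m'%:R * h' = s ->
  s <= h0 -> j%:R * s <= T -> BL C f -> forall x,
  iter j (iter m (step adm cost h)) f x
    <= iter j (iter m' (step adm' cost' h')) f x + e].
Proof.
move=> rho1 C0 T0 e0.
have e20 : 0 < e / 2 by rewrite divr_gt0.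
have [eta eta0 etaE] := mollify_scale C0 e20.
pose B := @mollconst R d C eta.
have B0 : 0 <= B by exact: mollconst_ge0.
have D0 : 0 < 6 * (T + 1) by rewrite mulr_gt0 //; lra.
pose e1 := e / (6 * (T + 1)).
have e10 : 0 < e1 by exact: divr_gt0.
have e1E : e1 * (6 * (T + 1)) = e by rewrite /e1 divfK // gt_eqF.
have [h0 [h00 h01 Hh0]] := @multi_consistent rho B e1 rho1 B0 e10.
exists h0, B, e1; split=> // adm cost adm' cost' cp cp' HH h h' m m' s j f hp h'p ms m's sh0 js fC x.
have s0 : 0 <= s by rewrite -ms mulr_ge0 // ltW.
have hJ := convex_operator_step cp (ltW hp).
have hJ' := convex_operator_step cp' (ltW h'p).
have := @comparison (iter m' (step adm' cost' h')) (iter m (step adm cost h)) C eta (3 * e1 * s) f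
  (convex_operator_iter m' hJ') (convex_operator_iter m hJ)
  (jensen_iter m' hJ' (jensen_step cp' (ltW h'p))) eta0 fC.
have ineq : 3 * e1 * (j%:R * s) <= e / 2.
  have : e1 * (j%:R * s) <= e1 * T by apply: ler_wpM2l => //; exact: ltW.
  lra.
move=> /(_ _ j x) Hc; apply: le_trans (Hc _) _; last by lra.
move=> g gC y.
have [pg [Qg tg]] := mollify_taylor eta0 gC.
rewrite -/B in tg.
have mh : m%:R * h <= h0 by rewrite ms.
have mh' : m'%:R * h' <= h0 by rewrite m's.
have F1 := Hh0 _ _ cp h m _ _ _ hp mh tg y.
have F2 := Hh0 _ _ cp' h' m' _ _ _ h'p mh' tg y.
rewrite ms in F1; rewrite m's in F2.
have F3 := HH (Qg y, pg y) (proj1 (ty_Q tg) y) (proj1 (ty_p tg) y).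
have := ler_wpM2l s0 F3.
rewrite -(ger0_norm s0) -normrM (ger0_norm s0) => F4.
move: F1 F2 F4; rewrite !ler_norml => /andP[_ F1] /andP[F2 _] /andP[_ F4].
lra.
Qed.

(** A mollification of f is moved by O(h) in each step, and it is close to f. *)
Lemma time_regular rho C e : (forall m, 1 <= rho m) -> 0 <= C -> 0 < e ->
  exists2 s0, 0 < s0 &
  forall adm cost, control_problem rho adm cost ->
  forall h r f, 0 <= h -> r%:R * h <= s0 -> BL C f -> forall x,
  `|iter r (step adm cost h) f x - f x| <= e.
Proof.
move=> rho1 C0 e0.
have e20 : 0 < e / 2 by rewrite divr_gt0.
have [eta eta0 etaE] := mollify_scale C0 e20.
pose B := @mollconst R d C eta.
have B0 : 0 <= B by exact: mollconst_ge0.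
have rho0 m : 0 <= rho m by apply: le_trans (rho1 m).
have k0 : 0 <= @drift_const R d rho B.
  by apply: mulr_ge0; [do 2 apply: mulr_ge0 => //|exact: addr_ge0].
exists ((e / 2) / (@drift_const R d rho B + 1)); first by rewrite divr_gt0 // ltr_wpDl.
move=> adm cost cp h r f h0 rh fC x.
have hA := @averaging_mollify R d eta eta0.
have [pg [Qg tg]] := mollify_taylor eta0 fC.
rewrite -/B in tg.
have F1 := iter_step_near cp h0 r x tg.
have near y : `|f y - mollify eta f y| <= 2 * d%:R * C * eta.
  by rewrite distrC; exact: mollify_near.
have hJ := convex_operator_iter r (convex_operator_step cp h0).
have F2 := co_contraction hJ (BL_bounded fC) (BL_bounded (av_BL hA fC)) near x.
have F3 := near x; rewrite distrC in F3.
have F4 : r%:R * h * @drift_const R d rho B <= e / 2.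
  move: rh; rewrite ler_pdivlMr ?ltr_wpDl // mulrDr mulr1.
  have : 0 <= r%:R * h by rewrite mulr_ge0.
  lra.
have G1 := ler_distD (mollify eta f x) (iter r (step adm cost h) f x) (f x).
have G2 := ler_distD (iter r (step adm cost h) (mollify eta f) x) (iter r (step adm cost h) f x) (mollify eta f x).
lra.
Qed.

(** ** Dyadic time steps *)

Definition dyadic k : R := (2 ^+ k)^-1.

Lemma dyadic_gt0 k : 0 < dyadic k.
Proof. by rewrite invr_gt0 exprn_gt0. Qed.

Lemma dyadic_split k0 k : (k0 <= k)%N -> (2 ^ (k - k0))%:R * dyadic k = dyadic k0.
Proof.
by move=> kk; rewrite /dyadic natrX -{2}(subnK kk) exprD invfM mulrA mulfV ?mul1r.
Qed.

Lemma dyadic_small e : 0 < e -> exists k, dyadic k <= e.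
Proof.
move=> e0; have [n] : exists n : nat, e^-1 < n%:R.
  by exists (Num.bound e^-1); apply: archi_boundP; rewrite invr_ge0 ltW.
move=> ne; exists n; rewrite /dyadic invf_ple ?posrE ?exprn_gt0 //.
apply: le_trans (ltW ne) _; rewrite -natrX ler_nat; exact: ltnW (ltn_expl _ _).
Qed.

Lemma le_dyadic k0 k : (k0 <= k)%N -> dyadic k <= dyadic k0.
Proof.
by move=> kk; rewrite lef_pV2 ?posrE ?exprn_gt0 // ler_weXn2l // ler1n.
Qed.

Definition steps k (t : R) : nat := Num.truncn (t / dyadic k).

Lemma steps_itv k t : 0 <= t -> (steps k t)%:R * dyadic k <= t /\ t < (steps k t)%:R * dyadic k + dyadic k.
Proof.
move=> t0; have t0' : 0 <= t / dyadic k by rewrite divr_ge0 // ltW // dyadic_gt0.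
have := truncn_itv t0'; rewrite -/(steps k t) => /andP[].
rewrite ler_pdivlMr ?dyadic_gt0 // ltr_pdivrMr ?dyadic_gt0 // -natr1 mulrDl mul1r.
by [].
Qed.

Definition scheme adm cost k (t : R) f : X -> R :=
  iter (steps k t) (step adm cost (dyadic k)) f.

(** At a finer level k the steps are grouped into blocks of length dyadic k0,
  after a remainder shorter than one block. *)
Lemma scheme_block adm cost k0 k t f : (k0 <= k)%N -> 0 <= t ->
  exists2 r, r%:R * dyadic k <= dyadic k0 &
    scheme adm cost k t f =
      iter (steps k0 t) (iter (2 ^ (k - k0)) (step adm cost (dyadic k)))
        (iter r (step adm cost (dyadic k)) f).
Proof.
move=> kk t0; have [a1 a2] := steps_itv k t0; have [b1 b2] := steps_itv k0 t0.
have := dyadic_split kk; set m := (2 ^ (k - k0))%N => mE.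
have dk := dyadic_gt0 k; have dk0 := dyadic_gt0 k0.
have le1 : (steps k0 t * m <= steps k t)%N.
  rewrite -ltnS -(ltr_nat R) -(ltr_pM2r dk) natrM -mulrA mE.
  by apply: le_lt_trans b1 _; rewrite -natr1 mulrDl mul1r.
exists (steps k t - steps k0 t * m)%N.
  rewrite natrB // mulrBl natrM -mulrA mE; lra.
rewrite -iterM -iterD mulnC addnC subnK // mulnC //.
Qed.

(** Both schemes are cut into blocks of the same dyadic length, where they can
  be compared; the remainders are short and hence harmless. *)
Theorem scheme_cauchy rho C T e : (forall m, 1 <= rho m) -> 0 <= C -> 0 <= T -> 0 < e ->
  exists k0 B del, [/\ 0 <= B, 0 < del &
  forall adm cost adm' cost', control_problem rho adm cost ->
  control_problem rho adm' cost' ->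
  ham_close B del (ham adm cost) (ham adm' cost') ->
  forall k k' t f, (k0 <= k)%N -> (k0 <= k')%N -> 0 <= t <= T -> BL C f -> forall x,
  `|scheme adm cost k t f x - scheme adm' cost' k' t f x| <= e].
Proof.
move=> rho1 C0 T0 e0; have e30 : 0 < e / 3 by rewrite divr_gt0.
have [h0 [B [del [h00 B0 del0 Hb]]]] := @block_comparison rho C T (e / 3) rho1 C0 T0 e30.
have [s0 s00 Hs] := @time_regular rho C (e / 3) rho1 C0 e30.
have m0 : 0 < Num.min h0 s0 by rewrite lt_min h00.
have [k0 Hk0] := dyadic_small m0.
exists k0, B, del; split=> //.
have half : forall adm cost adm' cost', control_problem rho adm cost ->
  control_problem rho adm' cost' ->
  ham_close B del (ham adm cost) (ham adm' cost') ->
  forall k k' t f, (k0 <= k)%N -> (k0 <= k')%N -> 0 <= t <= T -> BL C f -> forall x,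
  scheme adm cost k t f x - scheme adm' cost' k' t f x <= e.
  move=> adm cost adm' cost' cp cp' HH k k' t f kk kk' /andP[t0 tT] fC x.
  have [r rk ->] := scheme_block adm cost f kk t0.
  have [r' rk' ->] := scheme_block adm' cost' f kk' t0.
  have dk := dyadic_gt0 k; have dk' := dyadic_gt0 k'.
  move: Hk0; rewrite le_min => /andP[kh ks].
  have hJ := convex_operator_step cp (ltW dk).
  have hJ' := convex_operator_step cp' (ltW dk').
  have F1 := Hs _ _ cp _ _ _ (ltW dk) (le_trans rk ks) fC.
  have F2 := Hs _ _ cp' _ _ _ (ltW dk') (le_trans rk' ks) fC.
  set m := (2 ^ (k - k0))%N; set m' := (2 ^ (k' - k0))%N.
  have hP := convex_operator_iter (steps k0 t) (convex_operator_iter m hJ).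
  have hP' := convex_operator_iter (steps k0 t) (convex_operator_iter m' hJ').
  have fb := BL_bounded fC.
  have rb := co_dom (convex_operator_iter r hJ) fb.
  have rb' := co_dom (convex_operator_iter r' hJ') fb.
  have G1 := co_contraction hP rb fb F1 x.
  have G2 := co_contraction hP' rb' fb F2 x.
  have js : (steps k0 t)%:R * dyadic k0 <= T.
    by have [? _] := steps_itv k0 t0; lra.
  have G3 := Hb _ _ _ _ cp cp' HH _ _ m m' _ (steps k0 t) f dk dk' (dyadic_split kk) (dyadic_split kk') kh js fC x.
  move: G1 G2; rewrite !ler_norml => /andP[_ G1] /andP[G2 _].
  lra.
move=> adm cost adm' cost' cp cp' HH k k' t f kk kk' tT fC x.
rewrite ler_norml; apply/andP; split; last exact: half.
have := half _ _ _ _ cp' cp (ham_close_sym HH) k' k t f kk' kk tT fC x; lra.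
Qed.

End Comparison.

(** * Tightness *)

Section Tightness.
Context {R : realType} {d : nat}.
Local Notation X := 'rV[R]_d.
Local Notation M := 'M[R]_d.
Local Notation control := (@control R d).
Implicit Types (f g v : X -> R) (u : control) (adm : set control)
  (cost : control -> R) (rho : R -> R) (q : M * X).

Lemma semiconcave_scale B c f : 0 <= c -> semiconcave B f ->
  semiconcave (c * B) (fun x => c * f x).
Proof.
move=> c0 [f1 f2]; split=> [x y|z w].
  have := ler_wpM2l c0 (f1 x y); lra.
have := ler_wpM2l c0 (f2 z w); lra.
Qed.

(** A parabola, capped so that it stays bounded; for large r its first and
  second differences are small, and upper bounds survive the cap, which is a
  minimum. *)
Definition barrier1 (r s : R) : R := Num.min ((s / r) ^+ 2) 1.
Definition barrier (r : R) (x : X) : R := \sum_i barrier1 r (x ord0 i).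

Lemma barrier1_ge0 r s : 0 <= barrier1 r s.
Proof. by rewrite le_min sqr_ge0 ler01. Qed.

Lemma barrier1_le1 r s : barrier1 r s <= 1.
Proof. by rewrite ge_min lexx orbT. Qed.

Lemma barrier1_le_sqr r s : barrier1 r s <= (s / r) ^+ 2.
Proof. by rewrite ge_min lexx. Qed.

Lemma barrier1_ge1 r s : 0 < r -> r <= `|s| -> 1 <= barrier1 r s.
Proof.
move=> r0 rs; rewrite le_min lexx andbT -real_normK ?num_real // exprn_ege1 //.
by rewrite normrM normfV (gtr0_norm r0) ler_pdivlMr // mul1r.
Qed.

Lemma barrier1_case r s : (1 <= (s / r) ^+ 2 /\ barrier1 r s = 1) \/
  ((s / r) ^+ 2 < 1 /\ barrier1 r s = (s / r) ^+ 2).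
Proof.
rewrite /barrier1; have [h|h] := leP 1 ((s / r) ^+ 2); [left|right]; split => //.
Qed.

Lemma barrier1_add r s t : 1 <= r -> barrier1 r (s + t) <= barrier1 r s + 3 / r * `|t|.
Proof.
move=> r1; have r0 : 0 < r by lra.
have W : 0 <= 3 / r * `|t| by rewrite mulr_ge0 // divr_ge0 // ltW.
have [[_ ->]|[h ->]] := barrier1_case r s.
  by have := barrier1_le1 r (s + t); lra.
have [rt|tr] := leP 1 (`|t| / r).
  have := barrier1_le1 r (s + t); have := sqr_ge0 (s / r).
  have : 3 / r * `|t| = 3 * (`|t| / r) by ring.
  lra.
apply: le_trans (barrier1_le_sqr _ _) _.
have -> : ((s + t) / r) ^+ 2 = (s / r) ^+ 2 + 2 * (s / r) * (t / r) + (t / r) ^+ 2 by ring.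
have a1 : `|s / r| <= 1.
  by rewrite -(@expr_le1 _ 2) // real_normK ?num_real // ltW.
have tE : `|t / r| = `|t| / r by rewrite normrM normfV (gtr0_norm r0).
have H1 : (s / r) * (t / r) <= `|t| / r.
  apply: le_trans (ler_norm _) _; rewrite normrM tE ler_piMl //.
  by rewrite divr_ge0 // ltW.
have H2 : (t / r) ^+ 2 <= `|t| / r.
  by rewrite -real_normK ?num_real // tE expr2 ler_piMl ?divr_ge0 // ltW.
have -> : 3 / r * `|t| = 2 * (`|t| / r) + `|t| / r by ring.
lra.
Qed.

Lemma barrier1_second r s t : 1 <= r ->
  barrier1 r (s + t) + barrier1 r (s - t) <= 2 * barrier1 r s + 3 / r * t ^+ 2.
Proof.
move=> r1; have r0 : 0 < r by lra.
have t2 := sqr_ge0 t.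
have ri1 : r^-1 <= 1 by rewrite invf_le1.
have ri0 : 0 < r^-1 by rewrite invr_gt0.
have [[_ ->]|[h ->]] := barrier1_case r s.
  have := barrier1_le1 r (s + t); have := barrier1_le1 r (s - t).
  have : 0 <= 3 / r * t ^+ 2 by rewrite mulr_ge0 // divr_ge0 // ltW.
  lra.
have := barrier1_le_sqr r (s + t); have := barrier1_le_sqr r (s - t).
have : r^-1 * r^-1 <= 1 * r^-1 by rewrite ler_pM2r.
move: r^-1 ri0 ri1 h => i i0 i1 h ii.
have := ler_wpM2r t2 ii.
have : 0 <= i * t ^+ 2 by rewrite mulr_ge0 // ltW.
lra.
Qed.
Lemma barrier_semiconcave r : 1 <= r -> semiconcave (d%:R * (3 / r)) (barrier r).
Proof.
move=> r1; have r0 : 0 < r by lra.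
have c0 : 0 <= 3 / r by rewrite divr_ge0 // ltW.
split=> [x y|z w].
  rewrite -lerBlDl -sumrB -mulrA; apply: ler_sum_ord => i.
  rewrite mxE; have := barrier1_add (x ord0 i) (y ord0 i) r1.
  by have := ler_wpM2l c0 (mx_entry_le y ord0 i); lra.
rewrite -lerBlDl -big_split /= mulr_sumr -sumrB -mulrA; apply: ler_sum_ord => i.
rewrite !mxE; have := barrier1_second (z ord0 i) (w ord0 i) r1.
have : w ord0 i ^+ 2 <= `|w| ^+ 2.
  by rewrite -real_normK ?num_real // lerXn2r ?nnegrE //; exact: mx_entry_le.
by move=> /(ler_wpM2l c0); lra.
Qed.

Lemma barrier_ge0 r x : 0 <= barrier r x.
Proof. by apply: sumr_ge0 => i _; exact: barrier1_ge0. Qed.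

Lemma barrier_bounded r : bounded (barrier r).
Proof.
exists (d%:R * 1) => x; rewrite ger0_norm ?barrier_ge0 //.
by apply: ler_sum_ord => i; exact: barrier1_le1.
Qed.

Lemma barrier_ge1 r x : 0 < r -> r < `|x| -> 1 <= barrier r x.
Proof.
move=> r0 rx; have [i xi] : exists i, r < `|x ord0 i|.
  apply/not_existsP => H; move: rx; apply/negP; rewrite -leNgt.
  apply: mx_norm_leP; first exact: ltW.
  by move=> k i; rewrite (ord1 k) leNgt; apply/negP => ?; exact: (H i).
rewrite /barrier (bigD1 i) //=.
have := barrier1_ge1 r0 (ltW xi).
have : 0 <= \sum_(j < d | j != i) barrier1 r (x ord0 j).
  by apply: sumr_ge0 => j _; exact: barrier1_ge0.
lra.
Qed.

Lemma barrier_le r R0 x : 1 <= r -> `|x| <= R0 -> barrier r x <= d%:R * (R0 ^+ 2 / r).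
Proof.
move=> r1 xR; have r0 : 0 < r by lra.
apply: ler_sum_ord => i; apply: le_trans (barrier1_le_sqr _ _) _.
have xi : `|x ord0 i| <= R0 by exact: le_trans (mx_entry_le _ _ _) xR.
rewrite exprMn; apply: ler_pM; rewrite ?sqr_ge0 //.
  rewrite -real_normK ?num_real // lerXn2r ?nnegrE //; exact: le_trans xi.
by rewrite expr2 -[leRHS]mul1r ler_pM2r ?invr_gt0 // invf_le1.
Qed.

(** Far away f exceeds g by at most 2 r, which a multiple of the barrier
  covers. Convexity splits g plus this multiple into a part of weight lam,
  which is a large multiple of the barrier, still of small differences if r1
  is large, and a part of weight 1 - lam, which is close to g. *)
Lemma tight_estimate P c lam r r1 f g del : convex_operator bounded P ->
  (forall B k, 0 <= B -> bounded k -> semiconcave B k -> d.+2%:R * B <= 1 ->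
     forall x, P k x <= k x + c) ->
  0 < lam <= 2^-1 -> 0 <= r -> 1 <= r1 -> 0 <= del ->
  d.+2%:R * (2 * r / lam * (d%:R * (3 / r1))) <= 1 ->
  (forall x, `|f x| <= r) -> (forall x, `|g x| <= r) ->
  (forall y, `|y| <= r1 -> `|f y - g y| <= del) ->
  forall x, P f x <= P g x + del + 2 * r * lam + 2 * r * barrier r1 x + lam * c.
Proof.
move=> hP Hb /andP[l0 l1] r0 r11 d0 small fr gr fg x.
have r10 : 0 < r1 by lra.
have l1' : 0 < 1 - lam by lra.
have fb : bounded f by exists r.
have gb : bounded g by exists r.
pose k y := 2 * r / lam * barrier r1 y.
pose g' y := (1 - lam)^-1 * g y + 0 * g y.
have g'b : bounded g' by exact: bounded_lin.
have K0 : 0 <= 2 * r / lam by rewrite divr_ge0 ?mulr_ge0 // ltW.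
have kb : bounded k.
  have := bounded_lin (2 * r / lam) 0 (barrier_bounded r1) (barrier_bounded r1).
  by have -> : (fun y => 2 * r / lam * barrier r1 y + 0 * barrier r1 y) = k
    by apply/funext => y; rewrite mul0r addr0.
(* G is g plus 2 r times the barrier. *)
pose G y := lam * k y + (1 - lam) * g' y.
have Gb : bounded G by exact: bounded_lin.
have GE y : G y = 2 * r * barrier r1 y + g y.
  by rewrite /G /k /g'; field; apply/andP; split; rewrite gt_eqF.
have fG y : f y <= G y + del.
  rewrite GE; have b0 := barrier_ge0 r1 y.
  have [yr|yr] := leP `|y| r1.
    have := fg y yr; rewrite ler_norml => /andP[_].
    have : 0 <= 2 * r * barrier r1 y by rewrite !mulr_ge0.
    lra.
  have b1 := barrier_ge1 r10 yr.
  have : 2 * r <= 2 * r * barrier r1 y by rewrite ler_peMr // mulr_ge0.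
  have := fr y; have := gr y; rewrite !ler_norml => /andP[? ?] /andP[? ?]; lra.
have H1 := co_le_addcst hP fb Gb fG x.
have l01 : 0 <= lam <= 1 by apply/andP; split; lra.
have H2 := co_convex hP kb g'b l01 x.
have kS : semiconcave (2 * r / lam * (d%:R * (3 / r1))) k.
  by apply: semiconcave_scale K0 (barrier_semiconcave r11).
have BS0 : 0 <= 2 * r / lam * (d%:R * (3 / r1)).
  by rewrite mulr_ge0 // mulr_ge0 // divr_ge0 // ltW.
have H3 := ler_wpM2l (ltW l0) (Hb _ _ BS0 kb kS small x).
have kx : lam * k x = 2 * r * barrier r1 x.
  by rewrite /k; field; rewrite gt_eqF.
have g'g y : `|g' y - g y| <= r * lam / (1 - lam).
  have -> : g' y - g y = g y * (lam / (1 - lam)).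
    by rewrite /g'; field; rewrite gt_eqF.
  rewrite normrM [`|lam / _|]ger0_norm; last by rewrite divr_ge0 // ltW.
  by rewrite -mulrA; apply: ler_wpM2r; [rewrite divr_ge0 // ltW|exact: gr].
have H4 := co_contraction hP g'b gb g'g x.
move: H4; rewrite ler_norml => /andP[_ H4].
have H5 := ler_wpM2l (ltW l1') H4.
have H6 : (1 - lam) * (r * lam / (1 - lam)) = r * lam.
  by field; rewrite gt_eqF.
have H7 := co_bound hP gb gr x; rewrite ler_norml in H7; case/andP: H7 => H7 _.
have H8 := ler_wpM2l (ltW l0) H7.
rewrite /G in H1; lra.
Qed.

Lemma iter_step_semiconcave rho adm cost h n B f x : control_problem rho adm cost ->
  0 <= h -> 0 <= B -> bounded f -> semiconcave B f -> d.+2%:R * B <= 1 ->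
  iter n (step adm cost h) f x <= f x + n%:R * h * rho 1.
Proof.
move=> cp h0 B0 fb fB B1; have hJ := convex_operator_step cp h0.
elim: n x => [|n IH] x; first by rewrite !mul0r addr0.
have H1 := co_le_addcst hJ (co_dom (convex_operator_iter n hJ) fb) fb IH x.
have H2 := step_semiconcave cp h0 x B0 fB B1.
have H3 : h * (d.+2%:R * B * rho 1) <= h * rho 1.
  by apply: ler_wpM2l => //; rewrite ler_piMl // (rho_ge0 cp).
rewrite iterS -natr1 !mulrDl mul1r; lra.
Qed.

(** The values on a ball are determined, up to e, by the data on a larger ball
  that depends only on the coercivity; no speed bound exists, but fast
  controls are expensive. *)
Theorem step_tight rho e r T R0 : (forall m, 1 <= rho m) -> 0 < e -> 0 <= r -> 0 <= T -> 0 <= R0 ->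
  exists r1, forall adm cost, control_problem rho adm cost ->
  forall h n f g del, 0 <= h -> n%:R * h <= T -> 0 <= del ->
  (forall x, `|f x| <= r) -> (forall x, `|g x| <= r) ->
  (forall y, `|y| <= r1 -> `|f y - g y| <= del) ->
  forall x, `|x| <= R0 ->
  `|iter n (step adm cost h) f x - iter n (step adm cost h) g x| <= del + e.
Proof.
move=> rho1 e0 r0 T0 R00.
have rh0 : 0 <= rho 1 by apply: le_trans (rho1 1).
pose D := 2 * r + T * rho 1 + e.
have Tr0 : 0 <= T * rho 1 by rewrite mulr_ge0.
have D0 : 0 < D by rewrite /D; lra.
(* lam makes the convexity error at most e / 2, and the radius r1 then makes
  both the growth of the barrier and its value on the ball of radius R0 small. *)
pose lam := (e / 2) / D.
have l0 : 0 < lam by rewrite !divr_gt0.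
have l1 : lam <= 2^-1 by rewrite ler_pdivrMr // mulrC; rewrite /D; lra.
have lD : lam * D = e / 2 by rewrite /lam divfK // gt_eqF.
pose K := d.+2%:R * (2 * r / lam * (d%:R * 3)).
have K0 : 0 <= K by rewrite !mulr_ge0 // invr_ge0 ltW.
pose L := 2 * r * d%:R * R0 ^+ 2.
have L0 : 0 <= L by rewrite !mulr_ge0 // sqr_ge0.
have Le0 : 0 <= 2 * L / e by rewrite divr_ge0 ?mulr_ge0 // ltW.
pose r1 := 1 + K + 2 * L / e.
have r11 : 1 <= r1 by rewrite /r1; lra.
have r10 : 0 < r1 by lra.
exists r1 => adm cost cp h n f g del h0 nT d0 fr gr fg x xR.
have hP := convex_operator_iter n (convex_operator_step cp h0).
have Hb B k : 0 <= B -> bounded k -> semiconcave B k -> d.+2%:R * B <= 1 ->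
     forall x, iter n (step adm cost h) k x <= k x + T * rho 1.
  move=> B0 kb kB kB1 y; apply: le_trans (iter_step_semiconcave n y cp h0 B0 kb kB kB1) _.
  by rewrite lerD2l; apply: ler_wpM2r.
have small : d.+2%:R * (2 * r / lam * (d%:R * (3 / r1))) <= 1.
  have -> : d.+2%:R * (2 * r / lam * (d%:R * (3 / r1))) = K / r1 by rewrite /K; ring.
  by rewrite ler_pdivrMr // mul1r /r1; lra.
have l01 : 0 < lam <= 2^-1 by rewrite l0.
have bar : 2 * r * barrier r1 x <= e / 2.
  have r20 : 0 <= 2 * r by rewrite mulr_ge0.
  have := ler_wpM2l r20 (barrier_le r11 xR).
  have -> : 2 * r * (d%:R * (R0 ^+ 2 / r1)) = L / r1 by rewrite /L; ring.
  move=> /le_trans; apply; rewrite ler_pdivrMr //.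
  have : e * (2 * L / e) = 2 * L by field; rewrite gt_eqF.
  have : 0 <= e * K by rewrite mulr_ge0 // ltW.
  rewrite /r1; lra.
have lE : lam * D = 2 * r * lam + lam * (T * rho 1) + lam * e by rewrite /D; ring.
have le0 : 0 <= lam * e by rewrite mulr_ge0 // ltW.
have gf y : `|y| <= r1 -> `|g y - f y| <= del by move=> /fg; rewrite distrC.
have H1 := tight_estimate hP Hb l01 r0 r11 d0 small fr gr fg x.
have H2 := tight_estimate hP Hb l01 r0 r11 d0 small gr fr gf x.
rewrite ler_norml; apply/andP; split; lra.
Qed.

End Tightness.

(** * Limits, continuity and compactness *)

Section Limits.
Context {R : realType}.
Implicit Types (a b : nat -> R) (l m e : R).

Definition limit a l : Prop :=
  forall e, 0 < e -> exists N, forall k, (N <= k)%N -> `|a k - l| <= e.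

Lemma limit_cvg a l : limit a l <-> a @ \oo --> l.
Proof.
split=> [H|H].
  apply/cvgrPdist_le => e e0; have [N HN] := H e e0.
  by exists N => // k /= Nk; rewrite distrC; exact: HN.
move=> e e0; have /cvgrPdist_le /(_ e e0) [N _ HN] := H.
by exists N => k Nk; rewrite distrC; exact: HN.
Qed.

Lemma cauchy_limit a :
  (forall e, 0 < e -> exists N, forall k k', (N <= k)%N -> (N <= k')%N -> `|a k - a k'| <= e) ->
  exists l, limit a l.
Proof.
move=> H; have : cvgn a.
  apply/cauchy_cvgP/cauchy_ballP => e e0.
  have e20 : 0 < e / 2 by rewrite divr_gt0.
  have [N HN] := H _ e20.
  exists ([set x | exists2 k, (N <= k)%N & x = a k], [set x | exists2 k, (N <= k)%N & x = a k]).
    by split; exists N => // k /= Nk; exists k.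
  move=> [x y] /= [[k Nk ->] [k' Nk' ->]]; rewrite -ball_normE /ball_ /=.
  by apply: le_lt_trans (HN _ _ Nk Nk') _; lra.
by move=> /cvg_ex[l /limit_cvg al]; exists l.
Qed.

Lemma limit_cst l : limit (fun=> l) l.
Proof. by move=> e e0; exists 0%N => k _; rewrite subrr normr0 ltW. Qed.

Lemma limit_lin x y a b l m : limit a l -> limit b m ->
  limit (fun k => x * a k + y * b k) (x * l + y * m).
Proof.
move=> al bm e e0.
have D0 : 0 < `|x| + `|y| + 1 by rewrite ltr_wpDl // addr_ge0.
have d0 : 0 < e / (`|x| + `|y| + 1) by exact: divr_gt0.
have [N1 H1] := al _ d0; have [N2 H2] := bm _ d0.
exists (maxn N1 N2) => k; rewrite geq_max => /andP[k1 k2].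
have -> : x * a k + y * b k - (x * l + y * m) = x * (a k - l) + y * (b k - m) by ring.
rewrite (le_trans (ler_normD _ _)) // !normrM.
have := ler_wpM2l (normr_ge0 x) (H1 k k1); have := ler_wpM2l (normr_ge0 y) (H2 k k2).
have : e / (`|x| + `|y| + 1) * (`|x| + `|y| + 1) = e by rewrite divfK // gt_eqF.
move: d0; move: (e / _) => t t0; lra.
Qed.

Lemma limit_le a b l m : limit a l -> limit b m ->
  (exists N, forall k, (N <= k)%N -> a k <= b k) -> l <= m.
Proof.
move=> al bm [N ab]; apply/ler_addgt0Pr => e e0.
have e20 : 0 < e / 2 by rewrite divr_gt0.
have [N1 H1] := al _ e20; have [N2 H2] := bm _ e20.
pose k := (N + N1 + N2)%N.
have k0 : (N <= k)%N by rewrite /k -addnA leq_addr.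
have k1 : (N1 <= k)%N by rewrite /k addnAC leq_addl.
have k2 : (N2 <= k)%N by rewrite /k leq_addl.
have := ab k k0; have := H1 k k1; have := H2 k k2.
by rewrite !ler_norml => /andP[? ?] /andP[? ?]; lra.
Qed.

Lemma limit_unique a l m : limit a l -> limit a m -> l = m.
Proof.
move=> al am; apply/eqP; rewrite eq_le; apply/andP; split;
  apply: limit_le; [exact: al|exact: am| |exact: am|exact: al|]; by exists 0%N.
Qed.

Lemma limit_dist_le a b l m c : limit a l -> limit b m ->
  (exists N, forall k, (N <= k)%N -> `|a k - b k| <= c) -> `|l - m| <= c.
Proof.
move=> al bm [N ab].
have L1 := limit_lin 1 (-1) al bm.
rewrite ler_norml; apply/andP; split.
  have -> : l - m = 1 * l + -1 * m by ring.
  apply: limit_le (limit_cst _) L1 _; exists N => k Nk.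
  by have := ab k Nk; rewrite ler_norml => /andP[]; lra.
have -> : l - m = 1 * l + -1 * m by ring.
apply: limit_le L1 (limit_cst _) _; exists N => k Nk.
by have := ab k Nk; rewrite ler_norml => /andP[]; lra.
Qed.

Lemma eq_of_le_eps (x y : R) : (forall e, 0 < e -> `|x - y| <= e) -> x = y.
Proof.
move=> H; apply/eqP; rewrite -subr_eq0 -normr_le0.
by apply/ler_addgt0Pr => e e0; rewrite add0r; exact: H.
Qed.

End Limits.

Section Continuity.
Context {R : realType} {V : normedModType R}.

Lemma continuousP_eps (f : V -> R) : continuous f <->
  forall x (e : R), 0 < e -> exists2 del : R, 0 < del &
    forall y, `|y - x| < del -> `|f y - f x| <= e.
Proof.
split=> H.
  move=> x e e0; have /cvgrPdist_le /(_ e e0) := H x.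
  move=> /nbhs_ballP[del del0 Hd]; exists del => // y yx.
  rewrite distrC; apply: Hd; rewrite -ball_normE /ball_ /= distrC.
  exact: yx.
move=> x; apply/cvgrPdist_le => e e0; have [del del0 Hd] := H x e e0.
apply/nbhs_ballP; exists del => // y; rewrite -ball_normE /ball_ /= distrC => yx.
by rewrite distrC; exact: Hd.
Qed.

Lemma continuous_lin (a b : R) (f g : V -> R) : continuous f -> continuous g ->
  continuous (fun x => a * f x + b * g x).
Proof.
by move=> cf cg x; apply: cvgD; apply: cvgM; (try exact: cvg_cst); [exact: cf|exact: cg].
Qed.

Lemma continuous_shift (f : V -> R) z : continuous f -> continuous (fun x => f (x + z)).
Proof.
move=> cf x; apply: continuous_comp; last exact: cf.
by apply: cvgD; [exact: cvg_id|exact: cvg_cst].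
Qed.

End Continuity.

Section Compactness.
Context {R : realType} {d : nat}.
Local Notation X := 'rV[R]_d.
Implicit Types (f g : X -> R).

Lemma compact_uniform (K : set X) (P : nat -> X -> Prop) : compact K ->
  (forall x, K x -> exists N (del : R), 0 < del /\
     forall k y, (N <= k)%N -> `|y - x| < del -> P k y) ->
  exists N, forall k x, (N <= k)%N -> K x -> P k x.
Proof.
move=> /compact_near_coveringP cK H.
have [|N _ HN] := cK nat \oo%classic P _; last by exists N => k x Nk; exact: HN.
move=> x Kx; have [N [del [del0 HP]]] := H x Kx.
exists (ball x del, [set k | (N <= k)%N]).
  by split; [exact: nbhsx_ballx|exact: nbhs_infty_ge].
move=> [y k] /= [xy Nk]; apply: HP => //.
by move: xy; rewrite -ball_normE /ball_ /= distrC.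
Qed.

Definition cball (r : R) : set X := [set x | `|x| <= r].

Lemma compact_cball r : 0 <= r -> compact (cball r).
Proof.
move=> r0.
have -> : cball r = [set v : X | forall i, `[- r, r]%classic (v ord0 i)].
  apply/seteqP; split=> x /= H.
    by move=> i; rewrite in_itv /= -ler_norml; exact: le_trans (mx_entry_le _ _ _) H.
  apply: mx_norm_leP => // k i; rewrite (ord1 k) ler_norml.
  by have := H i; rewrite in_itv.
by apply: (@rV_compact R d (fun=> `[- r, r]%classic)) => i; exact: segment_compact.
Qed.

Lemma compact_sub_cball (K : set X) : compact K -> exists2 r, 0 <= r & K `<=` cball r.
Proof.
move=> /compact_bounded[M [_ HM]]; exists (`|M| + 1); first by rewrite addr_ge0.
move=> x Kx; apply: HM => //.
by rewrite (le_lt_trans (ler_norm M)) // ltrDl.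
Qed.

Lemma continuous_cball_uniform f r e : continuous f -> 0 <= r -> 0 < e ->
  exists2 del : R, 0 < del &
    forall x y, `|x| <= r -> `|y - x| < del -> `|f y - f x| <= e.
Proof.
move=> /continuousP_eps cf r0 e0.
have e20 : 0 < e / 2 by rewrite divr_gt0.
have [N HN] : exists N, forall k x, (N <= k)%N -> cball r x ->
    forall y, `|y - x| < @dyadic R k -> `|f y - f x| <= e.
  apply: compact_uniform; first exact: compact_cball.
  move=> x _; have [del del0 Hd] := cf x _ e20.
  have del20 : 0 < del / 2 by rewrite divr_gt0.
  have [N Ndel] := @dyadic_small R _ del20.
  exists N, (del / 2); split=> // k y Nk yx z zy.
  have zx : `|z - x| < del.
    have := ler_distD y z x; have := @le_dyadic R _ _ Nk; lra.
  have yx' : `|y - x| < del by lra.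
  have := Hd _ zx; have := Hd _ yx'; rewrite (distrC (f y)).
  have := ler_distD (f x) (f z) (f y); lra.
exists (@dyadic R N); first exact: dyadic_gt0.
by move=> x y xr; exact: (HN N x (leqnn N) xr).
Qed.

(** Lipschitz regularization by sup-convolution. *)
Lemma lipschitz_approx f m r e : continuous f -> (forall x, `|f x| <= m) ->
  0 <= r -> 0 < e ->
  exists C g, [/\ BL C g, forall x, `|g x| <= m &
    forall x, `|x| <= r -> `|f x - g x| <= e].
Proof.
move=> cf fm r0 e0; have m0 : 0 <= m by exact: le_trans (fm 0).
have [del del0 Hd] := continuous_cball_uniform cf r0 e0.
(* With this slope only points closer than del to x compete in the supremum. *)
pose L := 2 * m / del.
have L0 : 0 <= L by rewrite divr_ge0 ?mulr_ge0 // ltW.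
pose A x := [set f z - L * `|x - z| | z in [set: X]].
pose g x := sup (A x).
have fle z x : f z - L * `|x - z| <= m.
  have := fm z; rewrite ler_norml => /andP[_].
  have : 0 <= L * `|x - z| by rewrite mulr_ge0.
  lra.
have Aub x : has_ubound (A x) by exists m => _ [z _ <-].
have gge z x : f z - L * `|x - z| <= g x by apply: ub_le_sup => //; exists z.
have gle x c : (forall z, f z - L * `|x - z| <= c) -> g x <= c.
  move=> H; apply: ge_sup; last by move=> _ [z _ <-]; exact: H.
  by exists (f x - L * `|x - x|); exists x.
have gf x : f x <= g x by have := gge x x; rewrite subrr normr0 mulr0 subr0.
have gm x : `|g x| <= m.
  rewrite ler_norml; apply/andP; split; last exact: gle.
  by have := gf x; have := fm x; rewrite ler_norml => /andP[]; lra.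
have glip x y : g x <= g y + L * `|x - y|.
  apply: gle => z; have := gge z y.
  have := ler_wpM2l L0 (ler_distD x y z); rewrite (distrC y x); lra.
exists (m + L), g; split=> //.
  split=> [x|x y]; first by apply: le_trans (gm x) _; rewrite lerDl.
  apply: (@le_trans _ _ (L * `|x - y|)); last by apply: ler_wpM2r => //; rewrite lerDr.
  rewrite ler_norml; have := glip x y; have := glip y x; rewrite (distrC y x).
  by move=> ? ?; apply/andP; split; lra.
move=> x xr; rewrite distrC ger0_norm ?subr_ge0 // lerBlDr addrC; apply: gle => z.
have [zx|zx] := ltP `|z - x| del.
  have := Hd x z xr zx; rewrite ler_norml => /andP[_].
  have : 0 <= L * `|x - z| by rewrite mulr_ge0.
  lra.
have : 2 * m <= L * `|x - z|.
  rewrite distrC -[leLHS](@divfK _ del) ?gt_eqF // -/L; exact: ler_wpM2l.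
have := fm x; have := fm z; rewrite !ler_norml => /andP[? ?] /andP[? ?]; lra.
Qed.

Lemma BL_continuous C f : BL C f -> continuous f.
Proof. by move=> [_ fC]; exact: (@lipschitz_continuous R X R^o f C fC). Qed.

Lemma BL_Cb C f : BL C f -> Cb f.
Proof. by move=> fC; split; [exact: BL_continuous fC|exists C; exact: (proj1 fC)]. Qed.

Lemma domain_Cb : domain (@Cb R d).
Proof.
split.
- move=> a b f g [cf fb] [cg gb]; split; last exact: bounded_lin.
  exact: (@continuous_lin R X).
- move=> f z [cf fb]; split; last exact: bounded_shift.
  exact: (@continuous_shift R X).
- exact: BL_Cb.
- by move=> f [_ fb].
Qed.

Lemma Cb_local_limit f : bounded f ->
  (forall r e, 0 <= r -> 0 < e -> exists2 g, continuous g &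
     forall x, `|x| <= r -> `|f x - g x| <= e) -> Cb f.
Proof.
move=> fb H; split=> //; apply/continuousP_eps => x e e0.
have e30 : 0 < e / 3 by rewrite divr_gt0.
have r0 : 0 <= `|x| + 1 by rewrite addr_ge0.
have [g /continuousP_eps cg fg] := H _ _ r0 e30.
have [del del0 Hd] := cg x _ e30.
exists (Num.min del 1); first by rewrite lt_min del0 ltr01.
move=> y; rewrite lt_min => /andP[yx y1].
have xr : `|x| <= `|x| + 1 by rewrite lerDl.
have yr : `|y| <= `|x| + 1.
  have := ler_normD (y - x) x; rewrite subrK; lra.
have := fg _ xr; have := fg _ yr; have := Hd _ yx.
have := ler_distD (g y) (f y) (f x); have := ler_distD (g x) (g y) (f x).
rewrite (distrC (g x) (f x)); lra.
Qed.

(** Dini's theorem on balls. *)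
Lemma dini (u : nat -> X -> R) r e : (forall n, continuous (u n)) ->
  decreases_to0 u -> 0 <= r -> 0 < e ->
  exists N, forall k x, (N <= k)%N -> `|x| <= r -> `|u k x| <= e.
Proof.
move=> cu du r0 e0.
have e20 : 0 < e / 2 by rewrite divr_gt0.
have upos k x : 0 <= u k x.
  have [mono lim0] := du x.
  apply: limit_le (limit_cst 0) (limit_cst (u k x)) _ => //.
  exists 0%N => _ _; apply: (limit_le (proj2 (limit_cvg _ _) lim0) (limit_cst (u k x))).
  by exists k => n kn; exact: mono.
apply: (@compact_uniform (cball r) (fun k x => `|u k x| <= e)); first exact: compact_cball.
move=> x _; have [mono lim0] := du x.
have [N HN] := proj2 (limit_cvg _ _) lim0 _ e20.
have /continuousP_eps cN := cu N.
have [del del0 Hd] := cN x _ e20.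
exists N, del; split=> // k y Nk yx.
rewrite ger0_norm //.
have := (du y).1 _ _ Nk; have := Hd _ yx; have := HN N (leqnn N); rewrite subr0.
by rewrite !ler_norml => /andP[? ?] /andP[? ?]; lra.
Qed.

End Compactness.

(** * Convergence in the space of bounded continuous functions *)

Section SupremumNorms.
Context {R : realType} {d : nat}.
Local Notation X := 'rV[R]_d.
Implicit Types (f g l : X -> R) (u : nat -> X -> R).

Lemma esup_absP (T : Type) (K : set T) (F : T -> \bar R) (c : R) : 0 <= c ->
  ((esup_abs K F <= c%:E)%E <-> forall x, K x -> (`|F x| <= c%:E)%E).
Proof.
move=> c0; split=> [H x Kx|H].
  by apply: le_trans H; apply: ereal_sup_ubound; right; exists x.
by apply: ge_ereal_sup => _ [->|[x Kx <-]]; [rewrite lee_fin|exact: H].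
Qed.

Lemma esup_abs_ge0 (T : Type) (K : set T) (F : T -> \bar R) : (0 <= esup_abs K F)%E.
Proof. by apply: ereal_sup_ubound; left. Qed.

Lemma norm_onP (T : Type) (K : set T) (f : T -> R) (c : R) : 0 <= c ->
  ((norm_on K f <= c%:E)%E <-> forall x, K x -> `|f x| <= c).
Proof.
by move=> c0; rewrite /norm_on esup_absP.
Qed.

Lemma supnormP (T : Type) (f : T -> R) (c : R) : 0 <= c ->
  ((supnorm f <= c%:E)%E <-> forall x, `|f x| <= c).
Proof. by move=> c0; rewrite /supnorm norm_onP //; split=> H x; [|move=> _]; exact: H. Qed.

Lemma ecvg0P (v : nat -> \bar R) : (forall n, (0 <= v n)%E) ->
  (v @ \oo --> 0%E <->
   forall e : R, 0 < e -> exists N, forall k, (N <= k)%N -> (v k <= e%:E)%E).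
Proof.
move=> v0; split.
  move=> /fine_cvgP[[N1 _ HN1] /limit_cvg H] e e0; have [N2 HN2] := H e e0.
  exists (maxn N1 N2) => k; rewrite geq_max => /andP[k1 k2].
  have fk := HN1 k k1; have := HN2 k k2; rewrite /= subr0.
  by rewrite -(fineK fk) lee_fin => /(le_trans (ler_norm _)).
move=> H; apply/fine_cvgP; split.
  have [N HN] := H 1 ltr01; exists N => // k /= Nk.
  by rewrite ge0_fin_numE //; apply: le_lt_trans (HN k Nk) _; rewrite ltry.
apply/limit_cvg => e e0; have [N HN] := H e e0; exists N => k Nk; rewrite /= subr0.
have vk := HN k Nk.
have fk : v k \is a fin_num by rewrite ge0_fin_numE //; apply: le_lt_trans vk _; rewrite ltry.
rewrite ger0_norm ?fine_ge0 //.
by rewrite -lee_fin fineK.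
Qed.

Definition loc_cvg u l : Prop := forall r e, 0 <= r -> 0 < e ->
  exists N, forall k x, (N <= k)%N -> `|x| <= r -> `|u k x - l x| <= e.

Lemma cvgCbP u l : cvgCb u l <->
  [/\ forall n, Cb (u n), Cb l, exists M, forall n x, `|u n x| <= M & loc_cvg u l].
Proof.
have lu0 K n : (0 <= norm_on K (l \- u n)%R)%E by exact: esup_abs_ge0.
split=> -[H1 H2 [M HM] H4]; split => //.
- exists `|M| => n x; apply: (proj1 (supnormP (u n) (normr_ge0 M))).
  by apply: le_trans (HM n) _; rewrite lee_fin ler_norm.
- move=> r e r0 e0.
  have [N HN] := (ecvg0P (lu0 (cball r))).1 (H4 _ (compact_cball r0)) e e0.
  exists N => k x Nk xr; have := HN k Nk; rewrite norm_onP ?(ltW e0) //.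
  by move=> /(_ x xr) /=; rewrite distrC.
- exists `|M| => n; apply/supnormP => // x; apply: le_trans (HM n x) _; exact: ler_norm.
- move=> K cK; apply/(ecvg0P (lu0 K)) => e e0.
  have [r r0 Kr] := compact_sub_cball cK.
  have [N HN] := H4 r e r0 e0; exists N => k Nk; apply/norm_onP; first exact: ltW.
  by move=> x /Kr xr /=; rewrite distrC; exact: HN.
Qed.

Lemma uniform_loc_cvg u l : (forall e, 0 < e -> exists N, forall k x, (N <= k)%N -> `|u k x - l x| <= e) ->
  loc_cvg u l.
Proof. by move=> H r e r0 e0; have [N HN] := H e e0; exists N => k x Nk _; exact: HN. Qed.

Lemma cvgCb_cst f : Cb f -> cvgCb (fun=> f) f.
Proof.
move=> fC; apply/cvgCbP; split=> //; first by have [_ [M HM]] := fC; exists M.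
by move=> r e r0 e0; exists 0%N => k x _ _; rewrite subrr normr0 ltW.
Qed.

End SupremumNorms.

(** * Regular families of operators and their limits *)

Section RegularFamilies.
Context {R : realType} {d : nat}.
Local Notation X := 'rV[R]_d.
Implicit Types (f g v : X -> R) (V S : R -> (X -> R) -> X -> R)
  (tau : R -> R -> R -> R -> R) (kap : R -> R -> R).

(** Families of operators with prescribed moduli of tightness and of continuity
  in time; the moduli make the class stable under limits. *)
Record regular_family tau kap V : Prop := {
  rf_op : forall t, 0 <= t -> convex_operator (@Cb R d) (V t);
  rf_tight : forall e r T R0 t f g del, 0 < e -> 0 <= r -> 0 <= R0 ->
    0 <= t <= T -> 0 <= del -> Cb f -> Cb g ->
    (forall x, `|f x| <= r) -> (forall x, `|g x| <= r) ->
    (forall y, `|y| <= tau e r T R0 -> `|f y - g y| <= del) ->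
    forall x, `|x| <= R0 -> `|V t f x - V t g x| <= del + e;
  rf_kap : forall C e, 0 <= C -> 0 < e -> 0 < kap C e;
  rf_time : forall C e t f, 0 <= C -> 0 < e -> 0 <= t <= kap C e -> BL C f ->
    forall x, `|V t f x - f x| <= e
}.

Section Limit.
Variables (tau : R -> R -> R -> R -> R) (kap : R -> R -> R).
Variable V : nat -> R -> (X -> R) -> X -> R.
Hypothesis hV : forall k, regular_family tau kap (V k).
Hypothesis V_cauchy : forall C T e, 0 <= C -> 0 <= T -> 0 < e -> exists N,
  forall k k' t f, (N <= k)%N -> (N <= k')%N -> 0 <= t <= T -> BL C f ->
  forall x, `|V k t f x - V k' t f x| <= e.

Definition limit_family (t : R) f (x : X) : R :=
  xget 0 [set l | limit (fun k => V k t f x) l].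
Local Notation S := limit_family.

(** On a ball a continuous f may be replaced by a Lipschitz function, by
  tightness. *)
Lemma Cb_cauchy f T R0 e : Cb f -> 0 <= T -> 0 <= R0 -> 0 < e -> exists N,
  forall k k' t x, (N <= k)%N -> (N <= k')%N -> 0 <= t <= T -> `|x| <= R0 ->
  `|V k t f x - V k' t f x| <= e.
Proof.
move=> fC T0 R00 e0; have [cf [m fm]] := fC.
have m0 : 0 <= m by exact: le_trans (fm 0).
have e50 : 0 < e / 5 by rewrite divr_gt0.
have r0 : 0 <= `|tau (e / 5) m T R0| := normr_ge0 _.
have [C [g [gC gm fg]]] := lipschitz_approx cf fm r0 e50.
have [N HN] := V_cauchy (BL_ge0 gC) T0 e50.
exists N => k k' t x Nk Nk' tT xR.
have fg' y : `|y| <= tau (e / 5) m T R0 -> `|f y - g y| <= e / 5.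
  by move=> yr; apply: fg; apply: le_trans yr (ler_norm _).
have D k0 := rf_tight (hV k0) e50 m0 R00 tT (ltW e50) fC (BL_Cb gC) fm gm fg' xR.
have H1 := D k; have H2 := D k'; have H3 := HN k k' t g Nk Nk' tT gC x.
move: H1 H2 H3; rewrite !ler_norml => /andP[? ?] /andP[? ?] /andP[? ?].
by apply/andP; split; lra.
Qed.

Lemma limit_familyP f t x : Cb f -> 0 <= t -> limit (fun k => V k t f x) (S t f x).
Proof.
move=> fC t0; have : exists l, limit (fun k => V k t f x) l.
  apply: cauchy_limit => e e0.
  have [N HN] := Cb_cauchy fC t0 (normr_ge0 x) e0.
  by exists N => k k' Nk Nk'; apply: HN => //; rewrite t0 lexx.
by move=> [l Hl]; exact: (xgetPex 0 (ex_intro _ l Hl)).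
Qed.

Lemma limit_family_uniform C T e : 0 <= C -> 0 <= T -> 0 < e -> exists N,
  forall k t f, (N <= k)%N -> 0 <= t <= T -> BL C f ->
  forall x, `|V k t f x - S t f x| <= e.
Proof.
move=> C0 T0 e0; have [N HN] := V_cauchy C0 T0 e0; exists N => k t f Nk tT fC x.
have t0 : 0 <= t by case/andP: tT.
apply: limit_dist_le (limit_cst _) (limit_familyP x (BL_Cb fC) t0) _.
by exists N => k' Nk'; exact: HN.
Qed.

Lemma limit_family_loc f T R0 e : Cb f -> 0 <= T -> 0 <= R0 -> 0 < e -> exists N,
  forall k t x, (N <= k)%N -> 0 <= t <= T -> `|x| <= R0 -> `|V k t f x - S t f x| <= e.
Proof.
move=> fC T0 R00 e0; have [N HN] := Cb_cauchy fC T0 R00 e0; exists N => k t x Nk tT xR.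
have t0 : 0 <= t by case/andP: tT.
apply: limit_dist_le (limit_cst _) (limit_familyP x fC t0) _.
by exists N => k' Nk'; exact: HN.
Qed.

Lemma limit_family_bound f m t x : Cb f -> 0 <= t -> (forall x, `|f x| <= m) -> `|S t f x| <= m.
Proof.
move=> fC t0 fm; rewrite -[S t f x]subr0.
apply: limit_dist_le (limit_familyP x fC t0) (limit_cst 0) _.
by exists 0%N => k _; rewrite subr0; exact: (co_bound (rf_op (hV k) t0)).
Qed.

Lemma limit_family_Cb f t : Cb f -> 0 <= t -> Cb (S t f).
Proof.
move=> fC t0; have [_ [m fm]] := fC; apply: Cb_local_limit.
  by exists m => x; exact: limit_family_bound.
move=> r e r0 e0; have [N HN] := limit_family_loc fC t0 r0 e0.
exists (V N t f); first by case: (co_dom (rf_op (hV N) t0) fC).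
by move=> x xr; rewrite distrC; apply: HN => //; rewrite t0 lexx.
Qed.

Lemma regular_limit_family : regular_family tau kap S.
Proof.
split.
- move=> t t0; have Lim f x (fC : Cb f) := limit_familyP x fC t0.
  have hD := @domain_Cb R d.
  have op k := rf_op (hV k) t0.
  split => //.
  + by move=> f fC; exact: limit_family_Cb.
  + move=> f g fC gC fg x; apply: limit_le (Lim f x fC) (Lim g x gC) _.
    by exists 0%N => k _; exact: (co_le (op k)).
  + move=> f c fC x; have fcC := dom_addcst (op 0%N) c fC.
    apply: limit_unique (Lim _ x fcC) _.
    have -> : (fun k => V k t (fun y => f y + c) x) = (fun k => 1 * V k t f x + 1 * c).
      by apply/funext => k; rewrite (co_addcst (op k)) // !mul1r.
    have -> : S t f x + c = 1 * S t f x + 1 * c by rewrite !mul1r.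
    exact: limit_lin (Lim f x fC) (limit_cst c).
  + move=> x; have C0 := dom_cst (op 0%N) 0.
    apply: limit_unique (Lim _ x C0) _.
    by under eq_fun do rewrite (co_zero (op _)); exact: limit_cst.
  + move=> f z fC x; have fzC := dom_shift hD z fC.
    apply: limit_unique (Lim _ x fzC) _.
    by under eq_fun do rewrite (co_shift (op _)) //; exact: Lim.
  + move=> f g lam fC gC l01 x.
    apply: limit_le (Lim _ x (dom_lin hD lam (1 - lam) fC gC))
      (limit_lin lam (1 - lam) (Lim f x fC) (Lim g x gC)) _.
    by exists 0%N => k _; exact: (co_convex (op k)).
- move=> e r T R0 t f g del e0 r0 R00 /[dup] tT /andP[t0 _] d0 fC gC fr gr fg x xR.
  apply: limit_dist_le (limit_familyP x fC t0) (limit_familyP x gC t0) _.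
  by exists 0%N => k _; exact: (rf_tight (hV k) e0 r0 R00 tT).
- exact: (rf_kap (hV 0%N)).
- move=> C e t f C0 e0 /[dup] tk /andP[t0 _] fC x.
  apply: limit_dist_le (limit_familyP x (BL_Cb fC) t0) (limit_cst _) _.
  by exists 0%N => k _; exact: (rf_time (hV k) C0 e0 tk fC).
Qed.

Hypothesis V_add : forall C e s t, 0 <= C -> 0 < e -> 0 <= s -> 0 <= t -> exists N,
  forall k f, (N <= k)%N -> BL C f -> forall x,
  `|V k (s + t) f x - V k s (V k t f) x| <= e.

(** For Lipschitz functions the convergence is uniform in space, so that the
  limits can be composed; tightness extends the identity to continuous
  functions. *)
Lemma limit_family_add f s t : Cb f -> 0 <= s -> 0 <= t -> S (s + t) f = S s (S t f).
Proof.
move=> fC s0 t0; have st0 : 0 <= s + t by exact: addr_ge0.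
have hS := regular_limit_family.
have lipcase C g : BL C g -> forall x, S (s + t) g x = S s (S t g) x.
  move=> gC x; have C0 := BL_ge0 gC.
  have SgC : BL C (S t g) := co_BL (rf_op hS t0) gC.
  apply: limit_unique (limit_familyP x (BL_Cb gC) st0) _ => e e0.
  have e30 : 0 < e / 3 by rewrite divr_gt0.
  have [N1 H1] := V_add C0 e30 s0 t0.
  have [N2 H2] := limit_family_uniform C0 t0 e30.
  have [N3 H3] := limit_family_uniform C0 s0 e30.
  exists (N1 + N2 + N3)%N => k Nk.
  have k1 : (N1 <= k)%N by apply: leq_trans Nk; rewrite -addnA leq_addr.
  have k2 : (N2 <= k)%N by apply: leq_trans Nk; rewrite addnAC leq_addl.
  have k3 : (N3 <= k)%N by apply: leq_trans Nk; rewrite leq_addl.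
  have tt : 0 <= t <= t by rewrite t0 lexx.
  have ss : 0 <= s <= s by rewrite s0 lexx.
  have G1 := H1 k g k1 gC x.
  have VgC : BL C (V k t g) := co_BL (rf_op (hV k) t0) gC.
  have G2 := co_contraction (rf_op (hV k) s0) (BL_Cb VgC) (BL_Cb SgC) (H2 k t g k2 tt gC) x.
  have G3 := H3 k s _ k3 ss SgC x.
  move: G1 G2 G3; rewrite !ler_norml => /andP[? ?] /andP[? ?] /andP[? ?].
  by apply/andP; split; lra.
apply/funext => x; apply: eq_of_le_eps => e e0.
have [cf [m fm]] := fC; have m0 : 0 <= m by exact: le_trans (fm 0).
have e60 : 0 < e / 6 by rewrite divr_gt0.
have x0 := normr_ge0 x.
pose R1 := `|tau (e / 6) m s `|x| |.
pose R2 := `|tau (e / 6) m t R1| + `|tau (e / 6) m (s + t) `|x| |.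
have R10 : 0 <= R1 := normr_ge0 _.
have R20 : 0 <= R2 by rewrite addr_ge0.
have [C [g [gC gm fg]]] := lipschitz_approx cf fm R20 e60.
have gCb := BL_Cb gC.
have stst : 0 <= s + t <= s + t by rewrite st0 lexx.
have tt : 0 <= t <= t by rewrite t0 lexx.
have ss : 0 <= s <= s by rewrite s0 lexx.
have G1 : `|S (s + t) f x - S (s + t) g x| <= e / 6 + e / 6.
  apply: (rf_tight hS e60 m0 x0 stst (ltW e60) fC gCb fm gm) => // y yr.
  apply: fg; apply: le_trans yr (le_trans (ler_norm _) _); by rewrite lerDr.
have G2 y : `|y| <= R1 -> `|S t f y - S t g y| <= e / 6 + e / 6.
  apply: (rf_tight hS e60 m0 R10 tt (ltW e60) fC gCb fm gm) => z zr.
  apply: fg; apply: le_trans zr (le_trans (ler_norm _) _); by rewrite lerDl.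
have G3 : `|S s (S t f) x - S s (S t g) x| <= (e / 6 + e / 6) + e / 6.
  have e330 : 0 <= e / 6 + e / 6 by rewrite addr_ge0 // ltW.
  apply: (rf_tight hS e60 m0 x0 ss e330 (limit_family_Cb fC t0) (limit_family_Cb gCb t0)) => //.
  - by move=> y; exact: limit_family_bound.
  - by move=> y; exact: limit_family_bound.
  - by move=> y yr; apply: G2; apply: le_trans yr (ler_norm _).
have G4 := lipcase C g gC x.
move: G1 G3; rewrite G4 !ler_norml => /andP[? ?] /andP[? ?].
by apply/andP; split; lra.
Qed.

End Limit.

Section Semigroups.
Variables (tau : R -> R -> R -> R -> R) (kap : R -> R -> R).
Variable S : R -> (X -> R) -> X -> R.
Hypothesis hS : regular_family tau kap S.

Lemma regular_time_loc f R0 e : Cb f -> 0 <= R0 -> 0 < e -> exists2 t0, 0 < t0 &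
  forall t x, 0 <= t <= t0 -> `|x| <= R0 -> `|S t f x - f x| <= e.
Proof.
move=> fC R00 e0; have [cf [m fm]] := fC; have m0 : 0 <= m by exact: le_trans (fm 0).
have e50 : 0 < e / 5 by rewrite divr_gt0.
pose r := `|tau (e / 5) m 1 R0| + R0.
have r0 : 0 <= r by rewrite addr_ge0.
have [C [g [gC gm fg]]] := lipschitz_approx cf fm r0 e50.
have C0 := BL_ge0 gC; have k0 := rf_kap hS C0 e50.
exists (Num.min (kap C (e / 5)) 1); first by rewrite lt_min k0 ltr01.
move=> t x /andP[t0]; rewrite le_min => /andP[tk t1] xR.
have t01 : 0 <= t <= 1 by rewrite t0.
have tk' : 0 <= t <= kap C (e / 5) by rewrite t0.
have fg' y : `|y| <= tau (e / 5) m 1 R0 -> `|f y - g y| <= e / 5.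
  by move=> yr; apply: fg; apply: le_trans yr (le_trans (ler_norm _) _); rewrite lerDl.
have H1 := rf_tight hS e50 m0 R00 t01 (ltW e50) fC (BL_Cb gC) fm gm fg' xR.
have H2 := rf_time hS C0 e50 tk' gC x.
have xr : `|x| <= r by apply: le_trans xR _; rewrite lerDr.
have H3 := fg x xr.
move: H1 H2 H3; rewrite !ler_norml => /andP[? ?] /andP[? ?] /andP[? ?].
by apply/andP; split; lra.
Qed.

(** Continuity from above is the theorem of Dini on the ball provided by
  tightness; strong continuity combines tightness with the continuity in time
  on Lipschitz functions. *)
Lemma regular_semigroup :
  (forall s t f, 0 <= s -> 0 <= t -> Cb f -> S (s + t) f = S s (S t f)) ->
  convex_monotone_semigroup S.
Proof.
move=> S_add; split.
- by move=> t f t0 fC; exact: (co_dom (rf_op hS t0)).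
- by move=> t f g t0 fC gC fg; exact: (co_le (rf_op hS t0)).
- by move=> t f g lam t0 fC gC l01 x; exact: (co_convex (rf_op hS t0)).
- move=> t u t0 uC ud x; have op := rf_op hS t0; split.
    by move=> m n mn; apply: (co_le op) => // y; exact: (ud y).1.
  apply/limit_cvg => e e0.
  have [_ [m um]] := uC 0%N; have m0 : 0 <= m by exact: le_trans (um 0).
  have e20 : 0 < e / 2 by rewrite divr_gt0.
  have upos k y : 0 <= u k y.
    apply: (limit_le (proj2 (limit_cvg _ _) (ud y).2) (limit_cst (u k y))).
    by exists k => n kn; exact: (ud y).1.
  have ukm k y : `|u k y| <= m.
    rewrite ger0_norm //; apply: le_trans ((ud y).1 0%N k (leq0n k)) _.
    exact: le_trans (ler_norm _) (um y).
  pose r := `|tau (e / 2) m t `|x| |.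
  have r0 : 0 <= r := normr_ge0 _.
  have [N HN] := dini (fun n => (uC n).1) ud r0 e20.
  exists N => k Nk; rewrite -[X in _ - X](co_zero op x).
  have -> : e = e / 2 + e / 2 by lra.
  have tt : 0 <= t <= t by rewrite t0 lexx.
  apply: (rf_tight hS e20 m0 (normr_ge0 x) tt (ltW e20) (uC k) (dom_cst op 0)) => //.
    by move=> y; rewrite normr0.
  move=> y yr; rewrite subr0; apply: HN => //.
  exact: le_trans yr (ler_norm _).
- move=> f fC; apply/funext => x; apply: eq_of_le_eps => e e0.
  have [t0 t00 H] := regular_time_loc fC (normr_ge0 x) e0.
  by apply: H => //; rewrite lexx ltW.
- by move=> s t f; exact: S_add.
- move=> r T r0 T0; exists r => t /andP[t0 _]; apply/supnormP => // x.
  by rewrite (co_cst (rf_op hS t0)) ger0_norm.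
- move=> f fC h hpos h0; have [_ [m fm]] := fC; apply/cvgCbP; split => //.
  + by move=> k; exact: (co_dom (rf_op hS (ltW (hpos k)))).
  + by exists m => k x; exact: (co_bound (rf_op hS (ltW (hpos k))) fC).
  + move=> r e r0 e0; have [t0 t00 H] := regular_time_loc fC r0 e0.
    have [N HN] := proj2 (limit_cvg _ _) h0 _ t00.
    exists N => k x Nk xr; apply: H => //.
    have := HN k Nk; rewrite subr0 ger0_norm ?(ltW (hpos k)) //.
Qed.

End Semigroups.

End RegularFamilies.

(** * Limits of the schemes and their generators *)

Section SchemesRegular.
Context {R : realType} {d : nat}.
Local Notation X := 'rV[R]_d.
Local Notation M := 'M[R]_d.
Local Notation control := (@control R d).
Implicit Types (f g v : X -> R) (adm : set control) (cost : control -> R) (rho : R -> R).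

Lemma convex_operator_Cb P : convex_operator (@bounded R d) P ->
  (forall f, Cb f -> Cb (P f)) -> convex_operator (@Cb R d) P.
Proof.
move=> hP PC; have hD := @domain_Cb R d.
have b f : Cb f -> bounded f by exact: dom_bounded.
split => //.
- by move=> f g /b fb /b gb; exact: (co_le hP).
- by move=> f c /b fb; exact: (co_addcst hP).
- exact: (co_zero hP).
- by move=> f z /b fb; exact: (co_shift hP).
- by move=> f g lam /b fb /b gb; exact: (co_convex hP).
Qed.

(** The moduli come from estimates that involve the coercivity modulus only. *)
Lemma scheme_regular rho : (forall m, 1 <= rho m) -> exists tau kap,
  forall adm cost, control_problem rho adm cost ->
  forall k, regular_family tau kap (@scheme R d adm cost k).
Proof.
move=> rho1.
have tightP (p : R * R * R * R) : exists r1,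
    0 < p.1.1.1 -> 0 <= p.1.1.2 -> 0 <= p.1.2 -> 0 <= p.2 ->
    forall adm cost, control_problem rho adm cost ->
    forall h n f g del, 0 <= h -> n%:R * h <= p.1.2 -> 0 <= del ->
    (forall x, `|f x| <= p.1.1.2) -> (forall x, `|g x| <= p.1.1.2) ->
    (forall y, `|y| <= r1 -> `|f y - g y| <= del) ->
    forall x, `|x| <= p.2 ->
    `|iter n (step adm cost h) f x - iter n (step adm cost h) g x| <= del + p.1.1.1.
  have [[e0 r0 T0 R0]|no] := pselect [/\ 0 < p.1.1.1, 0 <= p.1.1.2, 0 <= p.1.2 & 0 <= p.2].
    by have [r1 H] := @step_tight R d rho _ _ _ _ rho1 e0 r0 T0 R0; exists r1.
  by exists 0 => e0 r0 T0 R0; case: no.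
have [tau0 Htau] := choice tightP.
have timeP (p : R * R) : exists s0, 0 <= p.1 -> 0 < p.2 -> 0 < s0 /\
    forall adm cost, control_problem rho adm cost ->
    forall h r f, 0 <= h -> r%:R * h <= s0 -> BL p.1 f -> forall x,
    `|iter r (@step R d adm cost h) f x - f x| <= p.2.
  have [[C0 e0]|no] := pselect (0 <= p.1 /\ 0 < p.2).
    by have [s0 s00 H] := @time_regular R d rho _ _ rho1 C0 e0; exists s0.
  by exists 0 => C0 e0; case: no.
have [kap0 Hkap] := choice timeP.
exists (fun e r T R0 => tau0 (e, r, T, R0)), (fun C e => kap0 (C, e)).
move=> adm cost cp k.
have dk := @dyadic_gt0 R k.
have hJ := convex_operator_step cp (ltW dk).
have st (t : R) : 0 <= t -> (steps k t)%:R * dyadic k <= t by move=> /(steps_itv k)[].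
split.
- move=> t t0; have hP := convex_operator_iter (steps k t) hJ.
  apply: convex_operator_Cb => // f fC; have [cf [m fm]] := fC.
  have m0 : 0 <= m by exact: le_trans (fm 0).
  apply: Cb_local_limit; first by apply: (co_dom hP); exists m.
  move=> r e r0 e0; have e20 : 0 < e / 2 by rewrite divr_gt0.
  have [C [g [gC gm fg]]] := lipschitz_approx cf fm (normr_ge0 (tau0 (e / 2, m, t, r))) e20.
  exists (iter (steps k t) (step adm cost (dyadic k)) g).
    exact: BL_continuous (co_BL hP gC).
  have -> : e = e / 2 + e / 2 by lra.
  apply: (Htau (e / 2, m, t, r) e20 m0 t0 r0 _ _ cp) => //=.
  - exact: ltW.
  - exact: st.
  - exact: ltW.
  - by move=> y yr; apply: fg; apply: le_trans yr (ler_norm _).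
- move=> e r T R0 t f g del e0 r0 R00 /andP[t0 tT] d0 fC gC fr gr fg x xR.
  have T0 : 0 <= T by exact: le_trans tT.
  apply: (Htau (e, r, T, R0) e0 r0 T0 R00 _ _ cp) => //=; first exact: ltW.
  exact: le_trans (st t t0) tT.
- by move=> C e C0 e0; exact: (proj1 (Hkap (C, e) C0 e0)).
- move=> C e t f C0 e0 /andP[t0 tk] fC.
  apply: (proj2 (Hkap (C, e) C0 e0) _ _ cp) => //; first exact: ltW.
  exact: le_trans (st t t0) tk.
Qed.

(** Rounding s and t separately loses at most one time step. *)
Lemma scheme_add rho C e : (forall m, 1 <= rho m) -> 0 <= C -> 0 < e -> exists N,
  forall adm cost, control_problem rho adm cost ->
  forall k s t f, (N <= k)%N -> 0 <= s -> 0 <= t -> BL C f -> forall x,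
  `|@scheme R d adm cost k (s + t) f x - scheme adm cost k s (scheme adm cost k t f) x| <= e.
Proof.
move=> rho1 C0 e0.
have [s0 s00 H] := @time_regular R d rho _ _ rho1 C0 e0.
have [N HN] := dyadic_small s00.
exists N => adm cost cp k s t f Nk spos tpos fC x.
have dk := @dyadic_gt0 R k.
have [a1 a2] := steps_itv k spos; have [b1 b2] := steps_itv k tpos.
have [c1 c2] := steps_itv k (addr_ge0 spos tpos).
have le1 : (steps k s + steps k t <= steps k (s + t))%N.
  by rewrite -ltnS -(ltr_nat R) -(ltr_pM2r dk) natrD -natr1 !mulrDl mul1r; lra.
have le2 : (steps k (s + t) <= (steps k s + steps k t).+1)%N.
  rewrite -ltnS -(ltr_nat R) -(ltr_pM2r dk) -!natr1 natrD !mulrDl !mul1r.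
  apply: le_lt_trans c1 _; lra.
have hJ := convex_operator_step cp (ltW dk).
have hP := convex_operator_iter (steps k s + steps k t) hJ.
rewrite /scheme -iterD -(subnK le1) addnC iterD.
set r := (_ - _)%N.
have r1 : (r <= 1)%N by rewrite /r leq_subLR addn1.
have rk : r%:R * dyadic k <= s0.
  have := @le_dyadic R _ _ Nk.
  have : (r%:R : R) <= 1 by rewrite lern1.
  by move=> /(ler_wpM2r (ltW dk)); rewrite mul1r; lra.
have fb := BL_bounded fC.
have rb := co_dom (convex_operator_iter r hJ) fb.
exact: (co_contraction hP rb fb (H _ _ cp _ _ _ (ltW dk) rk fC) x).
Qed.

(** The generator with a remainder that is uniform in space and over bounded
  sets of smooth functions, the form that is stable under limits. *)
Definition consistent (om : R -> R -> R) (S : R -> (X -> R) -> X -> R) (H : M * X -> R) :=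
  forall B e t v p Q, 0 <= B -> 0 < e -> 0 <= t <= om B e -> taylor B v p Q ->
  forall x, `|S t v x - v x - t * H (Q x, p x)| <= e * t.

Lemma steps_limit (t : R) : 0 <= t -> limit (fun k => (steps k t)%:R * dyadic k) t.
Proof.
move=> t0 e e0; have [N HN] := dyadic_small e0; exists N => k Nk.
have [a1 a2] := steps_itv k t0; have := @le_dyadic R _ _ Nk.
by rewrite ler_norml => ?; apply/andP; split; lra.
Qed.

Lemma scheme_limit_consistent rho : (forall m, 1 <= rho m) -> exists om,
  (forall B e, 0 <= B -> 0 < e -> 0 < om B e) /\
  forall adm cost, control_problem rho adm cost ->
  (forall f t x, Cb f -> 0 <= t ->
     limit (fun k => scheme adm cost k t f x) (limit_family (scheme adm cost) t f x)) ->
  consistent om (limit_family (scheme adm cost)) (ham adm cost).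
Proof.
move=> rho1.
have omP (p : R * R) : exists h0, 0 <= p.1 -> 0 < p.2 -> 0 < h0 /\
    forall adm cost, control_problem rho adm cost ->
    forall h m v q Q, 0 < h -> m%:R * h <= h0 -> taylor p.1 v q Q -> forall x,
    `|iter m (@step R d adm cost h) v x - v x - m%:R * h * ham adm cost (Q x, q x)|
       <= p.2 * (m%:R * h).
  have [[B0 e0]|no] := pselect (0 <= p.1 /\ 0 < p.2).
    by have [h0 [h00 _ H]] := @multi_consistent R d rho _ _ rho1 B0 e0; exists h0.
  by exists 0 => B0 e0; case: no.
have [om Hom] := choice omP.
exists (fun B e => om (B, e)); split.
  by move=> B e B0 e0; exact: (proj1 (Hom (B, e) B0 e0)).
move=> adm cost cp lim B e t v p Q B0 e0 /andP[t0 tom] tv x.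
have L1 := lim v t x (BL_Cb (ty_v tv)) t0.
have L2 := limit_lin 1 (ham adm cost (Q x, p x)) (limit_cst (v x)) (steps_limit t0).
have -> : limit_family (scheme adm cost) t v x - v x - t * ham adm cost (Q x, p x)
   = limit_family (scheme adm cost) t v x - (1 * v x + ham adm cost (Q x, p x) * t) by ring.
apply: limit_dist_le L1 L2 _; exists 0%N => k _.
have [a1 _] := steps_itv k t0.
have := proj2 (Hom (B, e) B0 e0) _ _ cp _ (steps k t) _ _ _ (dyadic_gt0 k) (le_trans a1 tom) tv x.
rewrite /= => H1.
have H2 : e * ((steps k t)%:R * dyadic k) <= e * t by apply: ler_wpM2l => //; exact: ltW.
apply: le_trans H2; apply: le_trans H1.
have -> : scheme adm cost k t v x - (1 * v x + ham adm cost (Q x, p x) * ((steps k t)%:R * dyadic k))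
  = iter (steps k t) (step adm cost (dyadic k)) v x - v x - (steps k t)%:R * dyadic k * ham adm cost (Q x, p x).
  by rewrite /scheme; ring.
by [].
Qed.

(** Consistency controls the difference quotients for small h, and the bound 2
  B / h does so for h beyond om B 1. *)
Lemma consistent_generator tau kap om S (H : M * X -> R) B C v p Q :
  regular_family tau kap S -> (forall B e, 0 <= B -> 0 < e -> 0 < om B e) ->
  consistent om S H -> taylor B v p Q -> BL C (fun x => H (Q x, p x)) ->
  generator S v (fun x => H (Q x, p x)).
Proof.
move=> hS om0 hc tv HC; have B0 := BL_ge0 (ty_v tv).
have vC := BL_Cb (ty_v tv).
split=> // h hpos h0; apply/cvgCbP; split.
- move=> k; have hk := hpos k; have SC := co_dom (rf_op hS (ltW hk)) vC.
  have := dom_lin (@domain_Cb R d) (h k)^-1 (- (h k)^-1) SC vC.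
  by congr Cb; apply/funext => x; ring.
- exact: BL_Cb HC.
- have o1 := om0 B 1 B0 ltr01.
  exists (2 * B / om B 1 + (1 + C)) => k x.
  have C0 := BL_ge0 HC; have hk := hpos k.
  have W0 : 0 <= 2 * B / om B 1 by rewrite divr_ge0 ?mulr_ge0 // ltW.
  rewrite normrM normfV (gtr0_norm hk) ler_pdivrMr //.
  have [hs|hl] := leP (h k) (om B 1).
    have hko : 0 <= h k <= om B 1 by rewrite ltW.
    have H1 := hc _ _ _ _ _ _ B0 ltr01 hko tv x.
    have H2 := ler_wpM2l (ltW hk) (proj1 HC x).
    rewrite -{1}(gtr0_norm hk) -normrM in H2.
    have := ler_normD (S (h k) v x - v x - h k * H (Q x, p x)) (h k * H (Q x, p x)).
    rewrite subrK.
    have := mulr_ge0 W0 (ltW hk); lra.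
  have H1 := co_bound (rf_op hS (ltW hk)) vC (proj1 (ty_v tv)) x.
  have H2 := proj1 (ty_v tv) x.
  apply: le_trans (ler_normB _ _) _.
  have : 2 * B <= 2 * B / om B 1 * h k.
    rewrite mulrAC -mulrA ler_peMr ?mulr_ge0 // ler_pdivlMr // mul1r; exact: ltW.
  have : 0 <= (1 + C) * h k by rewrite mulr_ge0 ?addr_ge0 // ltW.
  rewrite [X in _ <= X]mulrDl; lra.
- apply: uniform_loc_cvg => e e0.
  have [N HN] := proj2 (limit_cvg _ _) h0 _ (om0 B e B0 e0).
  exists N => k x Nk; have hk := hpos k.
  have hko : 0 <= h k <= om B e.
    by have := HN k Nk; rewrite subr0 (gtr0_norm hk) => ->; rewrite ltW.
  have H1 := hc _ _ _ _ _ _ B0 e0 hko tv x.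
  have -> : (S (h k) v x - v x) / h k - H (Q x, p x)
     = (S (h k) v x - v x - h k * H (Q x, p x)) / h k by field; rewrite gt_eqF.
  by rewrite normrM normfV (gtr0_norm hk) ler_pdivrMr.
Qed.

End SchemesRegular.

(** * A countable dense set of smooth functions *)

Section Density.
Context {R : realType} {d : nat}.
Local Notation X := 'rV[R]_d.

(** Rational nodes and values, an integral slope, a rational bound and the
  inverse of a mollification scale: a countable type. *)
Definition spline_data : Type := (seq ('rV[rat]_d * rat) * nat * rat * nat)%type.

Definition rat_point (z : 'rV[rat]_d) : X := \row_i ratr (z ord0 i).

(** The McShane extension of finitely many values, a maximum of cones with
  slope L, cut off from below at - c. *)
Definition node_max (s : seq ('rV[rat]_d * rat)) (L : R) (c : R) (x : X) : R :=
  foldr (fun zq m => Num.max (ratr zq.2 - L * `|x - rat_point zq.1|) m) (- c) s.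

Definition spline s (L c : R) (x : X) : R := Num.min c (node_max s L c x).

Definition smooth_spline (t : spline_data) : X -> R :=
  mollify (t.2.+1%:R^-1) (spline t.1.1.1 t.1.1.2%:R `|ratr t.1.2|).

Lemma max_lip (a b a' b' e : R) : `|a - a'| <= e -> `|b - b'| <= e ->
  `|Num.max a b - Num.max a' b'| <= e.
Proof.
rewrite !ler_norml => /andP[? ?] /andP[? ?].
by apply/andP; split; rewrite /Num.max; case: ltP => ?; case: ltP => ?; lra.
Qed.

Lemma min_lip (a b a' b' e : R) : `|a - a'| <= e -> `|b - b'| <= e ->
  `|Num.min a b - Num.min a' b'| <= e.
Proof.
rewrite !ler_norml => /andP[? ?] /andP[? ?].
by apply/andP; split; rewrite /Num.min; case: ltP => ?; case: ltP => ?; lra.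
Qed.

Lemma node_max_lip s L c x y : 0 <= L ->
  `|node_max s L c x - node_max s L c y| <= L * `|x - y|.
Proof.
move=> L0; elim: s => [|zq s IH] /=; first by rewrite subrr normr0 mulr_ge0.
apply: max_lip => //.
have -> : ratr zq.2 - L * `|x - rat_point zq.1| - (ratr zq.2 - L * `|y - rat_point zq.1|)
   = L * (`|y - rat_point zq.1| - `|x - rat_point zq.1|) by ring.
rewrite normrM (ger0_norm L0); apply: ler_wpM2l => //.
apply: le_trans (ler_dist_dist _ _) _.
by rewrite distrC subrDr.
Qed.

Lemma node_max_ge s L c x : - c <= node_max s L c x.
Proof. by elim: s => [|zq s IH] //=; rewrite le_max IH orbT. Qed.

Lemma spline_bound s L c x : 0 <= c -> `|spline s L c x| <= c.
Proof.
move=> c0; rewrite ler_norml ge_min lexx /= andbT le_min node_max_ge andbT; lra.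
Qed.

Lemma spline_BL s L c : 0 <= L -> 0 <= c -> BL (c + L) (spline s L c).
Proof.
move=> L0 c0; split=> [x|x y].
  by apply: le_trans (spline_bound _ _ _ c0) _; rewrite lerDl.
apply: min_lip; first by rewrite subrr normr0 mulr_ge0 // addr_ge0.
apply: le_trans (node_max_lip _ _ _ _ L0) _; apply: ler_wpM2r => //.
by rewrite lerDr.
Qed.

Lemma rat_dense (a b : R) : a < b -> exists q : rat, a < ratr q < b.
Proof. by move=> /rat_in_itvoo[q]; rewrite in_itv /=; exists q. Qed.

Lemma rat_point_dense (x : X) (e : R) : 0 < e -> exists z, `|x - rat_point z| < e.
Proof.
move=> e0; have e20 : 0 < e / 2 by rewrite divr_gt0.
have H i : exists q : rat, x ord0 i - e / 2 < ratr q < x ord0 i + e / 2.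
  by apply: rat_dense; lra.
have [q Hq] := choice H.
exists (\row_i q i); apply: (@le_lt_trans _ _ (e / 2)); last by lra.
apply: mx_norm_leP; first exact: ltW.
move=> k i; rewrite (ord1 k) !mxE; have /andP[? ?] := Hq i.
by rewrite ler_norml; apply/andP; split; lra.
Qed.

(** A Lipschitz function is the supremum of the cones with vertices on its
  graph over the rational points; by compactness finitely many of them suffice
  on a ball. *)
Lemma spline_dense f C m r e : BL C f -> (forall x, `|f x| <= m) -> 0 <= r -> 0 < e ->
  exists s (L : nat) (c : rat), `|ratr c| <= m /\
    forall x, `|x| <= r -> `|f x - spline s L%:R `|ratr c| x| <= e.
Proof.
move=> fC fm r0 e0; have C0 := BL_ge0 fC; have m0 : 0 <= m by exact: le_trans (fm 0).
have e20 : 0 < e / 2 by rewrite divr_gt0.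
have [L CL] : exists L : nat, C <= L%:R.
  by exists (Num.bound C); apply: ltW; apply: archi_boundP.
have L0 : (0 : R) <= L%:R by [].
have [c [cm mc]] : exists c : rat, `|ratr c| <= m /\ m - e <= `|ratr c| :> R.
  have [->|mN0] := eqVneq m 0; first by exists 0; rewrite rmorph0 normr0; split=> //; lra.
  have mp : 0 < m by rewrite lt_neqAle eq_sym mN0.
  have [c /andP[c1 c2]] := @rat_dense (Num.max 0 (m - e)) m ltac:(by rewrite gt_max mp /=; lra).
  move: c1; rewrite gt_max => /andP[c0 c1].
  by exists c; rewrite gtr0_norm //; split; exact: ltW.
pose z (i : nat) : 'rV[rat]_d := odflt 0 (unpickle i).
have Hq i : exists q : rat, f (rat_point (z i)) - e / 2 < ratr q < f (rat_point (z i)) + e / 2.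
  by apply: rat_dense; lra.
have [q {}Hq] := choice Hq.
pose s n := [seq (z i, q i) | i <- iota 0 n].
have upper n L' x : C <= L' -> node_max (s n) L' `|ratr c| x <= f x + e.
  move=> CL'; rewrite /s; elim: (iota 0 n) => [|i l IH] /=.
    by have := fm x; rewrite ler_norml => /andP[]; lra.
  rewrite ge_max IH andbT; have /andP[_ q2] := Hq i.
  have := proj2 fC (rat_point (z i)) x; rewrite ler_norml => /andP[_].
  have := ler_wpM2r (normr_ge0 (x - rat_point (z i))) CL'.
  rewrite (distrC (rat_point (z i)) x); lra.
have nodes n i x : (i < n)%N -> ratr (q i) - L%:R * `|x - rat_point (z i)| <= node_max (s n) L%:R `|ratr c| x.
  move=> im; have : i \in iota 0 n by rewrite mem_iota.
  rewrite /s; elim: (iota 0 n) => [//|j l IH] /=; rewrite inE => /orP[/eqP ->|il].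
    by rewrite le_max lexx.
  by rewrite le_max IH ?orbT.
have [N HN] : exists N, forall k x, (N <= k)%N -> cball r x -> f x - e <= node_max (s k) L%:R `|ratr c| x.
  apply: compact_uniform; first exact: compact_cball.
  move=> x _.
  pose del : R := e / 4 / (C + L%:R + 1).
  have D0 : 0 < C + L%:R + 1 by rewrite ltr_wpDl // addr_ge0.
  have del0 : 0 < del by rewrite !divr_gt0.
  have [z0 Hz0] := rat_point_dense x del0.
  have zE : z (pickle z0) = z0 by rewrite /z pickleK.
  exists (pickle z0).+1, del; split=> // k y ik yx.
  have := nodes k (pickle z0) y ik; rewrite zE.
  have /andP[q1 _] := Hq (pickle z0); rewrite zE in q1.
  have yz : `|y - rat_point z0| <= del + del.
    by have := ler_distD x y (rat_point z0); lra.
  have := proj2 fC y (rat_point z0); rewrite ler_norml => /andP[_ F1].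
  have F2 := ler_wpM2l C0 yz; have F3 := ler_wpM2l L0 yz.
  have : del * (C + L%:R + 1) = e / 4 by rewrite /del divfK // gt_eqF.
  lra.
exists (s N), L, c; split=> // x xr.
have H1 := HN N x (leqnn N) xr; have H2 := upper N L%:R x CL.
rewrite /spline /Num.min; case: ltP => ?.
  have := fm x; rewrite !ler_norml => /andP[? ?]; apply/andP; split; lra.
rewrite ler_norml; apply/andP; split; lra.
Qed.

Lemma smooth_spline_taylor t : exists B p Q, taylor B (smooth_spline t) p Q.
Proof.
have HC := spline_BL t.1.1.1 (ler0n R t.1.1.2) (normr_ge0 (ratr t.1.2 : R)).
have e0 : 0 < (t.2.+1%:R : R)^-1 by rewrite invr_gt0.
by have [p [Q H]] := mollify_taylor e0 HC; eexists; exists p, Q; exact: H.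
Qed.

Lemma smooth_spline_dense f m r e : Cb f -> (forall x, `|f x| <= m) -> 0 <= r -> 0 < e ->
  exists t, (forall x, `|smooth_spline t x| <= m) /\
    forall x, `|x| <= r -> `|smooth_spline t x - f x| <= e.
Proof.
move=> [cf _] fm r0 e0; have e30 : 0 < e / 3 by rewrite divr_gt0.
have [C [g [gC gm fg]]] := lipschitz_approx cf fm r0 e30.
have [s [L [c [cm Hs]]]] := spline_dense gC gm r0 e30.
have sBL := spline_BL s (ler0n R L) (normr_ge0 (ratr c : R)).
set C' := _ + _ in sBL.
have C'0 := BL_ge0 sBL.
have K0 : 0 <= 2 * d%:R * C' by rewrite !mulr_ge0.
have [j Hj] : exists j : nat, 2 * d%:R * C' * j.+1%:R^-1 <= e / 3.
  have [j Hj] : exists j : nat, 2 * d%:R * C' / (e / 3) < j%:R.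
    by exists (Num.bound (2 * d%:R * C' / (e / 3))); apply: archi_boundP; rewrite divr_ge0 // ltW.
  exists j; move: Hj; rewrite ltr_pdivrMr // ler_pdivrMr // -natr1; lra.
have j0 : 0 < (j.+1%:R : R)^-1 by rewrite invr_gt0.
have hA := @averaging_mollify R d _ j0.
exists (s, L, c, j); split=> x.
  rewrite -[smooth_spline _ x]subr0 -[X in _ - X](av_cst hA 0 x).
  have zBL : BL C' (fun _ : X => 0 : R).
    by apply: le_BL (@BL_cst R d 0); rewrite normr0.
  apply: (av_near hA sBL zBL) => y; rewrite subr0.
  exact: le_trans (spline_bound _ _ _ (normr_ge0 _)) cm.
move=> xr; have H1 := fg x xr; have H2 := Hs x xr.
have H3 := le_trans (mollify_near j0 sBL x) Hj.
move: H1 H2 H3; rewrite /smooth_spline /= !ler_norml => /andP[? ?] /andP[? ?] /andP[? ?].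
by apply/andP; split; lra.
Qed.

Lemma countable_smooth_splines : countable (range smooth_spline).
Proof.
by apply: (sub_countable (card_image_le _ _)); exact: countableP.
Qed.

End Density.

(** * From penalty functions to control problems *)

Section ControlProblems.
Context {R : realType} {d : nat}.
Local Notation X := 'rV[R]_d.
Local Notation M := 'M[R]_d.
Local Notation control := (@control R d).

Definition finite_cost (phi : M * X -> \bar R) : set control :=
  [set u | (phi (diffusion u, u.2) < +oo)%E].
Definition real_cost (phi : M * X -> \bar R) (u : control) : R :=
  fine (phi (diffusion u, u.2)).

Lemma psd_diffusion (u : control) : psd (diffusion u).
Proof.
split; first by rewrite /diffusion trmx_mul trmxK.
move=> x; rewrite /diffusion.
have -> : x *m (u.1^T *m u.1) *m x^T = (x *m u.1^T) *m (x *m u.1^T)^T.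
  by rewrite trmx_mul trmxK !mulmxA.
rewrite mxE; apply: sumr_ge0 => i _.
by rewrite [(_ ^T) _ _]mxE -expr2 sqr_ge0.
Qed.

Section Cost.
Variables (rho : R -> R) (phi : M * X -> \bar R).
Hypothesis phi_ge0 : forall p, psd p.1 -> (0 <= phi p)%E.
Hypothesis phi_zero : exists2 p, psd p.1 & phi p = 0%E.
Hypothesis rho1 : forall m, 1 <= rho m.
Hypothesis phi_coercive : forall m a b, psd a -> rho m < enorm a + enorm b ->
  (m%:E <= phi (a, b) * ((enorm a + enorm b)^-1)%:E)%E.

Lemma real_costE u : finite_cost phi u -> phi (diffusion u, u.2) = (real_cost phi u)%:E.
Proof.
move=> fu; rewrite /real_cost fineK // ge0_fin_numE //.
by apply: phi_ge0; exact: psd_diffusion.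
Qed.

Lemma control_problem_of_cost : control_problem rho (finite_cost phi) (real_cost phi).
Proof.
split=> //.
- move=> u _; apply: fine_ge0; apply: phi_ge0; exact: psd_diffusion.
- have [[a b] /= apsd phi0] := phi_zero.
  have [s aE] := cholesky apsd.
  have sE : diffusion (s, b) = a by rewrite aE.
  have ph : phi (diffusion (s, b), (s, b).2) = 0%E by rewrite sE.
  exists (s, b); split.
  + by rewrite /finite_cost /= ph ltry.
  + by rewrite /real_cost ph.
  + rewrite leNgt; apply/negP; rewrite /magnitude sE /= => big.
    have := phi_coercive apsd big; rewrite phi0 mul0e lee_fin.
    by rewrite ler10.
- move=> m u fu big.
  have s0 : 0 < magnitude u by apply: lt_le_trans ltr01 (le_trans (rho1 m) (ltW big)).
  have := phi_coercive (psd_diffusion u) big.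
  by rewrite real_costE // -EFinM lee_fin ler_pdivlMr.
Qed.

Lemma linear_partE (q : M * X) (u : control) :
  linear_part q u = \tr (q.1 *m diffusion u) / 2 + (q.2 *m u.2^T) ord0 ord0.
Proof.
congr (_ + _); rewrite mxE; apply: eq_bigr => i _.
by rewrite [(_ ^T) _ _]mxE.
Qed.

(** Every covariance matrix has a square root, so the Hamiltonian is a supremum
  over the controls of the random walk. *)
Lemma hamiltonianE q : hamiltonian phi q = (ham (finite_cost phi) (real_cost phi) q)%:E.
Proof.
have cp := control_problem_of_cost.
have elt u : finite_cost phi u ->
    ((linear_part q u - real_cost phi u)%:E <= hamiltonian phi q)%E.
  move=> fu; apply: ereal_sup_ubound; exists (diffusion u, u.2); first exact: psd_diffusion.
  by rewrite real_costE // linear_partE EFinB.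
apply/eqP; rewrite eq_le; apply/andP; split.
  apply: ge_ereal_sup => _ [[a b] /= apsd <-].
  have [s aE] := cholesky apsd.
  have sE : diffusion (s, b) = a by rewrite aE.
  have [fu|nfu] := pselect (finite_cost phi (s, b)).
    have := ham_lb cp q fu; rewrite linear_partE sE /=.
    have := real_costE fu; rewrite sE /= => ->.
    by rewrite -EFinB lee_fin.
  have -> : phi (a, b) = +oo%E.
    by apply/eqP; rewrite -leye_eq leNgt; apply/negP => fu; apply: nfu; rewrite /finite_cost /= sE.
  by rewrite addeNy leNye.
have [u [fu _ _]] := cp_free cp.
have := elt u fu; case: (hamiltonian phi q) (elt) => [r| |] H; last by rewrite leeNy_eq.
  by move=> _; rewrite lee_fin; apply: (ham_ub cp) => w fw; have := H w fw; rewrite lee_fin.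
by move=> _; rewrite leey.
Qed.

End Cost.

Lemma compact_mx_ball B : 0 <= B -> compact [set a : M | `|a| <= B].
Proof.
move=> B0.
have -> : [set a : M | `|a| <= B] = (@vec_mx R d d) @` (@cball R (d * d) B).
  apply/seteqP; split=> [a /= aB|_ [v vB <-]] /=.
    exists (mxvec a); last exact: mxvecK.
    apply: mx_norm_leP => // i k; rewrite (ord1 i).
    case/mxvec_indexP: k => k l; rewrite mxvecE.
    exact: le_trans (mx_entry_le _ _ _) aB.
  apply: mx_norm_leP => // i j; rewrite mxE.
  exact: le_trans (mx_entry_le _ _ _) vB.
apply: continuous_compact; last exact: compact_cball.
apply: continuous_subspaceT.
apply: (@lipschitz_continuous R 'rV[R]_(d * d) M (@vec_mx R d d) 1) => v w.
rewrite mul1r -linearB; apply: mx_norm_leP => // i j; rewrite mxE.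
exact: mx_entry_le.
Qed.

Lemma compact_pair_ball B : 0 <= B ->
  compact [set q : M * X | `|q.1| <= B /\ `|q.2| <= B].
Proof.
move=> B0.
have -> : [set q : M * X | `|q.1| <= B /\ `|q.2| <= B] = [set a : M | `|a| <= B] `*` @cball R d B.
  by [].
by apply: compact_setX; [exact: compact_mx_ball|exact: compact_cball].
Qed.

Lemma norm_on_finite (T : Type) (K : set T) (f : T -> R) m : 0 <= m ->
  (forall x, `|f x| <= m) -> exists2 c, 0 <= c & norm_on K f = c%:E.
Proof.
move=> m0 fm.
have n0 : (0 <= norm_on K f)%E by exact: esup_abs_ge0.
have nm : (norm_on K f <= m%:E)%E by apply/norm_onP.
have fn : norm_on K f \is a fin_num.
  by rewrite ge0_fin_numE //; apply: le_lt_trans nm _; rewrite ltry.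
exists (fine (norm_on K f)); first exact: fine_ge0.
by rewrite fineK.
Qed.

Lemma norm_le_norm_on (T : Type) (K : set T) (f : T -> R) c x : 0 <= c ->
  norm_on K f = c%:E -> K x -> `|f x| <= c.
Proof. by move=> c0 E; apply: (proj1 (norm_onP K f c0)); rewrite E. Qed.

End ControlProblems.

(** * The semigroups and their limit *)

Section Semigroups.
Context {R : realType} {d : nat}.
Local Notation M := 'M[R]_d.
Local Notation X := 'rV[R]_d.
Context (rho : R -> R) (rho1 : forall m, 1 <= rho m).
Context (adm : nat -> set (@control R d)) (cost : nat -> @control R d -> R).
Context (cp : forall n, control_problem rho (adm n) (cost n)).
Implicit Types (f g v : X -> R).
Local Notation V n := (scheme (adm n) (cost n)).
Local Notation Hn n := (ham (adm n) (cost n)).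

Definition semigroup n : R -> (X -> R) -> X -> R := limit_family (V n).

Lemma scheme_time_cauchy n C T e : 0 <= C -> 0 <= T -> 0 < e -> exists N,
  forall k k' t f, (N <= k)%N -> (N <= k')%N -> 0 <= t <= T -> BL C f ->
  forall x, `|V n k t f x - V n k' t f x| <= e.
Proof.
move=> C0 T0 e0; have [N [B [del [B0 del0 HN]]]] := @scheme_cauchy R d rho C T e rho1 C0 T0 e0.
exists N => k k' t f Nk Nk' tT fC x; apply: (HN _ _ _ _ (cp n) (cp n)) => //.
by move=> q _ _; rewrite subrr normr0 ltW.
Qed.

Context (tau : R -> R -> R -> R -> R) (kap : R -> R -> R).
Context (V_regular : forall n k, regular_family tau kap (V n k)).

Lemma semigroup_regular n : regular_family tau kap (semigroup n).
Proof. exact: regular_limit_family (V_regular n) (@scheme_time_cauchy n). Qed.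

Lemma semigroup_limit n f t x : Cb f -> 0 <= t ->
  limit (fun k => V n k t f x) (semigroup n t f x).
Proof. exact: limit_familyP (V_regular n) (@scheme_time_cauchy n) f t x. Qed.

Lemma semigroup_add n s t f : 0 <= s -> 0 <= t -> Cb f ->
  semigroup n (s + t) f = semigroup n s (semigroup n t f).
Proof.
move=> s0 t0 fC; apply: (limit_family_add (V_regular n) (@scheme_time_cauchy n)) => //.
move=> C e s' t' C0 e0 s'0 t'0; have [N HN] := @scheme_add R d rho C e rho1 C0 e0.
by exists N => k g Nk gC x; exact: (HN _ _ (cp n)).
Qed.

Context (H : M * X -> R).
Context (ham_cvg : forall B e, 0 <= B -> 0 < e -> exists N, forall n (q : M * X),
  (N <= n)%N -> `|q.1| <= B -> `|q.2| <= B -> `|Hn n q - H q| <= e).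

(** Hamiltonians that are close on a large ball have schemes that are close at
  all fine levels, and the bound passes to the limits in the step size. *)
Lemma semigroup_cauchy C T e : 0 <= C -> 0 <= T -> 0 < e -> exists N,
  forall n n' t f, (N <= n)%N -> (N <= n')%N -> 0 <= t <= T -> BL C f ->
  forall x, `|semigroup n t f x - semigroup n' t f x| <= e.
Proof.
move=> C0 T0 e0; have [N [B [del [B0 del0 HN]]]] := @scheme_cauchy R d rho C T e rho1 C0 T0 e0.
have del20 : 0 < del / 2 by rewrite divr_gt0.
have [N' HN'] := ham_cvg B0 del20.
exists N' => n n' t f Nn Nn' /[dup] tT /andP[t0 _] fC x.
apply: limit_dist_le (semigroup_limit n x (BL_Cb fC) t0) (semigroup_limit n' x (BL_Cb fC) t0) _.
exists N => k Nk; apply: (HN _ _ _ _ (cp n) (cp n')) => // q q1 q2.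
have := HN' n q Nn q1 q2; have := HN' n' q Nn' q1 q2.
by rewrite !ler_norml => /andP[? ?] /andP[? ?]; apply/andP; split; lra.
Qed.

Definition limit_semigroup : R -> (X -> R) -> X -> R := limit_family semigroup.
Local Notation S := limit_semigroup.

Lemma limit_semigroup_regular : regular_family tau kap S.
Proof. exact: regular_limit_family semigroup_regular semigroup_cauchy. Qed.

Lemma limit_semigroup_limit f t x : Cb f -> 0 <= t ->
  limit (fun n => semigroup n t f x) (S t f x).
Proof. exact: limit_familyP semigroup_regular semigroup_cauchy f t x. Qed.

Lemma limit_semigroup_add s t f : 0 <= s -> 0 <= t -> Cb f ->
  S (s + t) f = S s (S t f).
Proof.
move=> s0 t0 fC; apply: (limit_family_add semigroup_regular semigroup_cauchy) => //.
move=> C e s' t' C0 e0 s'0 t'0; exists 0%N => n g _ gC x.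
by rewrite semigroup_add ?subrr ?normr0 ?(ltW e0) //; exact: BL_Cb gC.
Qed.

Lemma limit_semigroup_cvg f t : Cb f -> 0 <= t ->
  cvgCb (fun n => semigroup n t f) (S t f).
Proof.
move=> fC t0; have [_ [m fm]] := fC; apply/cvgCbP; split.
- by move=> n; exact: (co_dom (rf_op (semigroup_regular n) t0)).
- exact: (co_dom (rf_op limit_semigroup_regular t0)).
- by exists m => n x; exact: (co_bound (rf_op (semigroup_regular n) t0) fC).
- move=> r e r0 e0.
  have [N HN] := limit_family_loc semigroup_regular semigroup_cauchy fC t0 r0 e0.
  by exists N => n x Nn xr; apply: HN => //; rewrite t0 lexx.
Qed.

Lemma ham_limit q : limit (fun n => Hn n q) (H q).
Proof.
move=> e e0; have B0 : 0 <= `|q.1| + `|q.2| by rewrite addr_ge0.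
by have [N HN] := ham_cvg B0 e0; exists N => n Nn; apply: HN; rewrite // ?lerDl ?lerDr.
Qed.

Lemma ham_limit_BL B v p Q : taylor B v p Q -> exists C,
  (forall n, BL C (fun x => Hn n (Q x, p x))) /\ BL C (fun x => H (Q x, p x)).
Proof.
move=> tv; exists (@ham_bound R d rho B + @ham_lip R d rho B * B).
have hn n := ham_BL (cp n) tv.
split=> //; split=> [x|x y].
  rewrite -[H _]subr0; apply: limit_dist_le (ham_limit _) (limit_cst 0) _.
  by exists 0%N => n _; rewrite subr0; exact: (proj1 (hn n)).
apply: limit_dist_le (ham_limit _) (ham_limit _) _.
by exists 0%N => n _; exact: (proj2 (hn n)).
Qed.

Lemma ham_cvgCb B v p Q : taylor B v p Q ->
  cvgCb (fun n x => Hn n (Q x, p x)) (fun x => H (Q x, p x)).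
Proof.
move=> tv; have [C [h1 h2]] := ham_limit_BL tv; apply/cvgCbP; split.
- by move=> n; exact: BL_Cb (h1 n).
- exact: BL_Cb h2.
- by exists C => n x; exact: (proj1 (h1 n)).
- apply: uniform_loc_cvg => e e0.
  have [N HN] := ham_cvg (BL_ge0 (ty_v tv)) e0; exists N => n x Nn; apply: HN => //=.
    exact: (proj1 (ty_Q tv)).
  exact: (proj1 (ty_p tv)).
Qed.

Context (om : R -> R -> R) (om_gt0 : forall B e, 0 <= B -> 0 < e -> 0 < om B e).
Context (semigroup_consistent : forall n, consistent om (semigroup n) (Hn n)).

Lemma semigroup_generator n B v p Q : taylor B v p Q ->
  generator (semigroup n) v (fun x => Hn n (Q x, p x)).
Proof.
move=> tv; have [C [h1 _]] := ham_limit_BL tv.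
exact: consistent_generator (semigroup_regular n) om_gt0 (semigroup_consistent n) tv (h1 n).
Qed.

(** The generators commute with the limit because the small-time expansions of
  all the semigroups hold on the same time intervals. *)
Lemma limit_semigroup_consistent : consistent om S H.
Proof.
move=> B e t v p Q B0 e0 /[dup] tom /andP[t0 _] tv x.
have L1 := limit_semigroup_limit x (BL_Cb (ty_v tv)) t0.
have L2 := limit_lin 1 t (limit_cst (v x)) (ham_limit (Q x, p x)).
have -> : S t v x - v x - t * H (Q x, p x) = S t v x - (1 * v x + t * H (Q x, p x)) by ring.
apply: limit_dist_le L1 L2 _; exists 0%N => n _.
have -> : semigroup n t v x - (1 * v x + t * Hn n (Q x, p x)) = semigroup n t v x - v x - t * Hn n (Q x, p x) by ring.
exact: (semigroup_consistent n B0 e0 tom tv x).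
Qed.

Lemma limit_semigroup_generator B v p Q : taylor B v p Q ->
  generator S v (fun x => H (Q x, p x)).
Proof.
move=> tv; have [C [_ h2]] := ham_limit_BL tv.
exact: consistent_generator limit_semigroup_regular om_gt0 limit_semigroup_consistent tv h2.
Qed.

End Semigroups.

(** * Supremum norms, translations and Lipschitz bounds *)

Section Conditions.
Context {R : realType} {d : nat}.
Local Notation X := 'rV[R]_d.
Implicit Types (f g v : X -> R).

Lemma Cb_supnorm f : Cb f -> exists c, [/\ 0 <= c, supnorm f = c%:E & forall x, `|f x| <= c].
Proof.
move=> [_ [m fm]]; have m0 : 0 <= m by exact: le_trans (fm 0).
have [c c0 cE] := norm_on_finite [set: X] m0 fm.
by exists c; split=> // x; exact: (norm_le_norm_on c0 cE).
Qed.

Lemma Cb_sub f g : Cb f -> Cb g -> Cb (f \- g)%R.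
Proof.
move=> fC gC; have := dom_lin (@domain_Cb R d) 1 (-1) fC gC.
by congr Cb; apply/funext => x /=; ring.
Qed.

Lemma contraction_supnorm P f g : convex_operator (@Cb R d) P -> Cb f -> Cb g ->
  (supnorm (P f \- P g)%R <= supnorm (f \- g)%R)%E.
Proof.
move=> hP fC gC; have [c [c0 -> fgc]] := Cb_supnorm (Cb_sub fC gC).
by apply/supnormP => // x /=; exact: (co_contraction hP fC gC).
Qed.

Lemma regular_family_tight tau kap S e r T r0 (K : set X) t f g :
  regular_family tau kap S -> 0 < e -> 0 <= r -> 0 <= r0 -> K `<=` cball r0 ->
  0 <= t <= T -> Cb f -> Cb g -> (supnorm f <= r%:E)%E -> (supnorm g <= r%:E)%E ->
  (norm_on K (S t f \- S t g)%R
    <= norm_on (cball `|tau e r T r0|) (f \- g)%R + e%:E)%E.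
Proof.
move=> hS e0 rpos r00 Kr tT fC gC /(supnormP _ rpos) fr /(supnormP _ rpos) gr.
have [_ [m fgm]] := Cb_sub fC gC; have m0 : 0 <= m by exact: le_trans (fgm 0).
have [c c0 cE] := norm_on_finite (@cball R d `|tau e r T r0|) m0 fgm.
rewrite cE -EFinD; apply/norm_onP; first by rewrite addr_ge0 // ltW.
move=> x Kx; apply: (rf_tight hS e0 rpos r00 tT c0 fC gC fr gr) => [y yr|].
  by apply: (norm_le_norm_on c0 cE); exact: le_trans yr (ler_norm _).
exact: Kr.
Qed.

Lemma operator_translate P f x y : convex_operator (@Cb R d) P -> Cb f ->
  P (translate x f) y = translate x (P f) y.
Proof.
move=> hP fC; rewrite /translate addrC -(co_shift hP) //; congr (P _ y).
by apply/funext => z; rewrite addrC.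
Qed.

Lemma operator_lipschitz P f r : convex_operator (@Cb R d) P -> Cb f ->
  lipschitz_with r f -> lipschitz_with r (P f).
Proof.
move=> hP fC fr x y; have -> : x = y + (x - y) by rewrite addrC subrK.
apply: le_trans (co_modulus hP (z := x - y) (c := r * enorm (x - y)) fC _ y) _.
  by move=> z; apply: le_trans (fr _ _) _; rewrite addrAC subrr add0r.
by rewrite [y + _ - y]addrAC subrr add0r.
Qed.

Lemma operator_Lipb_le P f r c : convex_operator (@Cb R d) P -> Cb f ->
  lipschitz_with r f -> (forall x, `|f x| <= c) -> Lipb_le (`|r| + c) (P f).
Proof.
move=> hP fC fr fc; have c0 : 0 <= c by exact: le_trans (fc 0).
split.
  move=> x y; apply: le_trans (operator_lipschitz hP fC fr x y) _.
  by apply: ler_wpM2r; [exact: enorm_ge0|rewrite (le_trans (ler_norm _)) // lerDl].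
apply/supnormP; first by rewrite addr_ge0.
by move=> x; apply: le_trans (co_bound hP fC fc x) _; rewrite lerDr.
Qed.

Lemma BL_equicontinuous C (u : nat -> X -> R) : (forall n, BL C (u n)) ->
  uniformly_equicontinuous u.
Proof.
move=> uC e e0; have C0 := BL_ge0 (uC 0%N).
exists (e / (C + 1)); first by rewrite divr_gt0 // ltr_wpDl.
move=> n x y; rewrite ltr_pdivlMr ?ltr_wpDl // => xy.
apply: le_lt_trans (proj2 (uC n) x y) _; apply: le_lt_trans xy.
rewrite mulrC; apply: ler_pM => //; first exact: norm_le_enorm.
by rewrite lerDl.
Qed.

Lemma smooth_spline_sequence f : Cb f -> exists s : nat -> spline_data,
  cvgCb (fun k => @smooth_spline R d (s k)) f /\
  forall k, (supnorm (@smooth_spline R d (s k)) <= supnorm f)%E.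
Proof.
move=> fC; have [c [c0 cE fc]] := Cb_supnorm fC.
have H1 k : exists s, (forall x, `|@smooth_spline R d s x| <= c) /\
    forall x, `|x| <= k%:R -> `|smooth_spline s x - f x| <= (k.+1%:R)^-1.
  by apply: smooth_spline_dense => //; rewrite invr_gt0.
have [s Hs] := choice H1; exists s; split; last first.
  by move=> k; rewrite cE; apply/supnormP => // x; exact: (Hs k).1.
apply/cvgCbP; split=> //.
- by move=> k; have [B [p [Q tB]]] := @smooth_spline_taylor R d (s k); exact: BL_Cb (ty_v tB).
- by exists c => k; exact: (Hs k).1.
- move=> r e r0 e0; exists (Num.bound r + Num.bound e^-1)%N => k x Nk xr.
  have rk : r <= k%:R.
    apply: ltW; apply: lt_le_trans (archi_boundP r0) _; rewrite ler_nat.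
    by apply: leq_trans Nk; rewrite leq_addr.
  apply: le_trans ((Hs k).2 x (le_trans xr rk)) _.
  have ei0 : 0 <= e^-1 by rewrite invr_ge0 ltW.
  rewrite invf_ple ?posrE // ltW // (lt_le_trans (archi_boundP ei0)) // ler_nat.
  by apply: leq_trans (leq_trans (leq_addl _ _) Nk) (leqnSn k).
Qed.

End Conditions.

(** * Convergence of the semigroups *)

Theorem theorem3p6 (R : realType) (d : nat)
    (phi : nat -> 'M[R]_d * 'rV[R]_d -> \bar R)
    (H : 'M[R]_d * 'rV[R]_d -> R)
    (phi_ge0 : forall n p, psd p.1 -> (0 <= phi n p)%E)
    (phi_zero : forall n, exists2 p, psd p.1 & phi n p = 0%E)
    (phi_coercive : forall M : R, exists rho : R,
       forall (a : 'M[R]_d) (b : 'rV[R]_d), psd a ->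
         rho < enorm a + enorm b ->
         (M%:E <= ereal_inf
            [set phi n (a, b) * ((enorm a + enorm b)^-1)%:E | n in [set: nat]])%E)
    (H_cvg : forall K : set ('M[R]_d * 'rV[R]_d), compact K ->
       (fun n => esup_abs K (fun p => hamiltonian (phi n) p - (H p)%:E)%E)
         @ \oo --> 0%E) :
  exists S_ : nat -> R -> ('rV[R]_d -> R) -> 'rV[R]_d -> R,
    (forall n, convex_monotone_semigroup (S_ n)) /\
    (forall n f, Cb_infty f ->
       exists2 g, generator (S_ n) f g &
         forall x, hamiltonian (phi n) (hessian f x, gradient f x) = (g x)%:E) /\
    (* (1) *)
    (forall r T : R, 0 <= r -> 0 <= T -> exists2 c : R, 0 <= c &
       forall n (t : R) f g, 0 <= t <= T -> Cb f -> Cb g ->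
         (supnorm f <= r%:E)%E -> (supnorm g <= r%:E)%E ->
         (supnorm (S_ n t f \- S_ n t g)%R
            <= c%:E * supnorm (f \- g)%R)%E) /\
    (* (2) *)
    (forall (e r T : R) (K : set 'rV[R]_d), 0 < e -> 0 <= r -> 0 <= T ->
       compact K ->
       exists (c : R) (K' : set 'rV[R]_d), 0 <= c /\ compact K' /\
       forall n (t : R) f g, 0 <= t <= T -> Cb f -> Cb g ->
         (supnorm f <= r%:E)%E -> (supnorm g <= r%:E)%E ->
         (norm_on K (S_ n t f \- S_ n t g)%R
            <= c%:E * norm_on K' (f \- g)%R + e%:E)%E) /\
    (* (3) *)
    (exists D0 : set ('rV[R]_d -> R),
       countable D0 /\ (forall f, D0 f -> Cb f) /\
       (forall f, D0 f ->
          exists fb gb : nat -> 'rV[R]_d -> R,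
            (forall n, generator (S_ n) (fb n) (gb n)) /\
            cvgCb fb f /\
            (forall n, (supnorm (fb n) <= supnorm f)%E) /\
            (exists l, cvgCb gb l) /\
            (forall t : R, 0 <= t -> exists tb : nat -> R,
               (forall n, 0 <= tb n) /\ tb @ \oo --> t /\
               uniformly_equicontinuous (fun n => S_ n (tb n) (fb n)))) /\
       (forall f, Cb f -> exists u : nat -> 'rV[R]_d -> R,
          (forall n, D0 (u n)) /\ cvgCb u f /\
          (forall n, (supnorm (u n) <= supnorm f)%E))) /\
    (* (4) *)
    (forall f (e : R), Lipb f -> 0 < e ->
       exists (del t0 : R) (u : nat -> 'rV[R]_d -> R),
         0 < del /\ 0 < t0 /\ cvgCb u f /\
         forall n (t : R) x, 0 <= t <= t0 -> enorm x <= del -> forall y,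
           S_ n t (translate x (u n)) y <= translate x (S_ n t (u n)) y + e * t) /\
    (* (5) *)
    (forall f, Lipb f -> exists r t0 : R, 0 < r /\ 0 < t0 /\
       forall n (t : R), 0 <= t <= t0 -> Lipb_le r (S_ n t f)) /\
    (* (6) *)
    (forall f, Cb_infty f ->
       exists fb gb : nat -> 'rV[R]_d -> R,
         (forall n, generator (S_ n) (fb n) (gb n)) /\
         cvgCb fb f /\ exists l, cvgCb gb l) /\
    exists S : R -> ('rV[R]_d -> R) -> 'rV[R]_d -> R,
      convex_monotone_semigroup S /\
      (forall f (t : R), Cb f -> 0 <= t -> cvgCb (fun n => S_ n t f) (S t f)) /\
      (forall f, Cb_infty f ->
         generator S f (fun x => H (hessian f x, gradient f x))).
Proof.
have [rho0 Hrho0] := choice phi_coercive.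
(* The threshold is moved to at least 1 to serve all the estimates. *)
pose rho m := `|rho0 m| + 1.
have rho1 m : 1 <= rho m by rewrite /rho lerDr.
pose adm n := finite_cost (phi n); pose cost n := real_cost (phi n).
have coer n m a b : psd a -> rho m < enorm a + enorm b ->
    (m%:E <= phi n (a, b) * ((enorm a + enorm b)^-1)%:E)%E.
  move=> apsd big; have big' : rho0 m < enorm a + enorm b.
    by apply: le_lt_trans big; rewrite /rho (le_trans (ler_norm _)) // lerDl.
  apply: le_trans (Hrho0 m a b apsd big') _; apply: ereal_inf_lbound.
  by exists n.
have cp n : control_problem rho (adm n) (cost n).
  exact: control_problem_of_cost (phi_ge0 n) (phi_zero n) rho1 (coer n).
have hamE n q : hamiltonian (phi n) q = (ham (adm n) (cost n) q)%:E.
  exact: hamiltonianE (phi_ge0 n) (phi_zero n) rho1 (coer n) q.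
have ham_cvg B e : 0 <= B -> 0 < e -> exists N, forall n (q : 'M[R]_d * 'rV[R]_d),
    (N <= n)%N -> `|q.1| <= B -> `|q.2| <= B ->
    `|ham (adm n) (cost n) q - H q| <= e.
  move=> B0 e0; have K := H_cvg _ (compact_pair_ball B0).
  have pos n : (0 <= esup_abs [set q : 'M[R]_d * 'rV[R]_d | `|q.1| <= B /\ `|q.2| <= B]%R
     (fun p => hamiltonian (phi n) p - (H p)%:E))%E by exact: esup_abs_ge0.
  have [N HN] := (ecvg0P pos).1 K e e0.
  exists N => n q Nn q1 q2; have := HN n Nn.
  rewrite esup_absP ?(ltW e0) // => /(_ q (conj q1 q2)).
  by rewrite hamE -EFinB /= lee_fin.
have [tau [kap Hreg]] := @scheme_regular R d rho rho1.
have [om [om0 Hom]] := @scheme_limit_consistent R d rho rho1.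
have Vreg n k : regular_family tau kap (scheme (adm n) (cost n) k) by exact: Hreg.
have Sreg n := semigroup_regular rho1 cp Vreg n.
have Scons n : consistent om (semigroup adm cost n) (ham (adm n) (cost n)).
  by apply: Hom => // f t x; exact: (semigroup_limit rho1 cp Vreg).
have Sgen n B v p Q : taylor B v p Q ->
    generator (semigroup adm cost n) v (fun x => ham (adm n) (cost n) (Q x, p x)).
  exact: (semigroup_generator rho1 cp Vreg ham_cvg om0 Scons).
have Hcvg B v p Q := @ham_cvgCb R d rho adm cost cp H ham_cvg B v p Q.
have op n t := rf_op (Sreg n) (t := t).
exists (semigroup adm cost).
split; [|split; [|split; [|split; [|split; [|split; [|split; [|split]]]]]]].
- by move=> n; apply: regular_semigroup (Sreg n) _ => s t f; exact: (semigroup_add rho1 cp Vreg).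
- move=> n f fI; have [B tB] := Cb_infty_taylor fI.
  by exists (fun x => ham (adm n) (cost n) (hessian f x, gradient f x)); [exact: Sgen tB|].
- move=> r T r0 T0; exists 1 => // n t f g /andP[t0 _] fC gC _ _; rewrite mul1e.
  exact: contraction_supnorm (op n t t0) fC gC.
- move=> e r T K e0 r0 T0 cK; have [R0 R00 KR] := compact_sub_cball cK.
  exists 1, (cball `|tau e r T R0|); split=> //; split; first exact: compact_cball.
  move=> n t f g tT fC gC fr gr; rewrite mul1e.
  exact: regular_family_tight (Sreg n) e0 r0 R00 KR tT fC gC fr gr.
- exists (range (@smooth_spline R d)); split; first exact: countable_smooth_splines.
  have sC s : exists B p Q, taylor B (@smooth_spline R d s) p Q := @smooth_spline_taylor R d s.
  split; first by move=> _ [s _ <-]; have [B [p [Q tB]]] := sC s; exact: BL_Cb (ty_v tB).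
  split; last first.
    move=> f fC; have [s [s1 s2]] := smooth_spline_sequence fC.
    by exists (fun k => smooth_spline (s k)); split=> // k; exists (s k).
  move=> _ [s _ <-]; have [B [p [Q tB]]] := sC s.
  exists (fun=> smooth_spline s), (fun n x => ham (adm n) (cost n) (Q x, p x)).
  split; first by move=> n; exact: Sgen tB.
  split; first by apply: cvgCb_cst; exact: BL_Cb (ty_v tB).
  split; first by [].
  split; first by exists (fun x => H (Q x, p x)); exact: Hcvg tB.
  move=> t t0; exists (fun=> t); split=> //; split; first exact: cvg_cst.
  by apply: (@BL_equicontinuous R d B) => n; exact: (co_BL (op n t t0) (ty_v tB)).
- move=> f e [fC _] e0; exists 1, 1, (fun=> f); do 3 (split=> //); first exact: cvgCb_cst.
  move=> n t x /andP[t0 _] _ y; rewrite (operator_translate _ _ (op n t t0) fC).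
  by rewrite lerDl mulr_ge0 // ltW.
- move=> f [fC [r fr]]; have [c [c0 _ fc]] := Cb_supnorm fC.
  exists (`|r| + (c + 1)), 1; split; first by rewrite ltr_wpDl // ltr_wpDl.
  split=> // n t /andP[t0 _]; apply: operator_Lipb_le (op n t t0) fC fr _ => x.
  by apply: le_trans (fc x) _; rewrite lerDl.
- move=> f fI; have [B tB] := Cb_infty_taylor fI.
  exists (fun=> f), (fun n x => ham (adm n) (cost n) (hessian f x, gradient f x)).
  split; first by move=> n; exact: Sgen tB.
  split; first by apply: cvgCb_cst; exact: BL_Cb (ty_v tB).
  by exists (fun x => H (hessian f x, gradient f x)); exact: Hcvg tB.
- exists (limit_semigroup adm cost); split.
    apply: regular_semigroup (limit_semigroup_regular rho1 cp Vreg ham_cvg) _ => s t f.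
    exact: (limit_semigroup_add rho1 cp Vreg ham_cvg).
  split; first by move=> f t; exact: (limit_semigroup_cvg rho1 cp Vreg ham_cvg).
  move=> f fI; have [B tB] := Cb_infty_taylor fI.
  exact: (limit_semigroup_generator rho1 cp Vreg ham_cvg om0 Scons tB).
Qed.
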